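(* The system $\mathrm{RCA}_0^\omega+\mathrm{IND}+\mathrm{CAU}_{\mathrm{net}}$ proves $\mathrm{HBU}$. Here $\mathrm{CAU}_{\mathrm{net}}$ is the statement that every Cauchy net in $[0,1]$ indexed by a subset of Baire space converges to a limit, and $\mathrm{HBU}$ is the statement that for every $\Psi:\mathbb{R}\to\mathbb{R}^+$ there are finitely many $y_1,\dots,y_k\in[0,1]$ such that $(\forall x\in[0,1])(\exists i\le k)\big(x\in(y_i-\Psi(y_i),y_i+\Psi(y_i))\big)$.
   Context: Base theory. Finite types: $0$ (natural numbers) is a type, and if $\sigma,\tau$ are types then so is $\sigma\to\tau$ (mappings from type $\sigma$ to type $\tau$ objects); $1:=0\to0$ and $n+1:=n\to0$; a superscript on a variable is its type. $L_\omega$ is the language with variables and quantifiers of all finite types, constants $0,1,<_0,+_0,\times_0,=_0$ on $\mathbb{N}$, the combinators $\Pi,\Sigma$ and a recursor constant $\mathbf{R}_0$. Equality at higher types is defined extensionally: $x=_\tau y$ iff $xz_1\dots z_k=_0yz_1\dots z_k$ for all arguments. $\mathrm{QF\text{-}AC}^{\sigma,\tau}$ is the schema $(\forall x^\sigma)(\exists y^\tau)A(x,y)\to(\exists Y^{\sigma\to\tau})(\forall x^\sigma)A(x,Y(x))$ for quantifier-free $A$ of $L_\omega$ (parameters of any type allowed). $\mathrm{RCA}_0^\omega$ is the theory in $L_\omega$ with classical logic and the axioms: $\mathbb{N}$ is an ordered semi-ring; the defining axioms of $\Pi,\Sigma$ (giving $\lambda$-abstraction); $\mathbf{R}_0(f,m,0)=m$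 and $\mathbf{R}_0(f,m,n+1)=f(n,\mathbf{R}_0(f,m,n))$; extensionality $x=_\rho y\to\varphi(x)=_\tau\varphi(y)$ for all types $\rho,\tau$ and $\varphi^{\rho\to\tau}$; induction for quantifier-free formulas of $L_\omega$; $\mathrm{QF\text{-}AC}^{1,0}$. $\mathrm{IND}$ is the induction schema for all formulas of $L_\omega$. Reals. A real is a sequence of rationals $(q_n)$ with $|q_n-q_{n+i}|<2^{-n}$ for all $n,i$ (a type 1 object); $(q_n)=_{\mathbb{R}}(r_n)$ iff $|q_n-r_n|\le2^{-n+1}$ for all $n$. A function $\mathbb{R}\to\mathbb{R}$ is a type $1\to1$ functional mapping equal reals to equal reals. Sets. A subset $D$ of Baire space $\mathbb{N}^{\mathbb{N}}$ is given by a characteristic function $F_D^2\le1$ ($f\in D$ means $F_D(f)=1$); a binary relation $\preceq$ on $D$ is likewise given by a characteristic function of type $(1\times1)\to0$. Via coding (and extensionality with respect to $=_{\mathbb{R}}$), subsets of $\mathbb{R}$ and sets of finite sequences of reals, and relations on them, are included. Nets. $(D,\preceq)$ with $D\neq\emptyset$ is directed if $\preceq$ is transitive and reflexive on $D$ and for all $x,y\in D$ there is $z\in D$ with $x\preceq z$ and $y\preceq z$. A net in $X\subseteq\mathbb{R}$ is a map $x_d:D\to X$ with $(D,\preceq)$ directed; all index sets are subsets of Baire space given by characteristic functions $F_D^2\le1$, with $\preceq$ given by a characteristic function of type $(1\times1)\to0$ (including, via coding, subsets of $\mathbb{R}$ and sets of finite sequences of reals). The net $x_d$ is Cauchy if $(\forall\varepsilon>0)(\exists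 d\in D)(\forall e,f\succeq d)(|x_e-x_f|<\varepsilon)$. It converges to $y$ if $(\forall\varepsilon>0)(\exists d_0\in D)(\forall e\succeq d_0)(|x_e-y|<\varepsilon)$. *)

(* Defs.v *)
From Stdlib Require Import List.
Import ListNotations.

Set Implicit Arguments.
Unset Strict Implicit.
Unset Printing Implicit Defensive.

Inductive ty : Type :=
| N : ty
| Arr : ty -> ty -> ty.

Declare Scope ty_scope.
Delimit Scope ty_scope with ty.
Bind Scope ty_scope with ty.
Infix "⇒" := Arr (at level 60, right associativity) : ty_scope.
Local Open Scope ty_scope.

Notation N1 := (N ⇒ N).
Notation N2 := (N1 ⇒ N).

(** Terms and formulas are intrinsically typed, with de Bruijn variables: a
    context lists the types of the free variables, the most recently bound one
    first, and [var Γ σ] is the type of the variables of type [σ] in [Γ]. *)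
Definition ctx := list ty.

Inductive var : ctx -> ty -> Type :=
| vz : forall Γ σ, var (σ :: Γ) σ
| vs : forall Γ σ ρ, var Γ σ -> var (ρ :: Γ) σ.
Arguments vz {Γ σ}.
Arguments vs {Γ σ ρ} _.

Inductive cst : ty -> Type :=
| cZero : cst N
| cOne : cst N
| cPlus : cst (N ⇒ N ⇒ N)
| cTimes : cst (N ⇒ N ⇒ N)
| cPi : forall σ τ, cst (σ ⇒ τ ⇒ σ)
| cSigma : forall ρ σ τ, cst ((ρ ⇒ σ ⇒ τ) ⇒ (ρ ⇒ σ) ⇒ ρ ⇒ τ)
| cRec : cst ((N ⇒ N ⇒ N) ⇒ N ⇒ N ⇒ N).

Inductive tm (Γ : ctx) : ty -> Type :=
| Var : forall σ, var Γ σ -> tm Γ σ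
| Cst : forall σ, cst σ -> tm Γ σ
| App : forall σ τ, tm Γ (σ ⇒ τ) -> tm Γ σ -> tm Γ τ.
Arguments Var {Γ σ} _.
Arguments Cst {Γ σ} _.
Arguments App {Γ σ τ} _ _.

(** The connectives other than falsity, implication and the universal
    quantifier are the usual classical abbreviations (see below). *)
Inductive form : ctx -> Type :=
| Eq0 : forall Γ, tm Γ N -> tm Γ N -> form Γ
| Lt0 : forall Γ, tm Γ N -> tm Γ N -> form Γ
| Bot : forall Γ, form Γ
| Imp : forall Γ, form Γ -> form Γ -> form Γ
| All : forall Γ σ, form (σ :: Γ) -> form Γ.
Arguments Bot {Γ}.

Fixpoint quantifier_free Γ (A : form Γ) : Prop :=
  match A with
  | Eq0 _ _ | Lt0 _ _ | Bot => True
  | Imp A B => quantifier_free A /\ quantifier_free B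
  | All _ => False
  end.

Definition sub (Γ Δ : ctx) : Type := forall σ, var Γ σ -> tm Δ σ.

Fixpoint tsub Γ Δ (θ : sub Γ Δ) σ (t : tm Γ σ) : tm Δ σ :=
  match t with
  | Var x => θ _ x
  | Cst c => Cst c
  | App f a => App (tsub θ f) (tsub θ a)
  end.

Definition shift Γ ρ : sub Γ (ρ :: Γ) := fun _ x => Var (vs x).

Definition wk Γ ρ σ (t : tm Γ σ) : tm (ρ :: Γ) σ := tsub (@shift Γ ρ) t.

Definition scons Γ Δ ρ (t : tm Δ ρ) (θ : sub Γ Δ) : sub (ρ :: Γ) Δ :=
  fun σ x =>
    match x in var Γ' σ
      return match Γ' with
             | [] => unit
             | ρ' :: Γ'' => tm Δ ρ' -> sub Γ'' Δ -> tm Δ σ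
             end
    with
    | vz => fun t _ => t
    | vs y => fun _ θ => θ _ y
    end t θ.

Definition up Γ Δ ρ (θ : sub Γ Δ) : sub (ρ :: Γ) (ρ :: Δ) :=
  scons (Var vz) (fun _ x => wk ρ (θ _ x)).

Fixpoint fsub Γ (A : form Γ) : forall Δ, sub Γ Δ -> form Δ :=
  match A with
  | Eq0 s t => fun _ θ => Eq0 (tsub θ s) (tsub θ t)
  | Lt0 s t => fun _ θ => Lt0 (tsub θ s) (tsub θ t)
  | Bot => fun _ _ => Bot
  | Imp A B => fun _ θ => Imp (fsub A θ) (fsub B θ)
  | All A => fun _ θ => All (fsub A (up θ))
  end.

Definition inst Γ σ (A : form (σ :: Γ)) (t : tm Γ σ) : form Γ :=
  fsub A (scons t (fun _ x => Var x)).

Definition Not Γ (A : form Γ) := Imp A Bot.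
Definition And Γ (A B : form Γ) := Not (Imp A (Not B)).
Definition Or Γ (A B : form Γ) := Imp (Not A) B.
Definition Ex Γ σ (A : form (σ :: Γ)) : form Γ := Not (All (Not A)).

(** Binders are written with Rocq functions that are applied to the newly bound
    variable; a variable used below further binders is weakened explicitly,
    once per binder, with the postfix [↑]. *)
Definition fall Γ σ (A : tm (σ :: Γ) σ -> form (σ :: Γ)) : form Γ :=
  All (A (Var vz)).
Definition fex Γ σ (A : tm (σ :: Γ) σ -> form (σ :: Γ)) : form Γ :=
  Ex (A (Var vz)).

Declare Scope tm_scope.
Delimit Scope tm_scope with tm.
Bind Scope tm_scope with tm.
Declare Scope form_scope.
Delimit Scope form_scope with form.
Bind Scope form_scope with form.
Local Open Scope tm_scope.

Notation "t ↑" := (wk _ t) (at level 1, left associativity, format "t ↑")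
  : tm_scope.
Notation "f · a" := (App f a) (at level 25, left associativity) : tm_scope.
Notation "0" := (Cst cZero) : tm_scope.
Notation "1" := (Cst cOne) : tm_scope.
Notation "s + t" := (App (App (Cst cPlus) s) t) : tm_scope.
Notation "s * t" := (App (App (Cst cTimes) s) t) : tm_scope.

Notation "s == t" := (Eq0 s%tm t%tm) (at level 70) : form_scope.
Notation "s < t" := (Lt0 s%tm t%tm) : form_scope.
Notation "A --> B" := (Imp A B) (at level 86, right associativity) : form_scope.
Notation "~ A" := (Not A) : form_scope.
Notation "A /\ B" := (And A B) : form_scope.
Notation "A \/ B" := (Or A B) : form_scope.
Notation "∀ x : σ , A" := (fall (fun x : tm (σ%ty :: _) σ%ty => A))
  (at level 200, x name, σ at level 99, A at level 200) : form_scope.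
Notation "∃ x : σ , A" := (fex (fun x : tm (σ%ty :: _) σ%ty => A))
  (at level 200, x name, σ at level 99, A at level 200) : form_scope.

Definition le0 Γ (s t : tm Γ N) : form Γ :=
  (s < t \/ s == t)%form.
Notation "s <= t" := (le0 s%tm t%tm) : form_scope.

Fixpoint eqt Γ τ : tm Γ τ -> tm Γ τ -> form Γ :=
  match τ with
  | N => fun x y => (x == y)%form
  | σ ⇒ τ => fun x y => (∀ z : σ, eqt (x↑ · z) (y↑ · z))%form
  end.
Notation "x ≡ y" := (eqt x%tm y%tm) (at level 70) : form_scope.

(** λ-abstraction, defined from the combinators by bracket abstraction. *)
Definition abs_var Γ σ τ (x : var (σ :: Γ) τ) : tm Γ (σ ⇒ τ) :=
  match x in var Γ' τ
    return match Γ' with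
           | [] => unit
           | σ :: Γ => tm Γ (σ ⇒ τ)
           end
  with
  | @vz _ σ => Cst (cSigma σ (σ ⇒ σ) σ) · Cst (cPi σ (σ ⇒ σ)) · Cst (cPi σ σ)
  | vs y => Cst (cPi _ _) · Var y
  end.

Fixpoint abs Γ σ τ (t : tm (σ :: Γ) τ) : tm Γ (σ ⇒ τ) :=
  match t with
  | Var x => abs_var x
  | Cst c => Cst (cPi _ _) · Cst c
  | App f a => Cst (cSigma _ _ _) · abs f · abs a
  end.

Definition lam Γ σ τ (t : tm (σ :: Γ) σ -> tm (σ :: Γ) τ) : tm Γ (σ ⇒ τ) :=
  abs (t (Var vz)).
Notation "'λ' x : σ , t" := (lam (fun x : tm (σ%ty :: _) σ%ty => t%tm))
  (at level 200, x name, σ at level 99, t at level 200) : tm_scope.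

Inductive nd : forall Γ, list (form Γ) -> form Γ -> Prop :=
| nd_hyp : forall Γ (H : list (form Γ)) A, In A H -> nd H A
| nd_impI : forall Γ (H : list (form Γ)) A B, nd (A :: H) B -> nd H (A --> B)
| nd_impE : forall Γ (H : list (form Γ)) A B, nd H (A --> B) -> nd H A -> nd H B
| nd_raa : forall Γ (H : list (form Γ)) A, nd (Not A :: H) Bot -> nd H A
| nd_allI : forall Γ σ (H : list (form Γ)) (A : form (σ :: Γ)),
    nd (map (fun B => fsub B (@shift Γ σ)) H) A -> nd H (All A)
| nd_allE : forall Γ σ (H : list (form Γ)) (A : form (σ :: Γ)) (t : tm Γ σ),
    nd H (All A) -> nd H (inst A t).

Definition sentence := form [].
Definition theory := sentence -> Prop.

Definition proves (T : theory) (A : sentence) : Prop :=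
  exists H : list sentence, (forall B, In B H -> T B) /\ nd H A.

Definition union (T U : theory) : theory := fun A => T A \/ U A.
Definition single (A : sentence) : theory := fun B => B = A.

Declare Scope theory_scope.
Delimit Scope theory_scope with theory.
Bind Scope theory_scope with theory.
Notation "T ∪ U" := (union T U) (at level 50, left associativity)
  : theory_scope.
Notation "T ⊢ A" := (proves T%theory A%form) (at level 75) : type_scope.

Fixpoint closure Γ : form Γ -> sentence :=
  match Γ with
  | [] => fun A => A
  | σ :: Γ => fun A => closure (All A)
  end.

Local Open Scope form_scope.

(** [N] is a (nonnegatively, discretely) ordered commutative semi-ring, with
    [==] an equality; congruence of [+] and [*] is an instance of the
    extensionality axioms of [RCA0ω]. *)
Inductive semiring_axiom : theory :=
| sr_eq_refl : semiring_axiom (∀ x : N, x == x)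
| sr_eq_sym : semiring_axiom (∀ x : N, ∀ y : N, x↑ == y --> y == x↑)
| sr_eq_trans : semiring_axiom
    (∀ x : N, ∀ y : N, ∀ z : N, x↑↑ == y↑ --> y↑ == z --> x↑↑ == z)
| sr_lt_congr : semiring_axiom
    (∀ x : N, ∀ y : N, ∀ u : N, ∀ v : N,
      x↑↑↑ == y↑↑ --> u↑ == v --> x↑↑↑ < u↑ --> y↑↑ < v)
| sr_add_assoc : semiring_axiom
    (∀ x : N, ∀ y : N, ∀ z : N, (x↑↑ + y↑) + z == x↑↑ + (y↑ + z))
| sr_add_comm : semiring_axiom (∀ x : N, ∀ y : N, x↑ + y == y + x↑)
| sr_add_0 : semiring_axiom (∀ x : N, x + 0 == x)
| sr_mul_assoc : semiring_axiom
    (∀ x : N, ∀ y : N, ∀ z : N, (x↑↑ * y↑) * z == x↑↑ * (y↑ * z))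
| sr_mul_comm : semiring_axiom (∀ x : N, ∀ y : N, x↑ * y == y * x↑)
| sr_mul_1 : semiring_axiom (∀ x : N, x * 1 == x)
| sr_mul_0 : semiring_axiom (∀ x : N, x * 0 == 0)
| sr_mul_add : semiring_axiom
    (∀ x : N, ∀ y : N, ∀ z : N, x↑↑ * (y↑ + z) == x↑↑ * y↑ + x↑↑ * z)
| sr_lt_irrefl : semiring_axiom (∀ x : N, ~ (x < x))
| sr_lt_trans : semiring_axiom
    (∀ x : N, ∀ y : N, ∀ z : N, x↑↑ < y↑ --> y↑ < z --> x↑↑ < z)
| sr_lt_total : semiring_axiom
    (∀ x : N, ∀ y : N, x↑ < y \/ x↑ == y \/ y < x↑)
| sr_lt_add : semiring_axiom
    (∀ x : N, ∀ y : N, ∀ z : N, x↑↑ < y↑ --> x↑↑ + z < y↑ + z)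
| sr_lt_mul : semiring_axiom
    (∀ x : N, ∀ y : N, ∀ z : N, 0 < z --> x↑↑ < y↑ --> x↑↑ * z < y↑ * z)
| sr_lt_01 : semiring_axiom (0 < 1)
| sr_le_0 : semiring_axiom (∀ x : N, 0 <= x)
| sr_lt_discrete : semiring_axiom (∀ x : N, ∀ y : N, x↑ < y --> x↑ + 1 <= y).

Definition induction Γ (A : form (N :: Γ)) : form Γ :=
  inst A 0 -->
  All (A --> fsub A (scons (Var vz + 1) (fun _ x => Var (vs x)))) -->
  All A.

(** [(∀ x^1)(∃ y^0) A(x, y) --> (∃ Y^2)(∀ x^1) A(x, Y x)]; in [A] the variable
    0 is [y], the variable 1 is [x], and the others are parameters. *)
Definition choice10 Γ (A : form (N :: N1 :: Γ)) : form Γ :=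
  All (Ex A) -->
  ∃ Y : N2, ∀ x : N1,
    fsub A (scons (Y↑ · x) (scons x (fun _ p => Var (vs (vs p))))).

Inductive RCA0ω : theory :=
| ax_semiring : forall A, semiring_axiom A -> RCA0ω A
| ax_Pi : forall σ τ,
    RCA0ω (∀ x : σ, ∀ y : τ, Cst (cPi σ τ) · x↑ · y ≡ x↑)
| ax_Sigma : forall ρ σ τ,
    RCA0ω (∀ x : ρ ⇒ σ ⇒ τ, ∀ y : ρ ⇒ σ, ∀ z : ρ,
      Cst (cSigma ρ σ τ) · x↑↑ · y↑ · z ≡ x↑↑ · z · (y↑ · z))
| ax_rec_0 :
    RCA0ω (∀ f : N ⇒ N ⇒ N, ∀ m : N, Cst cRec · f↑ · m · 0 == m)
| ax_rec_S :
    RCA0ω (∀ f : N ⇒ N ⇒ N, ∀ m : N, ∀ n : N,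
      Cst cRec · f↑↑ · m↑ · (n + 1)
        == f↑↑ · n · (Cst cRec · f↑↑ · m↑ · n))
| ax_ext : forall ρ τ,
    RCA0ω (∀ φ : ρ ⇒ τ, ∀ x : ρ, ∀ y : ρ,
      x↑ ≡ y --> φ↑↑ · x↑ ≡ φ↑↑ · y)
| ax_qf_ind : forall Γ (A : form (N :: Γ)),
    quantifier_free A -> RCA0ω (closure (induction A))
| ax_qf_ac10 : forall Γ (A : form (N :: N1 :: Γ)),
    quantifier_free A -> RCA0ω (closure (choice10 A)).

Inductive IND : theory :=
| ax_ind : forall Γ (A : form (N :: Γ)), IND (closure (induction A)).

Section Arithmetic.
Variable Γ : ctx.
Implicit Types m n : tm Γ N.

Definition npred n : tm Γ N := Cst cRec · (λ i : N, λ r : N, i↑) · 0 · n.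

(** Truncated subtraction [m - n]. *)
Definition monus m n : tm Γ N :=
  Cst cRec · (λ i : N, λ r : N, Cst cRec · (λ j : N, λ s : N, j↑) · 0 · r)
    · m · n.

Definition pow2 n : tm Γ N := Cst cRec · (λ i : N, λ r : N, r + r) · 1 · n.

(** The triangular number [0 + 1 + ... + n]. *)
Definition tri n : tm Γ N :=
  Cst cRec · (λ i : N, λ r : N, r + (i↑ + 1)) · 0 · n.
End Arithmetic.

Section Rationals.
Variable Γ : ctx.
Implicit Types m n p q a b c : tm Γ N.

(** Cantor's bijective pairing; [nroot q] is the largest [w] such that
    [tri w <= q], computed by recursion on [q]. *)
Definition npair m n : tm Γ N := tri (m + n) + m.
Definition nroot q : tm Γ N :=
  Cst cRec
    · (λ i : N, λ w : N, w + monus 1 (monus (tri (w + 1)) (i↑ + 1))) · 0 · q.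
Definition nfst q : tm Γ N := monus q (tri (nroot q)).
Definition nsnd q : tm Γ N := monus (nroot q) (nfst q).

(** Every number codes a rational: [rat a b c] codes [(a - b) / (c + 1)]. *)
Definition rat a b c : tm Γ N := npair (npair a b) c.
Definition qpos q : tm Γ N := nfst (nfst q).
Definition qneg q : tm Γ N := nsnd (nfst q).
Definition qden q : tm Γ N := nsnd q + 1.

Definition qadd p q : tm Γ N :=
  rat (qpos p * qden q + qpos q * qden p) (qneg p * qden q + qneg q * qden p)
      (npred (qden p * qden q)).
Definition qopp q : tm Γ N := rat (qneg q) (qpos q) (nsnd q).
Definition qabs q : tm Γ N :=
  rat (monus (qpos q) (qneg q) + monus (qneg q) (qpos q)) 0 (nsnd q).
Definition qlt p q : form Γ :=
  qpos p * qden q + qneg q * qden p < qpos q * qden p + qneg p * qden q.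
Definition qle p q : form Γ :=
  qpos p * qden q + qneg q * qden p <= qpos q * qden p + qneg p * qden q.

(** The rational [2^-n]. *)
Definition qhalf n : tm Γ N := rat 1 0 (npred (pow2 n)).
End Rationals.

Section Reals.
Variable Γ : ctx.
Implicit Types x y : tm Γ N1.

Definition is_real x : form Γ :=
  ∀ n : N, ∀ i : N,
    qlt (qabs (qadd (x↑↑ · n↑) (qopp (x↑↑ · (n↑ + i))))) (qhalf n↑).

(** The bound is [2^(-n+1) = 2^-n + 2^-n]. *)
Definition req x y : form Γ :=
  ∀ n : N, qle (qabs (qadd (x↑ · n) (qopp (y↑ · n)))) (qadd (qhalf n) (qhalf n)).

(** Since [|x - x n| <= 2^-n] for a real [x], this says that some rational
    approximations to [x] and [y] witness [x < y]. *)
Definition rlt x y : form Γ :=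
  ∃ n : N, qlt (qadd (x↑ · n) (qadd (qhalf n) (qhalf n))) (y↑ · n).
Definition rle x y : form Γ := ~ rlt y x.

(** The index is shifted so that the sum converges at the required rate. *)
Definition radd x y : tm Γ N1 := λ n : N, qadd (x↑ · (n + 1)) (y↑ · (n + 1)).
Definition ropp x : tm Γ N1 := λ n : N, qopp (x↑ · n).
Definition rsub x y : tm Γ N1 := radd x (ropp y).
Definition rabs x : tm Γ N1 := λ n : N, qabs (x↑ · n).
Definition r0 : tm Γ N1 := λ n : N, rat 0 0 0.
Definition r1 : tm Γ N1 := λ n : N, rat 1 0 0.

Definition in_unit x : form Γ := is_real x /\ rle r0 x /\ rle x r1.
Definition is_pos x : form Γ := is_real x /\ rlt r0 x.
End Reals.
Arguments r0 {Γ}.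
Arguments r1 {Γ}.

Definition real_fun Γ (Φ : tm Γ (N1 ⇒ N1)) : form Γ :=
  (∀ x : N1, is_real x --> is_real (Φ↑ · x)) /\
  (∀ x : N1, ∀ y : N1, is_real x↑ --> is_real y --> req x↑ y -->
     req (Φ↑↑ · x↑) (Φ↑↑ · y)).
Definition pos_real_fun Γ (Φ : tm Γ (N1 ⇒ N1)) : form Γ :=
  real_fun Φ /\ (∀ x : N1, is_real x --> rlt r0 (Φ↑ · x)).

Section Nets.
Variable Γ : ctx.

(** [D] is the characteristic function of a subset of Baire space, [R] that of
    a binary relation, and [X] maps the elements of [D] to reals. *)
Implicit Types (D : tm Γ N2) (R : tm Γ (N1 ⇒ N1 ⇒ N)) (X : tm Γ (N1 ⇒ N1)).

Definition is_set D : form Γ := ∀ d : N1, D↑ · d <= 1.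
Definition is_rel R : form Γ := ∀ d : N1, ∀ e : N1, R↑↑ · d↑ · e <= 1.

Definition mem D (d : tm Γ N1) : form Γ := D · d == 1.
Definition prec R (d e : tm Γ N1) : form Γ := R · d · e == 1.
End Nets.

Definition directed Γ (D : tm Γ N2) (R : tm Γ (N1 ⇒ N1 ⇒ N)) : form Γ :=
  (∃ d : N1, mem D↑ d) /\
  (∀ d : N1, mem D↑ d --> prec R↑ d d) /\
  (∀ d : N1, ∀ e : N1, ∀ f : N1,
     mem D↑↑↑ d↑↑ --> mem D↑↑↑ e↑ --> mem D↑↑↑ f -->
     prec R↑↑↑ d↑↑ e↑ --> prec R↑↑↑ e↑ f --> prec R↑↑↑ d↑↑ f) /\
  (∀ d : N1, ∀ e : N1, mem D↑↑ d↑ --> mem D↑↑ e -->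
     ∃ f : N1, mem D↑↑↑ f /\ prec R↑↑↑ d↑↑ f /\ prec R↑↑↑ e↑ f).

Definition net_in_unit Γ (D : tm Γ N2) (R : tm Γ (N1 ⇒ N1 ⇒ N))
    (X : tm Γ (N1 ⇒ N1)) : form Γ :=
  is_set D /\ is_rel R /\ directed D R /\
  (∀ d : N1, mem D↑ d --> in_unit (X↑ · d)).

Definition cauchy Γ (D : tm Γ N2) (R : tm Γ (N1 ⇒ N1 ⇒ N))
    (X : tm Γ (N1 ⇒ N1)) : form Γ :=
  ∀ ε : N1, is_pos ε -->
  ∃ d : N1, mem D↑↑ d /\
  ∀ e : N1, ∀ f : N1,
    mem D↑↑↑↑ e↑ --> mem D↑↑↑↑ f -->
    prec R↑↑↑↑ d↑↑ e↑ --> prec R↑↑↑↑ d↑↑ f -->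
    rlt (rabs (rsub (X↑↑↑↑ · e↑) (X↑↑↑↑ · f))) ε↑↑↑.

Definition converges_to Γ (D : tm Γ N2) (R : tm Γ (N1 ⇒ N1 ⇒ N))
    (X : tm Γ (N1 ⇒ N1)) (y : tm Γ N1) : form Γ :=
  ∀ ε : N1, is_pos ε -->
  ∃ d : N1, mem D↑↑ d /\
  ∀ e : N1, mem D↑↑↑ e --> prec R↑↑↑ d↑ e -->
    rlt (rabs (rsub (X↑↑↑ · e) y↑↑↑)) ε↑↑.

Definition CAU_net : sentence :=
  ∀ D : N2, ∀ R : N1 ⇒ N1 ⇒ N, ∀ X : N1 ⇒ N1,
    net_in_unit D↑↑ R↑ X --> cauchy D↑↑ R↑ X -->
    ∃ y : N1, is_real y /\ converges_to D↑↑↑ R↑↑ X↑ y.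

(** The finite sequence [y_1, ..., y_k] is given by its length [k] and a
    functional [Y] of type [0 -> 1], with [y_(i+1) = Y i] for [i < k]. *)
Definition HBU : sentence :=
  ∀ Ψ : N1 ⇒ N1, pos_real_fun Ψ -->
  ∃ k : N, ∃ Y : N ⇒ N1,
    (∀ i : N, i < k↑↑ --> in_unit (Y↑ · i)) /\
    (∀ x : N1, in_unit x -->
       ∃ i : N, i < k↑↑↑ /\
         rlt (rsub (Y↑↑ · i) (Ψ↑↑↑↑ · (Y↑↑ · i))) x↑ /\
         rlt x↑ (radd (Y↑↑ · i) (Ψ↑↑↑↑ · (Y↑↑ · i)))).

(* Main.v *)
(** By the completeness theorem for the calculus, it suffices to prove HBU in every
    extensional model; there the codes of rationals are read in an ordered field of
    fractions over the (possibly nonstandard) numbers of the model.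

    Consider chains of rationals q_0 <= 0, q_1, ..., q_k with 0 <= q_k <= 1, together
    with reals y_0, ..., y_(k-1) in [0, 1] such that rational approximations to y_i
    and Ψ(y_i) witness that q_i and q_(i+1) lie in the interval of radius Ψ(y_i)
    around y_i. Being such a chain is decidable, so the chains form an index set
    without any use of ∃². Ordered by q_k they carry the monotone net q_k, which is
    Cauchy by induction, and hence has a limit y. A chain whose last point is close
    to y can be prolonged by y itself to a rational well above y: as no chain in the
    index set ends there, that rational exceeds 1, and then the prolonged chain gives
    a finite cover of [0, 1]. *)

(* Arguing in a model replaces explicit derivations by ordinary mathematics, at one price: its
   numbers may be nonstandard and its functionals need not comprise all functions. Hence every
   induction must concern a predicate definable with parameters, and every functional must come from
   a term; [definable], [rep] and [Lam] keep this account.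

   The obstacle in the main argument is that an index set needs a characteristic functional, while
   being a real and comparing reals are not decided by any term at hand. So a chain stores, besides
   its rational points, arbitrary sequences that [hat] turns into reals of [0, 1], and indices at
   which strict rational inequalities leave room for all approximation errors. The limit of the net
   is only known to be a real, so it too passes through [hat] before Ψ is applied to it.

   Full induction enters because the statements proved by induction quantify over chains or compare
   reals. In particular no sequence of better and better chains has to be chosen: the induction runs
   over the mere existence of a chain that is good enough. *)
From HB Require Import structures.
From mathcomp Require Import all_boot all_order all_algebra generic_quotient.
From mathcomp Require Import boolp.
From mathcomp Require Import zify ring lra.
From Stdlib Require Import List Cantor Eqdep_dec.
Require Import Defs.
Import ListNotations.

Set Implicit Arguments.
Unset Strict Implicit.
Unset Printing Implicit Defensive.
Local Close Scope form_scope.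
Import Order.TTheory GRing.Theory Num.Theory.

(** * Substitution *)

Lemma var_ind_cons Γ ρ (P : forall σ, var (ρ :: Γ) σ -> Prop) :
  P ρ vz -> (forall σ (x : var Γ σ), P σ (vs x)) ->
  forall σ (x : var (ρ :: Γ) σ), P σ x.
Proof.
(* The motive is stated for every context by matching on it, so that [case] may abstract the index
   [ρ :: Γ]. *)
move=> Pz Ps σ x; pose Q Δ σ (x : var Δ σ) :=
  match Δ return var Δ σ -> Prop with
  | [] => fun _ => True
  | ρ' :: Γ' => fun x => forall (P : forall σ, var (ρ' :: Γ') σ -> Prop),
      P ρ' vz -> (forall σ (x : var Γ' σ), P σ (vs x)) -> P σ x
  end x.
suff: Q _ _ x by apply.
by case: x => [Γ' σ'|Γ' σ' ρ' x] P' P'z P's; [apply: P'z|apply: P's].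
Qed.

Lemma no_var σ (x : var [] σ) : False.
Proof.
pose Q Δ σ (x : var Δ σ) := match Δ with [] => False | _ => True end.
by suff: Q _ _ x by []; case: x.
Qed.

Lemma sub_ext Γ Δ (θ θ' : sub Γ Δ) :
  (forall σ (x : var Γ σ), θ σ x = θ' σ x) -> θ = θ'.
Proof. by move=> eθ; apply: functional_extensionality_dep => σ; apply: funext => x; apply: eθ. Qed.

Definition id_sub Γ : sub Γ Γ := fun _ x => Var x.
Definition comp_sub Γ Δ Θ (θ : sub Γ Δ) (η : sub Δ Θ) : sub Γ Θ :=
  fun _ x => tsub η (θ _ x).

Lemma tsub_id Γ σ (t : tm Γ σ) : tsub (@id_sub Γ) t = t.
Proof. by elim: t => //= {}σ τ f -> a ->. Qed.

(** Terms contain no binders, so composition needs no prior theory of renamings; only formulas go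
    through [up]. *)
Lemma tsub_comp Γ Δ Θ (θ : sub Γ Δ) (η : sub Δ Θ) σ (t : tm Γ σ) :
  tsub η (tsub θ t) = tsub (comp_sub θ η) t.
Proof. by elim: t => //= {}σ τ f -> a ->. Qed.

Lemma up_id Γ ρ : up (ρ := ρ) (@id_sub Γ) = @id_sub _.
Proof. by apply: sub_ext; apply: var_ind_cons. Qed.

Lemma up_comp Γ Δ Θ ρ (θ : sub Γ Δ) (η : sub Δ Θ) :
  comp_sub (up (ρ := ρ) θ) (up η) = up (comp_sub θ η).
Proof.
apply: sub_ext; apply: var_ind_cons => //= σ x.
by rewrite /comp_sub /= /wk !tsub_comp; congr tsub; apply: sub_ext.
Qed.

Lemma fsub_id Γ (A : form Γ) : fsub A (@id_sub Γ) = A.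
Proof.
elim: A => //= [Γ' s t|Γ' s t|Γ' A -> B ->|Γ' σ A IH] //; first by rewrite !tsub_id.
  by rewrite !tsub_id.
by rewrite up_id IH.
Qed.

Lemma fsub_comp Γ (A : form Γ) Δ Θ (θ : sub Γ Δ) (η : sub Δ Θ) :
  fsub (fsub A θ) η = fsub A (comp_sub θ η).
Proof.
elim: A Δ Θ θ η => //= [Γ' s t|Γ' s t|Γ' A IHA B IHB|Γ' σ A IH] Δ Θ θ η //.
- by rewrite !tsub_comp.
- by rewrite !tsub_comp.
- by rewrite IHA IHB.
- by rewrite IH up_comp.
Qed.

Lemma shift_up Γ Δ ρ (θ : sub Γ Δ) :
  comp_sub (@shift Γ ρ) (up θ) = comp_sub θ (@shift Δ ρ).
Proof. by apply: sub_ext => σ x; rewrite /comp_sub /= /wk. Qed.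

Lemma scons_up Γ Δ Θ ρ (θ : sub Γ Δ) (η : sub Δ Θ) (t : tm Θ ρ) :
  comp_sub (up θ) (scons t η) = scons t (comp_sub θ η).
Proof.
apply: sub_ext; apply: var_ind_cons => //= σ x.
by rewrite /comp_sub /= /wk tsub_comp; congr tsub; apply: sub_ext.
Qed.

Lemma scons_shift Γ Δ ρ (θ : sub Γ Δ) (t : tm Δ ρ) :
  comp_sub (@shift Γ ρ) (scons t θ) = θ.
Proof. by apply: sub_ext. Qed.

Lemma comp_subA Γ Δ Θ Ξ (θ : sub Γ Δ) (η : sub Δ Θ) (ζ : sub Θ Ξ) :
  comp_sub (comp_sub θ η) ζ = comp_sub θ (comp_sub η ζ).
Proof. by apply: sub_ext => σ x; rewrite /comp_sub tsub_comp. Qed.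

Lemma comp_sub_id Γ Δ (θ : sub Γ Δ) : comp_sub θ (@id_sub _) = θ.
Proof. by apply: sub_ext => σ x; rewrite /comp_sub tsub_id. Qed.

Lemma scons_comp Γ Δ Θ ρ (θ : sub Γ Δ) (t : tm Δ ρ) (η : sub Δ Θ) :
  comp_sub (scons t θ) η = scons (tsub η t) (comp_sub θ η).
Proof. by apply: sub_ext; apply: var_ind_cons. Qed.

Lemma fsub_inst Γ Δ σ (A : form (σ :: Γ)) (t : tm Γ σ) (θ : sub Γ Δ) :
  fsub (inst A t) θ = inst (fsub A (up θ)) (tsub θ t).
Proof.
by rewrite /inst !fsub_comp scons_comp scons_up comp_sub_id.
Qed.

(** * Natural deduction *)

Lemma nd_weak Γ (H K : list (form Γ)) A :
  (forall B, In B H -> In B K) -> nd H A -> nd K A.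
Proof.
move=> sHK d; elim: d K sHK => {Γ H A}.
- by move=> Γ H A inA K /(_ _ inA); apply: nd_hyp.
- move=> Γ H A B _ IH K sHK; apply: nd_impI; apply: IH => C /= [->|/sHK]; tauto.
- by move=> Γ H A B _ IH1 _ IH2 K sHK; apply: nd_impE (IH1 _ sHK) (IH2 _ sHK).
- move=> Γ H A _ IH K sHK; apply: nd_raa; apply: IH => C /= [->|/sHK]; tauto.
- move=> Γ σ H A _ IH K sHK; apply: nd_allI; apply: IH => C /in_map_iff [D [<- /sHK]].
  exact: (in_map (fun B => fsub B _)).
- by move=> Γ σ H A t _ IH K sHK; apply: nd_allE; apply: IH.
Qed.

Lemma nd_sub Γ (H : list (form Γ)) A : nd H A ->
  forall Δ (θ : sub Γ Δ), nd (map (fun B => fsub B θ) H) (fsub A θ).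
Proof.
elim=> {Γ H A}.
- by move=> Γ H A inA Δ θ; apply: nd_hyp; apply: (in_map (fun B => fsub B _)).
- by move=> Γ H A B _ IH Δ θ; apply: nd_impI; apply: IH.
- by move=> Γ H A B _ IH1 _ IH2 Δ θ; apply: nd_impE (IH1 _ θ) (IH2 _ θ).
- by move=> Γ H A _ IH Δ θ; apply: nd_raa; apply: IH.
- move=> Γ σ H A _ IH Δ θ /=; apply: nd_allI; move: (IH _ (up θ)).
  rewrite !map_map; congr nd; apply: map_ext => B.
  by rewrite !fsub_comp shift_up.
- by move=> Γ σ H A t _ IH Δ θ; rewrite fsub_inst; apply: nd_allE; apply: IH.
Qed.

Section Derivability.
Variable T : theory.

Definition closed_sub Γ : sub [] Γ := fun σ x => match no_var x with end.

(** The axioms used are sentences carried into [Γ] by the empty substitution. They are invariant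
    under further shifts, so they never obstruct the introduction of a universal quantifier. *)
Definition derives Γ (H : list (form Γ)) (A : form Γ) : Prop :=
  exists L, (forall B, In B L -> T B) /\
    nd (map (fun B => fsub B (@closed_sub Γ)) L ++ H) A.

Lemma derives_nd Γ (H : list (form Γ)) A : nd H A -> derives H A.
Proof. by exists []. Qed.

Lemma derives_axiom Γ (H : list (form Γ)) B :
  T B -> derives H (fsub B (@closed_sub Γ)).
Proof.
move=> TB; exists [B]; split; first by move=> C [<-|[]].
by apply: nd_hyp; left.
Qed.

Lemma derives_impI Γ (H : list (form Γ)) A B :
  derives (A :: H) B -> derives H (Imp A B).
Proof.
move=> [L [TL d]]; exists L; split => //; apply: nd_impI.
apply: nd_weak d => C; rewrite /= !in_app_iff /=; tauto.
Qed.

Lemma derives_impE Γ (H : list (form Γ)) A B :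
  derives H (Imp A B) -> derives H A -> derives H B.
Proof.
move=> [L [TL d]] [L' [TL' d']]; exists (L ++ L'); split.
  by move=> C /in_app_iff [/TL|/TL'].
rewrite map_app; apply: nd_impE; [apply: nd_weak d|apply: nd_weak d'];
  move=> C; rewrite !in_app_iff; tauto.
Qed.

(** Lets any derivation of the pure calculus act on formulas derived from the theory. *)
Lemma derives_cut Γ (K H : list (form Γ)) A :
  (forall B, In B K -> derives H B) -> nd K A -> derives H A.
Proof.
elim: K A => [|B K IH] A dK d.
  by apply: derives_nd; apply: nd_weak d.
apply: (@derives_impE _ _ B); last by apply: dK; left.
by apply: IH; [move=> C inC; apply: dK; right|apply: nd_impI].
Qed.

Lemma derives_weak Γ (H K : list (form Γ)) A :
  (forall B, In B H -> In B K) -> derives H A -> derives K A.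
Proof.
move=> sHK [L [TL d]]; exists L; split=> //.
apply: nd_weak d => C; rewrite !in_app_iff => -[|/sHK]; tauto.
Qed.

Lemma derives_raa Γ (H : list (form Γ)) A : derives (Not A :: H) Bot -> derives H A.
Proof.
move=> /derives_impI d; apply: (@derives_cut _ [Not (Not A)]).
  by move=> B [<-|[]].
by apply: nd_raa; apply: nd_impE (nd_hyp _) _;
  [right; left|apply: nd_hyp; left].
Qed.

Lemma closed_shift Γ σ :
  comp_sub (@closed_sub Γ) (@shift Γ σ) = @closed_sub (σ :: Γ).
Proof. by apply: sub_ext => ρ x; case: (no_var x). Qed.

Lemma derives_allI Γ σ (H : list (form Γ)) (A : form (σ :: Γ)) :
  derives (map (fun B => fsub B (@shift Γ σ)) H) A -> derives H (All A).
Proof.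
move=> [L [TL d]]; exists L; split=> //; apply: nd_allI; move: d.
rewrite map_app map_map; congr nd; congr app; apply: map_ext => B.
by rewrite fsub_comp closed_shift.
Qed.

Lemma derives_allE Γ σ (H : list (form Γ)) (A : form (σ :: Γ)) t :
  derives H (All A) -> derives H (inst A t).
Proof.
move=> d; apply: (@derives_cut _ [All A]); first by move=> B [<-|[]].
by apply: nd_allE; apply: nd_hyp; left.
Qed.

Lemma derives_shift Γ σ (H : list (form Γ)) A : derives H A ->
  derives (map (fun B => fsub B (@shift Γ σ)) H) (fsub A (@shift Γ σ)).
Proof.
move=> [L [TL d]]; exists L; split=> //.
move: (nd_sub d (@shift Γ σ)); rewrite map_app map_map.
congr nd; congr app; apply: map_ext => B.
by rewrite fsub_comp closed_shift.
Qed.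

Definition consistent Γ (H : list (form Γ)) := ~ derives H Bot.

End Derivability.

(** * Countability of the language *)

Fixpoint ty_code (σ : ty) : GenTree.tree nat :=
  match σ with
  | N => GenTree.Leaf 0
  | Arr σ τ => GenTree.Node 0 [ty_code σ; ty_code τ]
  end.

Fixpoint var_code Γ σ (x : var Γ σ) : nat :=
  match x with vz _ _ => 0 | vs _ _ _ x => (var_code x).+1 end.

Definition cst_code σ (c : cst σ) : GenTree.tree nat :=
  match c with
  | cZero => GenTree.Leaf 0 | cOne => GenTree.Leaf 1 | cPlus => GenTree.Leaf 2 | cTimes => GenTree.Leaf 3
  | cRec => GenTree.Leaf 4
  | cPi σ τ => GenTree.Node 0 [ty_code σ; ty_code τ]
  | cSigma ρ σ τ => GenTree.Node 0 [ty_code ρ; ty_code σ; ty_code τ]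
  end.

(** The types hidden in an application are not stored: a code determines the type of its term, so
    the code of the function already fixes both types. *)
Fixpoint tm_code Γ σ (t : tm Γ σ) : GenTree.tree nat :=
  match t with
  | Var _ x => GenTree.Leaf (var_code x)
  | Cst _ c => GenTree.Node 0 [cst_code c]
  | App _ _ f a => GenTree.Node 0 [tm_code f; tm_code a]
  end.

Fixpoint form_code Γ (A : form Γ) : GenTree.tree nat :=
  match A with
  | Eq0 _ s t => GenTree.Node 0 [tm_code s; tm_code t]
  | Lt0 _ s t => GenTree.Node 1 [tm_code s; tm_code t]
  | Bot _ => GenTree.Leaf 0
  | Imp _ A B => GenTree.Node 2 [form_code A; form_code B]
  | All _ σ A => GenTree.Node 3 [ty_code σ; form_code A]
  end.

Lemma ty_code_inj : injective ty_code.
Proof.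
elim=> [|σ IHσ τ IHτ] [|σ' τ'] //= [] /IHσ -> /IHτ -> //.
Qed.

Lemma existT_inj (A : Type) (P : A -> Type) a (x y : P a) :
  existT P a x = existT P a y -> x = y.
Proof. exact: (inj_pair2_eq_dec _ (fun b c => pselect (b = c))). Qed.

Lemma var_code_inj Γ σ τ (x : var Γ σ) (y : var Γ τ) :
  var_code x = var_code y -> existT (var Γ) σ x = existT (var Γ) τ y.
Proof.
move=> exy; elim: x τ y exy => {Γ σ} [Γ σ|Γ σ ρ x IH]; apply: var_ind_cons => //=.
move=> τ y [] /IH e.
exact: (f_equal (fun p => existT (var (ρ :: Γ)) (projT1 p) (vs (projT2 p))) e).
Qed.

Lemma cst_code_inj σ τ (c : cst σ) (d : cst τ) :
  cst_code c = cst_code d -> existT cst σ c = existT cst τ d.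
Proof.
case: c => [||||σ1 σ2|σ1 σ2 σ3|]; case: d => [||||τ1 τ2|τ1 τ2 τ3|] //=.
- by case=> /ty_code_inj -> /ty_code_inj ->.
- by case=> /ty_code_inj -> /ty_code_inj -> /ty_code_inj ->.
Qed.

Lemma tm_code_inj Γ σ τ (s : tm Γ σ) (t : tm Γ τ) :
  tm_code s = tm_code t -> existT (tm Γ) σ s = existT (tm Γ) τ t.
Proof.
elim: s τ t => [{}σ x|{}σ c|{}σ σ' f IHf a IHa] τ [{}τ y|{}τ d|{}τ τ' g b] //=.
- case=> /var_code_inj e.
  exact: (f_equal (fun p => existT (tm Γ) (projT1 p) (Var (projT2 p))) e).
- case=> /cst_code_inj e.
  exact: (f_equal (fun p => existT (tm Γ) (projT1 p) (Cst (projT2 p))) e).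
- case=> /IHf ef /IHa ea; case: (projT1_eq ef) => /= eσ eτ.
  by subst; rewrite (existT_inj ef) (existT_inj ea).
Qed.

Lemma form_code_inj Γ : injective (@form_code Γ).
Proof.
move=> A; elim: A => {Γ} [Γ s t|Γ s t|Γ|Γ A IHA B IHB|Γ σ A IHA] C.
- move: s t; case: C => {Γ} [Γ s' t'|Γ s' t'|Γ|Γ A' B'|Γ σ' A'] s t //=.
  by case=> /tm_code_inj es /tm_code_inj et; rewrite (existT_inj es) (existT_inj et).
- move: s t; case: C => {Γ} [Γ s' t'|Γ s' t'|Γ|Γ A' B'|Γ σ' A'] s t //=.
  by case=> /tm_code_inj es /tm_code_inj et; rewrite (existT_inj es) (existT_inj et).
- by case: C.
- move: A B IHA IHB; case: C => {Γ} [Γ s' t'|Γ s' t'|Γ|Γ A' B'|Γ σ' A'] A B IHA IHB //=.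
  by case=> /IHA -> /IHB ->.
- move: σ A IHA; case: C => {Γ} [Γ s' t'|Γ s' t'|Γ|Γ A' B'|Γ σ' A'] σ A IHA //=.
  by case=> /ty_code_inj e; subst; move/IHA ->.
Qed.

Definition nth_form Γ (c : nat) : form Γ :=
  match pselect (exists A : form Γ, pickle (form_code A) = c) with
  | left h => projT1 (cid h)
  | right _ => Bot
  end.

Lemma nth_form_surj Γ (A : form Γ) : exists c, nth_form Γ c = A.
Proof.
exists (pickle (form_code A)); rewrite /nth_form.
case: pselect => [h|[]]; last by exists A.
by case: cid => B /= /(pcan_inj pickleK) /form_code_inj.
Qed.

(** * Henkin construction *)

(** A formula that is not universal is treated as a vacuous quantification, so
    that deciding a formula and choosing a witness are one and the same step. *)
Definition task_of Γ (B : form Γ) : {σ & form (σ :: Γ)} :=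
  match B in form Γ return {σ & form (σ :: Γ)} with
  | All Γ σ C => existT (fun σ => form (σ :: Γ)) σ C
  | B => existT (fun σ => form (σ :: _)) N (fsub B (@shift _ N))
  end.

Definition task_form Γ (B : form Γ) : form Γ := All (projT2 (task_of B)).

Fixpoint closed_tm Γ (σ : ty) : tm Γ σ :=
  match σ with
  | N => Cst cZero
  | Arr σ τ => App (Cst (cPi τ σ)) (closed_tm Γ τ)
  end.

Lemma inst_shift Γ σ (B : form Γ) (t : tm Γ σ) : inst (fsub B (@shift Γ σ)) t = B.
Proof. by rewrite /inst fsub_comp scons_shift fsub_id. Qed.

Lemma nd_All_shift Γ σ (C : form Γ) : nd [All (fsub C (@shift _ σ))] C.
Proof.
rewrite -{2}(inst_shift C (closed_tm Γ σ)).
by apply: nd_allE; apply: nd_hyp; left.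
Qed.

Lemma nd_shift_All Γ σ (C : form Γ) : nd [C] (All (fsub C (@shift _ σ))).
Proof. by apply: nd_allI; apply: nd_hyp; left. Qed.

Lemma nd_task Γ (B : form Γ) : nd [task_form B] B.
Proof.
case: B => *; try exact: nd_All_shift.
by apply: nd_hyp; left.
Qed.

Lemma task_nd Γ (B : form Γ) : nd [B] (task_form B).
Proof.
case: B => *; try exact: nd_shift_All.
by apply: nd_hyp; left.
Qed.

(** [pending i c] is the [c]-th formula over the context of stage [i], weakened
    to the present context. *)
Record stage := Stage { sctx : ctx; pending : nat -> nat -> form sctx }.

Definition todo (m : nat) (S : stage) : form (sctx S) :=
  let (i, c) := of_nat m in pending S i c.

(** Each step adds one variable, of the type quantified in the formula under treatment, to serve as
    its Henkin witness. At the new stage [m + 1] the entries with [i > m + 1] are placeholders,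
    overwritten until their own stage is reached. *)
Definition next_stage (m : nat) (S : stage) : stage :=
  let σ := projT1 (task_of (todo m S)) in
  Stage (fun i c => if i <= m then fsub (pending S i c) (@shift (sctx S) σ)
                    else nth_form (σ :: sctx S) c).

Fixpoint stages (n : nat) : stage :=
  match n with
  | 0 => Stage (fun _ => nth_form [])
  | n.+1 => next_stage n (stages n)
  end.

Definition hctx (n : nat) : ctx := sctx (stages n).
Definition htodo (n : nat) : form (hctx n) := todo n (stages n).
Definition hty (n : nat) : ty := projT1 (task_of (htodo n)).
Definition hbody (n : nat) : form (hty n :: hctx n) := projT2 (task_of (htodo n)).

(** The inclusion of an earlier context in a later one. For [n > m] the closed terms are a junk
    value. *)
Fixpoint lift (n m : nat) : sub (hctx n) (hctx m) :=
  match PeanoNat.Nat.eq_dec n m with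
  | left e => match e in _ = m return sub (hctx n) (hctx m) with
              | erefl => @id_sub _ end
  | right _ =>
      match m return sub (hctx n) (hctx m) with
      | 0 => fun σ _ => closed_tm _ σ
      | m.+1 => comp_sub (@lift n m) (@shift (hctx m) (hty m))
      end
  end.
Arguments lift n m : clear implicits, simpl never.

Lemma lift_refl n : lift n n = @id_sub (hctx n).
Proof.
rewrite {1}/lift; case: n => [|n]; case: PeanoNat.Nat.eq_dec => // e;
  by rewrite (Eqdep_dec.UIP_dec PeanoNat.Nat.eq_dec e erefl).
Qed.

Lemma lift_S n m : n <= m ->
  lift n m.+1 = comp_sub (lift n m) (@shift (hctx m) (hty m)).
Proof. by move=> lnm; rewrite {1}/lift; case: PeanoNat.Nat.eq_dec => // e; lia. Qed.

Lemma lift_trans n m p : n <= m -> m <= p ->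
  comp_sub (lift n m) (lift m p) = lift n p.
Proof.
move=> lnm; elim: p => [|p IH] lmp.
  have -> : m = 0 by lia.
  by rewrite lift_refl comp_sub_id.
have [<-|ne] := eqVneq m p.+1; first by rewrite lift_refl comp_sub_id.
by rewrite !lift_S -?comp_subA ?IH //; lia.
Qed.

Lemma pending_stages n i c : i <= n ->
  pending (stages n) i c = fsub (nth_form (hctx i) c) (lift i n).
Proof.
elim: n => [|n IH] le_in.
  have -> : i = 0 by lia.
  by rewrite lift_refl fsub_id.
rewrite /= ; case: ifP => [le_in'|gt_in].
  by rewrite IH // fsub_comp lift_S.
have -> : i = n.+1 by lia.
by rewrite lift_refl fsub_id.
Qed.

(** The Cantor code of [(n, c)] is at least [n], so a formula is treated only once its context
    exists. *)
Lemma scheduled n (A : form (hctx n)) :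
  exists2 m, n <= m & htodo m = fsub A (lift n m).
Proof.
have [c <-] := nth_form_surj A; exists (to_nat (n, c)).
  by have := to_nat_non_decreasing n c; lia.
rewrite /htodo /todo cancel_of_to pending_stages //.
by have := to_nat_non_decreasing n c; lia.
Qed.

Section Henkin.
Variables (T : theory) (A0 : sentence).
Hypothesis A0_unprovable : ~ proves T A0.

(** Either the universal formula is consistent and is kept, or its body is denied at the fresh
    variable, which thus becomes a counterexample. *)
Fixpoint hyps (n : nat) : list (form (hctx n)) :=
  match n with
  | 0 => [Not A0]
  | n.+1 =>
    if pselect (consistent T (All (hbody n) :: hyps n))
    then map (fun B => fsub B (@shift (hctx n) (hty n))) (All (hbody n) :: hyps n)
    else Not (hbody n) :: map (fun B => fsub B (@shift (hctx n) (hty n))) (hyps n)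
  end.

Lemma closed_sub_id : @closed_sub [] = @id_sub [].
Proof. by apply: sub_ext => σ x; case: (no_var x). Qed.

(** Adding a variable is harmless because every type has a closed term to put in its place. *)
Lemma shift_consistent n (H : list (form (hctx n))) σ :
  consistent T H -> consistent T (map (fun B => fsub B (@shift _ σ)) H).
Proof.
move=> cH /derives_allI d; apply: cH.
exact: (@derives_allE T _ σ H Bot (closed_tm _ σ)).
Qed.

Lemma hyps_consistent n : consistent T (hyps n).
Proof.
elim: n => [|n IH].
  move=> /derives_raa [L [TL d]]; apply: A0_unprovable; exists L; split=> //.
  move: d; rewrite cats0 closed_sub_id; congr nd.
  by rewrite -[RHS]map_id; apply: map_ext => B; rewrite fsub_id.
(* Otherwise, if denying the body at the fresh variable were inconsistent, the body would be
   derivable, hence its generalisation, against the failure of the test. *)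
rewrite /=; case: pselect => /= [c|nc]; first exact: (shift_consistent c).
move=> /derives_raa /derives_allI d; apply: nc => d'; apply: IH.
by apply: derives_impE d; apply: derives_impI.
Qed.

(** The union of all stages: a complete consistent theory with Henkin witnesses. *)
Definition truth n (A : form (hctx n)) : Prop :=
  exists2 m, n <= m & derives T (hyps m) (fsub A (lift n m)).

Lemma derives_lift n m (A : form (hctx n)) : n <= m ->
  derives T (hyps n) A -> derives T (hyps m) (fsub A (lift n m)).
Proof.
move=> + d; elim: m => [|m IH] lnm.
  have e : n = 0 by lia.
  by subst; rewrite lift_refl fsub_id.
have [e|ne] := eqVneq n m.+1; first by subst; rewrite lift_refl fsub_id.
have {}lnm : n <= m by lia.
rewrite lift_S // -fsub_comp; have := derives_shift (hty m) (IH lnm).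
apply: derives_weak => B inB /=; case: pselect => _ /=; first by right.
by right.
Qed.

Lemma truth_later n m (A : form (hctx n)) : n <= m ->
  truth A <-> truth (fsub A (lift n m)).
Proof.
move=> lnm; split=> [[p lnp d]|[p lmp]].
  exists (maxn m p); first by lia.
  rewrite fsub_comp lift_trans //; last by lia.
  have := derives_lift (leq_maxr m p) d.
  by rewrite fsub_comp lift_trans // leq_maxr.
by rewrite fsub_comp lift_trans // => d; exists p => //; lia.
Qed.

Lemma truth_nd n (K : list (form (hctx n))) A :
  (forall B, In B K -> truth B) -> nd K A -> truth A.
Proof.
move=> tK d.
suff [m lnm dK] : exists2 m, n <= m &
    forall B, In B K -> derives T (hyps m) (fsub B (lift n m)).
  exists m => //; apply: (@derives_cut _ _ (map (fun B => fsub B (lift n m)) K)).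
    by move=> C /in_map_iff [B [<- /dK]].
  exact: nd_sub.
elim: K tK {d} => [|B K IH] tK; first by exists n.
have [|m lnm dK] := IH; first by move=> C inC; apply: tK; right.
have [|p lnp dB] := tK B; first by left.
exists (maxn m p) => [|C [<-|/dK dC]]; first by lia.
  by have := derives_lift (leq_maxr m p) dB; rewrite fsub_comp lift_trans ?leq_maxr.
by have := derives_lift (leq_maxl m p) dC; rewrite fsub_comp lift_trans ?leq_maxl.
Qed.

Lemma truth_consistent n : ~ @truth n Bot.
Proof. by move=> [m lnm]; apply: hyps_consistent. Qed.

Lemma truth_axiom n B : T B -> @truth n (fsub B (@closed_sub _)).
Proof. by move=> TB; exists n => //; rewrite lift_refl fsub_id; apply: derives_axiom. Qed.

Lemma truth_A0 : ~ @truth 0 A0.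
Proof.
move=> tA; apply: (@truth_consistent 0); apply: (@truth_nd 0 [A0; Not A0] Bot).
  move=> B [<-|[<-|[]]] //; exists 0 => //; rewrite lift_refl fsub_id.
  by apply: derives_nd; apply: nd_hyp; left.
by apply: nd_impE; apply: nd_hyp; [right; left|left].
Qed.

Lemma decided m :
  derives T (hyps m.+1) (fsub (All (hbody m)) (@shift _ (hty m))) \/
  derives T (hyps m.+1) (Not (hbody m)).
Proof.
rewrite /=; case: pselect => _ /=; [left|right];
  by apply: derives_nd; apply: nd_hyp; left.
Qed.

Lemma inst_up_shift Γ σ (C : form (σ :: Γ)) :
  inst (fsub C (up (@shift Γ σ))) (Var vz) = C.
Proof.
rewrite /inst fsub_comp scons_up -[RHS]fsub_id; congr fsub.
by apply: sub_ext; apply: var_ind_cons.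
Qed.

Lemma truth_shift m (A : form (hctx m)) :
  truth A <-> @truth m.+1 (fsub A (@shift _ (hty m))).
Proof.
have := @truth_later m m.+1 A (leqnSn m).
by rewrite lift_S // lift_refl.
Qed.

Lemma truth_derives n (A : form (hctx n)) : derives T (hyps n) A -> truth A.
Proof. by move=> d; exists n => //; rewrite lift_refl fsub_id. Qed.

Lemma truth_complete n (A : form (hctx n)) : truth A \/ truth (Not A).
Proof.
have [m lnm e] := scheduled A.
have [/truth_derives t|/truth_derives t] := decided m; [left|right].
  apply/(truth_later _ lnm); rewrite -e; apply/truth_shift.
  apply: (@truth_nd m.+1 [fsub (All (hbody m)) (@shift _ (hty m))]).
    by move=> B [<-|[]].
  exact: (nd_sub (nd_task (htodo m)) (@shift _ (hty m))).
apply/(truth_later _ lnm); rewrite [fsub _ _]/= -e; apply/truth_shift.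
apply: (@truth_nd m.+1 [Not (hbody m)]); first by move=> B [<-|[]].
apply: nd_impI; apply: nd_impE (nd_hyp _) _; first by right; left.
rewrite -[X in nd _ X]inst_up_shift; apply: nd_allE.
apply: nd_weak (nd_sub (task_nd (htodo m)) (@shift _ (hty m))).
by move=> B [<-|[]]; left.
Qed.

Lemma lift1 m : lift m m.+1 = @shift (hctx m) (hty m).
Proof. by rewrite lift_S // lift_refl. Qed.

(** The task is a variable [S] subject to an equation, which avoids rewriting inside the dependent
    pair [task_of (htodo m)]. *)
Lemma truth_henkin_task m S : S = task_of (htodo m) ->
  (forall t : tm (hctx m.+1) (projT1 S),
    truth (inst (fsub (projT2 S) (up (lift m m.+1))) t)) ->
  truth (All (projT2 S)).
Proof.
move=> -> tS; have [/truth_derives t|/truth_derives t] := decided m.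
  exact/truth_shift.
have /= := tS (Var vz); rewrite lift1 inst_up_shift => t'.
case: (@truth_consistent m.+1).
apply: (@truth_nd m.+1 [Not (hbody m); hbody m]); first by move=> B [<-|[<-|[]]].
by apply: nd_impE; apply: nd_hyp; [left|right; left].
Qed.

Lemma truth_henkin n σ (A : form (σ :: hctx n)) :
  (forall m (t : tm (hctx m) σ), n <= m ->
    truth (inst (fsub A (up (lift n m))) t)) ->
  truth (All A).
Proof.
move=> tA; have [m lnm e] := scheduled (All A).
apply/(truth_later _ lnm).
apply: (@truth_henkin_task m (existT _ σ (fsub A (up (lift n m))))).
  by rewrite e.
move=> /= t; rewrite fsub_comp up_comp lift_trans //.
by apply: tA; lia.
Qed.

End Henkin.

(** * Structures and completeness *)

Record structure := Structure {
  dom : ty -> Type;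
  ap : forall σ τ, dom (Arr σ τ) -> dom σ -> dom τ;
  ct : forall σ, cst σ -> dom σ;
  eqr : dom N -> dom N -> Prop;
  ltr : dom N -> dom N -> Prop }.
Arguments ct _ {σ} _.

Fixpoint env (D : ty -> Type) (Γ : ctx) : Type :=
  match Γ with [] => unit | σ :: Γ => (D σ * env D Γ)%type end.

Fixpoint lookup D Γ σ (x : var Γ σ) : env D Γ -> D σ :=
  match x with
  | vz _ _ => fun e => e.1
  | vs _ _ _ y => fun e => lookup y e.2
  end.

Lemma env_ext D Γ (e e' : env D Γ) :
  (forall σ (x : var Γ σ), lookup x e = lookup x e') -> e = e'.
Proof.
elim: Γ e e' => [|σ Γ IH] /=; first by case; case.
move=> [a e] [a' e'] eq_e; congr pair; first exact: (eq_e _ vz).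
by apply: IH => τ x; apply: (eq_e _ (vs x)).
Qed.

Section Semantics.
Variable M : structure.

Fixpoint eval Γ σ (t : tm Γ σ) (e : env (dom M) Γ) : dom M σ :=
  match t with
  | Var _ x => lookup x e
  | Cst _ c => ct M c
  | App _ _ f a => ap (eval f e) (eval a e)
  end.

Fixpoint sat Γ (A : form Γ) : env (dom M) Γ -> Prop :=
  match A with
  | Eq0 _ s t => fun e => eqr (eval s e) (eval t e)
  | Lt0 _ s t => fun e => ltr (eval s e) (eval t e)
  | Bot _ => fun _ => False
  | Imp _ A B => fun e => sat A e -> sat B e
  | All _ _ A => fun e => forall a, sat A (a, e)
  end.

Lemma sat_Imp Γ (A B : form Γ) e : sat (Imp A B) e = (sat A e -> sat B e).
Proof. by []. Qed.

Fixpoint sub_env Γ Δ : sub Γ Δ -> env (dom M) Δ -> env (dom M) Γ :=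
  match Γ with
  | [] => fun _ _ => tt
  | σ :: Γ => fun θ e => (eval (θ _ vz) e, sub_env (fun _ x => θ _ (vs x)) e)
  end.
Arguments sub_env : simpl never.

Lemma lookup_sub_env Γ Δ (θ : sub Γ Δ) e σ (x : var Γ σ) :
  lookup x (sub_env θ e) = eval (θ σ x) e.
Proof. by elim: x θ => {Γ σ} [|Γ σ ρ x IH] θ //; apply: IH. Qed.

Lemma eval_tsub Γ Δ (θ : sub Γ Δ) e σ (t : tm Γ σ) :
  eval (tsub θ t) e = eval t (sub_env θ e).
Proof.
elim: t => //= [{}σ x|{}σ τ f -> a -> //]; by rewrite lookup_sub_env.
Qed.

Lemma sub_env_shift Γ ρ a (e : env (dom M) Γ) : sub_env (@shift Γ ρ) (a, e) = e.
Proof. by apply: env_ext => σ x; rewrite lookup_sub_env. Qed.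

Lemma sub_env_id Γ (e : env (dom M) Γ) : sub_env (@id_sub Γ) e = e.
Proof. by apply: env_ext => σ x; rewrite lookup_sub_env. Qed.

Lemma eval_wk Γ ρ σ (t : tm Γ σ) a (e : env (dom M) Γ) :
  eval (wk ρ t) (a, e) = eval t e.
Proof. by rewrite /wk eval_tsub sub_env_shift. Qed.

Lemma sub_env_up Γ Δ ρ (θ : sub Γ Δ) a e :
  sub_env (up (ρ := ρ) θ) (a, e) = (a, sub_env θ e).
Proof.
apply: env_ext; apply: var_ind_cons => [|σ x]; rewrite lookup_sub_env //=.
by rewrite eval_wk lookup_sub_env.
Qed.

Lemma sat_fsub Γ (A : form Γ) Δ (θ : sub Γ Δ) e :
  sat (fsub A θ) e <-> sat A (sub_env θ e).
Proof.
elim: A Δ θ e => {Γ} /= [Γ s t|Γ s t|Γ|Γ A IHA B IHB|Γ σ A IH] Δ θ e //.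
- by rewrite !eval_tsub.
- by rewrite !eval_tsub.
- by split=> h /IHA /h /IHB.
- by split=> h a; [have /IH := h a|apply/IH]; rewrite (sub_env_up (ρ := σ)).
Qed.

Lemma sat_closure Γ (A : form Γ) : sat (closure A) tt <-> forall e, sat A e.
Proof.
elim: Γ A => [|σ Γ IH] A /=; first by split=> [h []|h]; [|apply: h].
by rewrite IH /=; split=> [h [a e]|h e a]; apply: h.
Qed.

Lemma sat_inst Γ σ (A : form (σ :: Γ)) t e :
  sat (inst A t) e <-> sat A (eval t e, e).
Proof.
rewrite /inst sat_fsub.
have -> // : sub_env (scons t (fun _ x => Var x)) e = (eval t e, e).
by congr pair; apply: sub_env_id.
Qed.

End Semantics.

Definition models (M : structure) (T : theory) := forall A, T A -> sat A (tt : env (dom M) []).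

Section TermModel.
Variables (T : theory) (A0 : sentence).
Hypothesis A0_unprovable : ~ proves T A0.

Definition tm_at σ := {n & tm (hctx n) σ}.
Definition raise σ (a : tm_at σ) m : tm (hctx m) σ := tsub (lift (projT1 a) m) (projT2 a).

(** Elements are terms over some stage, raised to a common stage when combined. Nothing is
    identified yet: [eqr] is provable equality, and quotients are left to the extensional
    collapse. *)
Definition term_model : structure := {|
  dom := tm_at;
  ap σ τ f a := let m := maxn (projT1 f) (projT1 a) in
    existT (fun n => tm (hctx n) τ) m (App (raise f m) (raise a m));
  ct σ c := existT (fun n => tm (hctx n) σ) 0 (Cst c);
  eqr a b := let m := maxn (projT1 a) (projT1 b) in
    truth T A0 (Eq0 (raise a m) (raise b m));
  ltr a b := let m := maxn (projT1 a) (projT1 b) in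
    truth T A0 (Lt0 (raise a m) (raise b m)) |}.

Definition bounded Γ (e : env tm_at Γ) m :=
  forall σ (x : var Γ σ), projT1 (lookup x e) <= m.
Definition env_sub Γ (e : env tm_at Γ) m : sub Γ (hctx m) :=
  fun σ x => raise (lookup x e) m.

Lemma tsub_raise σ (a : tm_at σ) m p : projT1 a <= m -> m <= p ->
  tsub (lift m p) (raise a m) = raise a p.
Proof. by move=> lam lmp; rewrite /raise tsub_comp lift_trans. Qed.

Lemma raise_eval Γ σ (t : tm Γ σ) (e : env (dom term_model) Γ) m : bounded e m ->
  projT1 (eval t e) <= m /\ raise (eval t e) m = tsub (env_sub e m) t.
Proof.
move=> be; elim: t => [{}σ x|{}σ c|{}σ τ f [lf IHf] a [la IHa]] /=.
- by split=> //; apply: be.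
- by [].
split; first by rewrite geq_max lf la.
rewrite -IHf -IHa {1}/raise /=.
by rewrite !tsub_raise ?leq_maxl ?leq_maxr // geq_max lf la.
Qed.

(** The truth lemma. Completeness of [truth] serves implications and the Henkin witnesses serve
    quantifiers; the bound [m] is raised when a quantifier brings in an element of a later stage. *)
Lemma sat_term_model Γ (A : form Γ) (e : env (dom term_model) Γ) m : bounded e m ->
  sat A e <-> truth T A0 (fsub A (env_sub e m)).
Proof.
elim: A e m => {Γ} [Γ s t|Γ s t|Γ|Γ A IHA B IHB|Γ σ A IH] e m be.
- have [ls es] := raise_eval s be; have [lt et] := raise_eval t be.
  rewrite /= -es -et (@truth_later _ _ _ m) ?geq_max ?ls //=.
  by rewrite !tsub_raise ?leq_maxl ?leq_maxr // geq_max ls.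
- have [ls es] := raise_eval s be; have [lt et] := raise_eval t be.
  rewrite /= -es -et (@truth_later _ _ _ m) ?geq_max ?ls //=.
  by rewrite !tsub_raise ?leq_maxl ?leq_maxr // geq_max ls.
- by split=> // /(truth_consistent A0_unprovable).
- rewrite /= (IHA e m be) (IHB e m be); split=> [h|h tA].
    have [/h tB|tN] := truth_complete T A0 (fsub A (env_sub e m)).
      apply: (@truth_nd _ _ _ [fsub B (env_sub e m)]); first by move=> C [<-|[]].
      by apply: nd_impI; apply: nd_hyp; right; left.
    apply: (@truth_nd _ _ _ [Not (fsub A (env_sub e m))]); first by move=> C [<-|[]].
    apply: nd_impI; apply: nd_raa; apply: (@nd_impE _ _ (fsub A (env_sub e m)));
      by apply: nd_hyp; simpl; tauto.
  apply: (@truth_nd _ _ _ [Imp (fsub A (env_sub e m)) (fsub B (env_sub e m));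
                           fsub A (env_sub e m)]).
    by move=> C [<-|[<-|[]]].
  by apply: nd_impE; apply: nd_hyp; [left|right; left].
- have bS p (a : tm_at σ) : m <= p -> projT1 a <= p -> bounded ((a, e) : env tm_at (σ :: Γ)) p.
    move=> lmp lap; apply: var_ind_cons => //= τ x.
    by apply: leq_trans lmp; apply: be.
  have eS p (a : tm_at σ) : m <= p ->
      env_sub ((a, e) : env tm_at (σ :: Γ)) p =
      comp_sub (up (env_sub e m)) (scons (raise a p) (lift m p)).
    move=> lmp; rewrite scons_up; apply: sub_ext; apply: var_ind_cons => //= τ x.
    by rewrite /comp_sub tsub_raise //; apply: be.
  split=> [h|h a] /=.
    apply: (truth_henkin A0_unprovable) => p t lmp.
    pose a : tm_at σ := existT (fun n => tm (hctx n) σ) p t.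
    have /(IH (a, e) p) := h a; rewrite eS // => /(_ (bS p a lmp (leqnn p))).
    have -> : raise a p = t by rewrite /raise /= lift_refl tsub_id.
    by rewrite /inst !fsub_comp (scons_up (lift m p)) (comp_sub_id (lift m p)).
  set p := maxn m (projT1 a).
  have lmp : m <= p by rewrite leq_maxl.
  have lap : projT1 a <= p by rewrite leq_maxr.
  apply/(IH (a, e) p); first exact: bS.
  rewrite eS // -fsub_comp; move: h => /(truth_later T A0 _ lmp) h.
  apply: (@truth_nd _ _ _ [fsub (fsub (All A) (env_sub e m)) (lift m p)]).
    by move=> C [<-|[]].
  have -> : scons (raise a p) (lift m p) = comp_sub (up (lift m p)) (scons (raise a p) (@id_sub _)).
    by rewrite scons_up comp_sub_id.
  by rewrite -fsub_comp; apply: nd_allE; apply: nd_hyp; left.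
Qed.

Lemma bounded0 : bounded (tt : env tm_at []) 0.
Proof. by move=> σ x; case: (no_var x). Qed.

Lemma env_sub0 (e : env tm_at []) m : env_sub e m = @closed_sub _.
Proof. by apply: sub_ext => σ x; case: (no_var x). Qed.

Lemma term_model_models : models term_model T.
Proof.
move=> A TA; apply/(sat_term_model _ bounded0).
by rewrite env_sub0; apply: truth_axiom.
Qed.

Lemma term_model_not_A0 : ~ sat A0 (tt : env (dom term_model) []).
Proof.
move=> /(sat_term_model _ bounded0); rewrite env_sub0 => t.
by apply: (truth_A0 A0_unprovable); move: t; rewrite closed_sub_id fsub_id.
Qed.

End TermModel.

Theorem completeness (T : theory) (A : sentence) :
  (forall M, models M T -> sat A (tt : env (dom M) [])) -> proves T A.
Proof.
move=> h; apply: contrapT => nA.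
by apply: (term_model_not_A0 nA); apply: h; apply: term_model_models.
Qed.

(** * Extensional collapse *)

Lemma cid_eq (A : Type) (P Q : A -> Prop) (hP : exists x, P x) (hQ : exists x, Q x) :
  P = Q -> projT1 (cid hP) = projT1 (cid hQ).
Proof. by move=> PQ; subst; rewrite (Prop_irrelevance hP hQ). Qed.

Section Collapse.
Variable M : structure.
Hypothesis M_RCA : models M RCA0ω.

Fixpoint eqm σ : dom M σ -> dom M σ -> Prop :=
  match σ with
  | N => @eqr M
  | Arr σ τ => fun f g => forall z, eqm (ap f z) (ap g z)
  end.

Lemma sat_eqt Γ σ (s t : tm Γ σ) (e : env (dom M) Γ) :
  sat (eqt s t) e <-> eqm (eval s e) (eval t e).
Proof.
elim: σ Γ s t e => [|σ _ τ IH] Γ s t e //=.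
by split=> h z; [have /IH := h z|apply/IH]; rewrite /= !eval_wk; try exact: h.
Qed.

Lemma eqm_refl σ (x : dom M σ) : eqm x x.
Proof.
elim: σ x => [|σ _ τ IH] x //=.
exact: (M_RCA (ax_semiring sr_eq_refl)).
Qed.

Lemma eqm_sym σ (x y : dom M σ) : eqm x y -> eqm y x.
Proof.
elim: σ x y => [|σ _ τ IH] x y /=; last by move=> h z; apply: IH.
exact: (M_RCA (ax_semiring sr_eq_sym)).
Qed.

Lemma eqm_trans σ (x y z : dom M σ) : eqm x y -> eqm y z -> eqm x z.
Proof.
elim: σ x y z => [|σ _ τ IH] x y z /=; last by move=> h k u; apply: IH (h u) (k u).
exact: (M_RCA (ax_semiring sr_eq_trans)).
Qed.

(** In the function this is the definition of [eqm]; in the argument it is the axiom of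
    extensionality. *)
Lemma eqm_ap σ τ (f g : dom M (Arr σ τ)) (x y : dom M σ) :
  eqm f g -> eqm x y -> eqm (ap f x) (ap g y).
Proof.
move=> fg xy; apply: (@eqm_trans _ _ (ap f y)); last exact: fg.
pose Γ : ctx := [σ; σ; Arr σ τ].
pose vx : tm Γ σ := Var (vs vz); pose vy : tm Γ σ := Var vz.
pose vf : tm Γ (Arr σ τ) := Var (vs (vs vz)).
have h : sat (Imp (eqt vx vy) (eqt (App vf vx) (App vf vy)))
             ((y, (x, (f, tt))) : env (dom M) Γ) := M_RCA (ax_ext σ τ) f x y.
by rewrite sat_Imp !sat_eqt in h; apply: h.
Qed.

Lemma ltr_congr (a b c d : dom M N) : eqr a b -> eqr c d -> ltr a c -> ltr b d.
Proof. exact: (M_RCA (ax_semiring sr_lt_congr) a b c d). Qed.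

(** Choice is applied to the whole class of [x], so by [cid_eq] the representative depends on the
    class alone. *)
Definition canon σ (x : dom M σ) : dom M σ :=
  projT1 (cid (ex_intro (eqm x) x (eqm_refl x))).

Lemma canonP σ (x : dom M σ) : eqm x (canon x).
Proof. by rewrite /canon; case: cid. Qed.

Lemma canon_eq σ (x y : dom M σ) : eqm x y -> canon x = canon y.
Proof.
move=> xy; have e : eqm x = eqm y.
  by apply: funext => z; apply: propext; split;
     apply: eqm_trans => //; apply: eqm_sym.
exact: cid_eq.
Qed.

Definition cdom σ := {x : dom M σ | canon x = x}.

Lemma cdom_inj σ (a b : cdom σ) : sval a = sval b -> a = b.
Proof.
case: a b => [x px] [y py] /= xy; subst.
by rewrite (Prop_irrelevance px py).
Qed.

Definition cls σ (x : dom M σ) : cdom σ :=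
  exist _ (canon x) (esym (canon_eq (canonP x))).

Lemma cls_eq σ (x y : dom M σ) : cls x = cls y <-> eqm x y.
Proof.
split=> [[e]|xy].
  by apply: eqm_trans (canonP x) _; rewrite e; apply: eqm_sym (canonP y).
by apply: cdom_inj; apply: canon_eq.
Qed.

Lemma cls_sval σ (a : cdom σ) : cls (sval a) = a.
Proof. by apply: cdom_inj; apply: (svalP a). Qed.

Definition collapse : structure := {|
  dom := cdom;
  ap σ τ f a := cls (ap (sval f) (sval a));
  ct σ c := cls (ct M c);
  eqr a b := a = b;
  ltr a b := ltr (sval a) (sval b) |}.

Lemma ap_cls σ τ (f : dom M (Arr σ τ)) (a : dom M σ) :
  @ap collapse _ _ (cls f) (cls a) = cls (ap f a).
Proof. by apply/cls_eq; apply: eqm_ap; apply: eqm_sym; apply: canonP. Qed.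

Lemma ltr_cls (a b : dom M N) : @ltr collapse (cls a) (cls b) <-> ltr a b.
Proof.
by split; apply: ltr_congr; (try exact: (canonP (σ := N)));
   apply: (eqm_sym (σ := N)); apply: (canonP (σ := N)).
Qed.

Fixpoint cls_env Γ : env (dom M) Γ -> env cdom Γ :=
  match Γ with [] => id | σ :: Γ => fun e => (cls e.1, cls_env e.2) end.

Lemma lookup_cls Γ σ (x : var Γ σ) e : lookup x (cls_env e) = cls (lookup x e).
Proof. by elim: x e => {Γ σ} [Γ σ|Γ σ ρ x IH] [a e] //=. Qed.

Lemma eval_cls Γ σ (t : tm Γ σ) e :
  @eval collapse _ _ t (cls_env e) = cls (eval t e).
Proof.
elim: t => [{}σ x|{}σ c|{}σ τ f IHf a IHa] //; first exact: lookup_cls.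
by rewrite [LHS]/= IHf IHa; apply: ap_cls.
Qed.

Lemma sat_cls Γ (A : form Γ) e : @sat collapse _ A (cls_env e) <-> sat A e.
Proof.
elim: A e => {Γ} [Γ s t|Γ s t|Γ|Γ A IHA B IHB|Γ σ A IH] e //.
- by rewrite /sat !eval_cls; apply: (@cls_eq N).
- by rewrite /sat !eval_cls ltr_cls.
- by rewrite /= IHA IHB.
- split=> h a; first by apply/IH; apply: h.
  by rewrite -(cls_sval a); have /IH := h (sval a).
Qed.

End Collapse.

Definition extensional (M : structure) :=
  (forall a b : dom M N, eqr a b <-> a = b) /\
  (forall σ τ (f g : dom M (Arr σ τ)), (forall x, ap f x = ap g x) -> f = g).

Theorem completeness_ext (T : theory) (A : sentence) :
  (forall B, RCA0ω B -> T B) ->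
  (forall M, extensional M -> models M T -> sat A (tt : env (dom M) [])) ->
  proves T A.
Proof.
move=> RT h; apply: completeness => M MT.
have MR : models M RCA0ω by move=> B /RT /MT.
apply/(sat_cls MR A tt); apply: h => [|B /MT]; last by move/(sat_cls MR B tt).
split=> // σ τ f g fg; rewrite -[f]cls_sval -[g]cls_sval.
apply/cls_eq => z; apply/(cls_eq MR).
by have := fg (cls MR z); rewrite -{1}[f]cls_sval -{1}[g]cls_sval !ap_cls.
Qed.

(** * The ordered field of fractions of a discretely ordered semiring *)

Section Fractions.
Local Open Scope ring_scope.
Local Open Scope quotient_scope.

(** In [ssub] the difference has the form [k + 1], so that it can serve directly as a denominator
    when fractions are inverted. *)
Record osemiring := OSemiring {
  osort :> comNzSemiRingType;
  slt : osort -> osort -> Prop;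
  slt_irr : forall x, ~ slt x x;
  slt_trans : forall x y z, slt x y -> slt y z -> slt x z;
  slt_total : forall x y, slt x y \/ x = y \/ slt y x;
  slt_add : forall x y z, slt x y -> slt (x + z) (y + z);
  slt_mul : forall x y z, slt 0 z -> slt x y -> slt (x * z) (y * z);
  slt01 : slt 0 1;
  sge0 : forall x, slt 0 x \/ x = 0;
  ssub : forall x y, slt x y -> exists k, y = x + (k + 1) }.

Variable S : osemiring.
Implicit Types (x y z a b c d : S).

Lemma slt_add2 x y z u : slt x y -> slt z u -> slt (x + z) (y + u).
Proof.
move=> xy zu; apply: slt_trans (slt_add z xy) _.
by rewrite ![y + _]addrC; apply: slt_add.
Qed.

Lemma saddI z : injective (fun x => x + z).
Proof.
move=> x y e; have [lt|[//|lt]] := slt_total x y;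
  have := slt_add z lt; rewrite e => /slt_irr [].
Qed.

Lemma smulI z : slt 0 z -> injective (fun x => x * z).
Proof.
move=> z0 x y e; have [lt|[//|lt]] := slt_total x y;
  have := slt_mul z0 lt; rewrite e => /slt_irr [].
Qed.

Lemma sS_gt0 x : slt 0 (x + 1).
Proof.
have [x0|->] := sge0 x; last by rewrite add0r; apply: slt01.
by have := slt_add2 x0 (slt01 S); rewrite addr0.
Qed.

Lemma smul_gt0 x y : slt 0 x -> slt 0 y -> slt 0 (x * y).
Proof. by move=> x0 y0; have := slt_mul y0 x0; rewrite mul0r. Qed.

(** The triple [(a, b, c)] represents [(a - b) / (c + 1)]. *)
Definition fraction_rep : Type := (S * S * S)%type.
HB.instance Definition _ := Choice.on fraction_rep.
Implicit Types t u : fraction_rep.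

Definition den t := t.2 + 1.
Lemma den_gt0 t : slt 0 (den t). Proof. exact: sS_gt0. Qed.

Definition feq t u :=
  t.1.1 * den u + u.1.2 * den t == u.1.1 * den t + t.1.2 * den u.

Lemma feq_refl : reflexive feq. Proof. by move=> t; rewrite /feq. Qed.
Lemma feq_sym : symmetric feq.
Proof. by move=> t u; rewrite /feq eq_sym. Qed.
Lemma feq_trans : transitive feq.
Proof.
move=> u t v /eqP tu /eqP uv; apply/eqP.
(* There is no subtraction: after multiplying by the middle denominator, the terms of [u] are added
   to both sides so that the two hypotheses become applicable. *)
apply: (smulI (den_gt0 u)); apply: (@saddI ((u.1.1 + u.1.2) * (den t * den v))) => /=.
transitivity ((t.1.1 * den u + u.1.2 * den t) * den v +
              (u.1.1 * den v + v.1.2 * den u) * den t); first by ring.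
by rewrite tu uv; ring.
Qed.

Canonical feq_equiv := EquivRel feq feq_refl feq_sym feq_trans.
Definition frac := {eq_quot feq}.
HB.instance Definition _ := Choice.on frac.
HB.instance Definition _ := EqQuotient.on frac.

Definition mkfrac a b c : frac := \pi_frac (a, b, c).

Lemma mkfracP (p : frac) : exists a b c, p = mkfrac a b c.
Proof. by exists (repr p).1.1, (repr p).1.2, (repr p).2; rewrite /mkfrac -!surjective_pairing reprK. Qed.

Lemma mkfrac_eq a b c a' b' c' :
  mkfrac a b c = mkfrac a' b' c' <->
  a * (c' + 1) + b' * (c + 1) = a' * (c + 1) + b * (c' + 1).
Proof. by split=> [/eqmodP/eqP|e]; last by apply/eqmodP/eqP. Qed.

Lemma repr_mkfrac a b c : let t := repr (mkfrac a b c) in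
  t.1.1 * (c + 1) + b * den t = a * den t + t.1.2 * (c + 1).
Proof. by apply/eqP; rewrite -/(feq _ (a, b, c)) -[feq _ _]/(feq_equiv _ _) -eqmodE reprK. Qed.

(** Denominators are stored minus one; this is the product of two denominators minus one, written
    without a predecessor. *)
Definition denM c c' := c * c' + c + c'.
Lemma denME c c' : denM c c' + 1 = (c + 1) * (c' + 1).
Proof. by rewrite /denM; ring. Qed.

Definition fadd (p q : frac) : frac :=
  let t := repr p in let u := repr q in
  mkfrac (t.1.1 * den u + u.1.1 * den t) (t.1.2 * den u + u.1.2 * den t) (denM t.2 u.2).
Definition fopp (p : frac) : frac :=
  let t := repr p in mkfrac t.1.2 t.1.1 t.2.
Definition fmul (p q : frac) : frac :=
  let t := repr p in let u := repr q in
  mkfrac (t.1.1 * u.1.1 + t.1.2 * u.1.2) (t.1.1 * u.1.2 + t.1.2 * u.1.1) (denM t.2 u.2).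

Lemma faddE a b c a' b' c' : fadd (mkfrac a b c) (mkfrac a' b' c') =
  mkfrac (a * (c' + 1) + a' * (c + 1)) (b * (c' + 1) + b' * (c + 1)) (denM c c').
Proof.
rewrite /fadd; move: (repr_mkfrac a b c) (repr_mkfrac a' b' c') => /=.
set t := repr (mkfrac a b c); set u := repr (mkfrac a' b' c') => et eu.
apply/mkfrac_eq; rewrite !denME -!/(den _).
transitivity ((t.1.1 * (c + 1) + b * den t) * (den u * (c' + 1)) +
  (u.1.1 * (c' + 1) + b' * den u) * (den t * (c + 1))); first by ring.
by rewrite et eu; ring.
Qed.

Lemma foppE a b c : fopp (mkfrac a b c) = mkfrac b a c.
Proof.
rewrite /fopp; move: (repr_mkfrac a b c) => /=; move: (repr _) => t et.
by apply/mkfrac_eq; rewrite -!/(den _) addrC -et addrC.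
Qed.

Lemma fmulE a b c a' b' c' : fmul (mkfrac a b c) (mkfrac a' b' c') =
  mkfrac (a * a' + b * b') (a * b' + b * a') (denM c c').
Proof.
rewrite /fmul; move: (repr_mkfrac a b c) (repr_mkfrac a' b' c') => /=.
set t := repr (mkfrac a b c); set u := repr (mkfrac a' b' c') => et eu.
apply: (@eq_trans _ _ (mkfrac (t.1.1 * a' + t.1.2 * b') (t.1.1 * b' + t.1.2 * a') (denM t.2 c'))).
  apply/mkfrac_eq; rewrite !denME -!/(den _).
  transitivity ((u.1.1 * (c' + 1) + b' * den u) * (t.1.1 * den t) +
     (a' * den u + u.1.2 * (c' + 1)) * (t.1.2 * den t)); first by ring.
  by rewrite eu -{2}eu; ring.
apply/mkfrac_eq; rewrite !denME -!/(den _).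
transitivity ((t.1.1 * (c + 1) + b * den t) * (a' * (c' + 1)) +
   (a * den t + t.1.2 * (c + 1)) * (b' * (c' + 1))); first by ring.
by rewrite et -{2}et; ring.
Qed.

Ltac fracs :=
  repeat (let p := fresh "p" in intro p; destruct (mkfracP p) as [? [? [? ->]]]).

Lemma faddA : associative fadd.
Proof. by rewrite /associative; fracs; rewrite !faddE; apply/mkfrac_eq; rewrite /denM; ring. Qed.
Lemma faddC : commutative fadd.
Proof. by fracs; rewrite !faddE; apply/mkfrac_eq; rewrite /denM; ring. Qed.
Lemma fadd0 : left_id (mkfrac 0 0 0) fadd.
Proof. by fracs; rewrite !faddE; apply/mkfrac_eq; rewrite /denM; ring. Qed.
Lemma faddN : left_inverse (mkfrac 0 0 0) fopp fadd.
Proof. by fracs; rewrite foppE !faddE; apply/mkfrac_eq; rewrite /denM; ring. Qed.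
HB.instance Definition _ := GRing.isZmodule.Build frac faddA faddC fadd0 faddN.

Lemma fmulA : associative fmul.
Proof. by fracs; rewrite !fmulE; apply/mkfrac_eq; rewrite /denM; ring. Qed.
Lemma fmulC : commutative fmul.
Proof. by fracs; rewrite !fmulE; apply/mkfrac_eq; rewrite /denM; ring. Qed.
Lemma fmul1 : left_id (mkfrac 1 0 0) fmul.
Proof. by fracs; rewrite !fmulE; apply/mkfrac_eq; rewrite /denM; ring. Qed.
Lemma fmulDl : left_distributive fmul fadd.
Proof. by fracs; rewrite ?(faddE, fmulE); apply/mkfrac_eq; rewrite /denM; ring. Qed.
Lemma f1_neq0 : mkfrac 1 0 0 != mkfrac 0 0 0 :> frac.
Proof.
apply/eqP => /mkfrac_eq; rewrite !add0r !mulr1 !addr0 => e.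
by have := slt01 S; rewrite e; apply: slt_irr.
Qed.
HB.instance Definition _ :=
  GRing.Zmodule_isComNzRing.Build frac fmulA fmulC fmul1 fmulDl f1_neq0.

Definition mkfracD a b c a' b' c' : mkfrac a b c + mkfrac a' b' c' = _ :=
  faddE a b c a' b' c'.
Definition mkfracN a b c : - mkfrac a b c = _ := foppE a b c.
Definition mkfracM a b c a' b' c' : mkfrac a b c * mkfrac a' b' c' = _ :=
  fmulE a b c a' b' c'.
Lemma mkfrac0 : 0 = mkfrac 0 0 0. Proof. by []. Qed.
Lemma mkfrac1 : 1 = mkfrac 1 0 0. Proof. by []. Qed.

Lemma mkfrac_eq0 a b c : mkfrac a b c = 0 <-> a = b.
Proof.
rewrite mkfrac0; split=> [/mkfrac_eq|->]; last by apply/mkfrac_eq; ring.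
by rewrite !add0r !mulr1 !mul0r !add0r !addr0.
Qed.

Lemma frac_inv_ex (p : frac) : exists q : frac, (p != 0 -> q * p = 1) /\ (p = 0 -> q = 0).
Proof.
have [a [b [c ->]]] := mkfracP p; have [lt|[->|lt]] := slt_total a b.
- have [k e] := ssub lt; exists (mkfrac 0 (c + 1) k); split=> [_|/mkfrac_eq0 ab].
    by rewrite e mkfracM mkfrac1; apply/mkfrac_eq; rewrite /denM; ring.
  by move: lt; rewrite ab => /slt_irr.
- by exists 0; split=> // /eqP []; apply/mkfrac_eq0.
- have [k e] := ssub lt; exists (mkfrac (c + 1) 0 k); split=> [_|/mkfrac_eq0 ab].
    by rewrite e mkfracM mkfrac1; apply/mkfrac_eq; rewrite /denM; ring.
  by move: lt; rewrite ab => /slt_irr.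
Qed.

Definition finv (p : frac) : frac := projT1 (cid (frac_inv_ex p)).
Lemma fmulV (p : frac) : p != 0 -> finv p * p = 1.
Proof. by rewrite /finv; case: cid => q /= []. Qed.
Lemma finv0 : finv 0 = 0.
Proof. by rewrite /finv; case: cid => q /= [_]; apply. Qed.
HB.instance Definition _ := GRing.ComNzRing_isField.Build frac fmulV finv0.

Definition fnonneg (p : frac) : bool := ~~ `[< slt (repr p).1.1 (repr p).1.2 >].

Lemma fnonnegE a b c : fnonneg (mkfrac a b c) <-> ~ slt a b.
Proof.
rewrite /fnonneg; move: (repr_mkfrac a b c) => /=; move: (repr _) => t et.
(* The sign of a numerator does not depend on the representative: if [x < y] but not [x' < y'], the
   cross-multiplied equation would put an element below itself. *)
have aux (x y x' y' d d' : S) : slt 0 d -> slt 0 d' ->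
    x * d' + y' * d = x' * d + y * d' -> slt x y -> slt x' y'.
  move=> d0 d'0 e xy; have h : slt (x * d') (y * d') by apply: slt_mul.
  have [//|[ee|lt]] := slt_total x' y'; case: (@slt_irr S (x * d' + y' * d)).
    by rewrite {2}e ee addrC [X in slt _ X]addrC ![y' * d + _]addrC; apply: slt_add.
  by rewrite {2}e [X in slt _ X]addrC; apply: slt_add2 => //; apply: slt_mul.
split=> [/asboolPn ht lt|ht].
  by apply: ht; apply: aux (esym et) lt; [exact: sS_gt0|exact: den_gt0].
apply/asboolPn => lt; apply: ht.
by apply: aux et lt; [exact: den_gt0|exact: sS_gt0].
Qed.

Definition fle p q := fnonneg (q - p).
Definition flt p q := (q != p) && fle p q.
Definition fnorm (p : frac) := if fnonneg p then p else - p.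

Lemma fle0E p : fle 0 p = fnonneg p. Proof. by rewrite /fle subr0. Qed.

Lemma nsltP a b : ~ slt a b <-> slt b a \/ a = b.
Proof.
split=> [|[lt lt'|->]]; last exact: slt_irr.
  by have [|[->|]] := slt_total a b; [|right|left].
exact: (slt_irr (slt_trans lt lt')).
Qed.

Lemma fnonneg_add p q : fnonneg p -> fnonneg q -> fnonneg (p + q).
Proof.
have [a [b [c ->]]] := mkfracP p; have [a' [b' [c' ->]]] := mkfracP q.
rewrite mkfracD => /fnonnegE/nsltP h /fnonnegE/nsltP k.
apply/fnonnegE/nsltP.
have mulS x' y w : slt x' y \/ y = x' -> slt (x' * (w + 1)) (y * (w + 1)) \/ y * (w + 1) = x' * (w + 1).
  by move=> [uv|->]; [left; apply: slt_mul => //; apply: sS_gt0|right].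
have [{}h|->] := mulS _ _ c' h; have [{}k|->] := mulS _ _ c k.
- by left; apply: slt_add2.
- by left; apply: slt_add.
- by left; rewrite ![b * _ + _]addrC; apply: slt_add.
- by right.
Qed.

Lemma fnonneg_mul p q : fnonneg p -> fnonneg q -> fnonneg (p * q).
Proof.
move: p q; fracs; rewrite mkfracM => /fnonnegE/nsltP h /fnonnegE/nsltP k.
apply/fnonnegE/nsltP.
case: h => [/ssub [m ->]|->]; last by right; ring.
case: k => [/ssub [n ->]|->]; last by right; ring.
left; rewrite -[X in slt X _]addr0.
set lo := (X in slt (X + 0) _); set hi := (X in slt _ X).
have -> : hi = lo + (m + 1) * (n + 1) by rewrite /lo /hi; ring.
rewrite ![lo + _]addrC; apply: slt_add; apply: smul_gt0; exact: sS_gt0.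
Qed.

Lemma fnonneg_anti p : fnonneg p -> fnonneg (- p) -> p = 0.
Proof.
have [a [b [c ->]]] := mkfracP p; rewrite mkfracN => /fnonnegE h /fnonnegE k; apply/mkfrac_eq0.
by have [/h|[|/k]] := slt_total a b.
Qed.

Lemma fnonneg_total p : fnonneg p || fnonneg (- p).
Proof.
move: p; fracs; rewrite mkfracN; apply/orP.
rewrite !fnonnegE; apply: contrapT => /not_orP [/contrapT h /contrapT k].
exact: (slt_irr (slt_trans h k)).
Qed.

Lemma fle_add p q : fle 0 p -> fle 0 q -> fle 0 (p + q).
Proof. by rewrite !fle0E; apply: fnonneg_add. Qed.
Lemma fle_mul p q : fle 0 p -> fle 0 q -> fle 0 (p * q).
Proof. by rewrite !fle0E; apply: fnonneg_mul. Qed.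
Lemma fle_anti p : fle 0 p -> fle p 0 -> p = 0.
Proof. by rewrite /fle subr0 sub0r; apply: fnonneg_anti. Qed.
Lemma fsub_ge0 p q : fle 0 (q - p) = fle p q.
Proof. by rewrite fle0E. Qed.
Lemma fle_total p : fle 0 p || fle p 0.
Proof. by rewrite /fle subr0 sub0r; apply: fnonneg_total. Qed.
Lemma fnormN p : fnorm (- p) = fnorm p.
Proof.
rewrite /fnorm; case: ifP => hN; case: ifP => h; rewrite ?opprK //.
  by rewrite (fnonneg_anti h hN) oppr0.
by have := fnonneg_total p; rewrite hN h.
Qed.
Lemma fnorm_nneg p : fle 0 p -> fnorm p = p.
Proof. by rewrite fle0E /fnorm => ->. Qed.
Lemma flt_def p q : flt p q = (q != p) && fle p q. Proof. by []. Qed.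
HB.instance Definition _ := Num.IntegralDomain_isLeReal.Build frac
  fle_add fle_mul fle_anti fsub_ge0 fle_total fnormN fnorm_nneg flt_def.

Lemma mkfrac_lt a b c a' b' c' : mkfrac a b c < mkfrac a' b' c' <->
  slt (a * (c' + 1) + b' * (c + 1)) (a' * (c + 1) + b * (c' + 1)).
Proof.
rewrite ltNge -subr_ge0 -[_ <= _]/(fle 0 _) fle0E mkfracN mkfracD.
rewrite -(rwP negP) fnonnegE [X in slt _ X]addrC.
by split=> [/contrapT|h]; last by apply.
Qed.

End Fractions.

(** * Definability in an extensional model *)

Record model := Model {
  mstr :> structure;
  M_ext : extensional mstr;
  M_RCA : models mstr RCA0ω;
  M_IND : models mstr IND }.

Section Definability.
Variable M : model.

Notation D := (dom M).
Local Notation "f • x" := (@ap M _ _ f x) (at level 25, left associativity).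

Lemma eqrE (a b : D N) : eqr a b = (a = b).
Proof. by apply: propext; apply: (proj1 (M_ext M)). Qed.

Lemma ext σ τ (f g : D (Arr σ τ)) : (forall x, f • x = g • x) -> f = g.
Proof. exact: (proj2 (M_ext M)). Qed.

Lemma eqmE σ (x y : D σ) : eqm x y <-> x = y.
Proof.
elim: σ x y => [|σ _ τ IH] x y /=; first by rewrite eqrE.
split=> [h|-> z]; last exact/IH.
by apply: ext => z; apply/IH.
Qed.

Lemma satE_eqt Γ σ (s t : tm Γ σ) (e : env D Γ) :
  sat (eqt s t) e <-> eval s e = eval t e.
Proof. by rewrite sat_eqt eqmE. Qed.

Lemma ap_Pi σ τ (x : D σ) (y : D τ) : ct M (cPi σ τ) • x • y = x.
Proof.
pose Γ : ctx := [τ; σ].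
pose t : tm Γ σ := App (App (Cst (cPi σ τ)) (Var (vs vz))) (Var vz).
have : sat (eqt t (Var (vs vz))) ((y, (x, tt)) : env D Γ) := M_RCA M (ax_Pi σ τ) x y.
by rewrite satE_eqt.
Qed.

Lemma ap_Sigma ρ σ τ (x : D (Arr ρ (Arr σ τ))) (y : D (Arr ρ σ)) (z : D ρ) :
  ct M (cSigma ρ σ τ) • x • y • z = x • z • (y • z).
Proof.
pose Γ : ctx := [ρ; Arr ρ σ; Arr ρ (Arr σ τ)].
pose s : tm Γ τ :=
  App (App (App (Cst (cSigma ρ σ τ)) (Var (vs (vs vz)))) (Var (vs vz))) (Var vz).
pose t : tm Γ τ :=
  App (App (Var (vs (vs vz))) (Var vz)) (App (Var (vs vz)) (Var vz)).
have : sat (eqt s t) ((z, (y, (x, tt))) : env D Γ) := M_RCA M (ax_Sigma ρ σ τ) x y z.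
by rewrite satE_eqt.
Qed.

Lemma eval_abs Γ σ τ (t : tm (σ :: Γ) τ) (e : env D Γ) x :
  eval (abs t) e • x = eval t (x, e).
Proof.
move: x; elim: t => [{}τ y|{}τ c|{}τ τ' f IHf a IHa] x /=.
- move: τ y; apply: var_ind_cons => [|τ y] /=; last exact: ap_Pi.
  by rewrite ap_Sigma !ap_Pi.
- exact: ap_Pi.
- by rewrite ap_Sigma IHf IHa.
Qed.

(** The element of the model that computes [f], unique by extensionality; a closed term is the
    default when the model has none. *)
Definition Lam σ τ (f : D σ -> D τ) : D (Arr σ τ) :=
  match pselect (exists c : D (Arr σ τ), forall x, c • x = f x) with
  | left h => projT1 (cid h)
  | right _ => eval (closed_tm [] (Arr σ τ)) tt
  end.

Lemma Lam_unique σ τ (f : D σ -> D τ) c : (forall x, c • x = f x) -> Lam f = c.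
Proof.
move=> cf; rewrite /Lam; case: pselect => [h|[]]; last by exists c.
by case: cid => c' /= c'f; apply: ext => x; rewrite cf c'f.
Qed.

(** No definability condition arises, because the bracket abstraction is itself the required
    element. *)
Lemma eval_lam Γ σ τ (t : tm (σ :: Γ) σ -> tm (σ :: Γ) τ) (e : env D Γ) :
  eval (lam t) e = Lam (fun x => eval (t (Var vz)) (x, e)).
Proof. by apply/esym/Lam_unique => x; apply: eval_abs. Qed.

Fixpoint cat_env Γ Δ : env D Γ -> env D Δ -> env D (Γ ++ Δ)%SEQ :=
  match Γ with
  | [] => fun _ d => d
  | σ :: Γ => fun e d => (e.1, cat_env e.2 d)
  end.

(** The environment [d] lists the parameters. *)
Definition rep Γ σ (f : env D Γ -> D σ) :=
  exists Δ (d : env D Δ) (t : tm (Γ ++ Δ)%SEQ σ), forall e, f e = eval t (cat_env e d).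
Definition definable Γ (P : env D Γ -> Prop) :=
  exists Δ (d : env D Δ) (A : form (Γ ++ Δ)%SEQ), forall e, P e <-> sat A (cat_env e d).

Lemma sub_cat_left Δ1 Δ2 : exists θ : sub Δ1 (Δ1 ++ Δ2)%SEQ,
  forall d1 d2, sub_env θ (cat_env d1 d2) = d1.
Proof.
elim: Δ1 => [|σ Δ IH]; first by exists (@closed_sub _) => -[].
have [θ hθ] := IH; exists (up θ) => -[a d1] d2.
by rewrite -[LHS]/(sub_env (up θ) (a, cat_env d1 d2)) sub_env_up hθ.
Qed.

Lemma sub_cat_right Δ1 Δ2 : exists θ : sub Δ2 (Δ1 ++ Δ2)%SEQ,
  forall d1 d2, sub_env θ (cat_env d1 d2) = d2.
Proof.
elim: Δ1 => [|σ Δ [θ hθ]]; first by exists (@id_sub _) => d1 d2; apply: sub_env_id.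
exists (fun _ x => wk σ (θ _ x)) => -[a d1] d2.
apply: env_ext => τ x; rewrite lookup_sub_env /= eval_wk.
by rewrite -[in RHS](hθ d1 d2) lookup_sub_env.
Qed.

Lemma sub_extend Γ Δ Δ' (d : env D Δ) (d' : env D Δ') :
  (exists θ : sub Δ Δ', sub_env θ d' = d) ->
  exists θ : sub (Γ ++ Δ)%SEQ (Γ ++ Δ')%SEQ,
    forall e, sub_env θ (cat_env e d') = cat_env e d.
Proof.
move=> [θ0 h0]; elim: Γ => [|σ Γ [θ hθ]]; first by exists θ0.
exists (up θ) => -[a e].
by rewrite -[LHS]/(sub_env (up θ) (a, cat_env e d')) sub_env_up hθ.
Qed.

Lemma sub_params Γ Δ1 Δ2 (d1 : env D Δ1) (d2 : env D Δ2) :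
  (exists θ : sub (Γ ++ Δ1)%SEQ (Γ ++ (Δ1 ++ Δ2))%SEQ,
    forall e, sub_env θ (cat_env e (cat_env d1 d2)) = cat_env e d1) /\
  (exists θ : sub (Γ ++ Δ2)%SEQ (Γ ++ (Δ1 ++ Δ2))%SEQ,
    forall e, sub_env θ (cat_env e (cat_env d1 d2)) = cat_env e d2).
Proof.
split; apply: sub_extend.
  by have [θ hθ] := sub_cat_left Δ1 Δ2; exists θ.
by have [θ hθ] := sub_cat_right Δ1 Δ2; exists θ.
Qed.

Lemma rep_const Γ σ (c : D σ) : rep (fun _ : env D Γ => c).
Proof.
have [θ hθ] := sub_cat_right Γ [σ].
exists [σ], (c, tt), (θ _ vz) => e; rewrite -lookup_sub_env.
by rewrite hθ.
Qed.

Lemma rep_fst Γ σ : rep (fun e : env D (σ :: Γ) => e.1).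
Proof. by exists [], tt, (Var vz). Qed.

Lemma rep_snd Γ σ τ (f : env D Γ -> D τ) :
  rep f -> rep (fun e : env D (σ :: Γ) => f e.2).
Proof.
move=> [Δ [d [t ft]]]; exists Δ, d, (wk σ t) => -[a e] /=.
by rewrite ft -(eval_wk (ρ := σ) t a).
Qed.

Lemma rep_lookup Γ σ (x : var Γ σ) : rep (fun e : env D Γ => lookup x e).
Proof.
elim: x => {Γ σ} [Γ σ|Γ σ ρ x IH]; first exact: rep_fst.
exact: (@rep_snd _ _ _ (fun e => lookup x e) IH).
Qed.

Lemma rep_ap Γ σ τ (f : env D Γ -> D (Arr σ τ)) (a : env D Γ -> D σ) :
  rep f -> rep a -> rep (fun e => f e • a e).
Proof.
move=> [Δ1 [d1 [t1 h1]]] [Δ2 [d2 [t2 h2]]].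
have [[θ1 k1] [θ2 k2]] := sub_params Γ d1 d2.
exists (Δ1 ++ Δ2)%SEQ, (cat_env d1 d2), (App (tsub θ1 t1) (tsub θ2 t2)) => e.
by rewrite h1 h2 /= !eval_tsub k1 k2.
Qed.

Lemma rep_Lam Γ σ τ (f : env D Γ -> D σ -> D τ) :
  rep (fun e : env D (σ :: Γ) => f e.2 e.1) -> rep (fun e => Lam (f e)).
Proof.
move=> [Δ [d [t ft]]]; exists Δ, d, (abs t) => e.
by apply: Lam_unique => x; rewrite eval_abs; apply/esym/(ft (x, e)).
Qed.

Lemma LamE σ τ (f : D σ -> D τ) x :
  rep (fun e : env D [σ] => f e.1) -> Lam f • x = f x.
Proof.
move=> [Δ [d [t ft]]].
rewrite (@Lam_unique _ _ f (eval (abs t) d)) => [|y]; rewrite eval_abs.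
  exact/esym/(ft (x, tt)).
exact/esym/(ft (y, tt)).
Qed.

Lemma definable_iff Γ (P Q : env D Γ -> Prop) :
  (forall e, P e <-> Q e) -> definable P -> definable Q.
Proof.
by move=> PQ [Δ [d [A h]]]; exists Δ, d, A => e; rewrite -PQ.
Qed.

Lemma definable_eq Γ (f g : env D Γ -> D N) :
  rep f -> rep g -> definable (fun e => f e = g e).
Proof.
move=> [Δ1 [d1 [t1 h1]]] [Δ2 [d2 [t2 h2]]].
have [[θ1 k1] [θ2 k2]] := sub_params Γ d1 d2.
exists (Δ1 ++ Δ2)%SEQ, (cat_env d1 d2), (Eq0 (tsub θ1 t1) (tsub θ2 t2)) => e.
by rewrite h1 h2 /= eqrE !eval_tsub k1 k2.
Qed.

Lemma definable_ltr Γ (f g : env D Γ -> D N) :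
  rep f -> rep g -> definable (fun e => ltr (f e) (g e)).
Proof.
move=> [Δ1 [d1 [t1 h1]]] [Δ2 [d2 [t2 h2]]].
have [[θ1 k1] [θ2 k2]] := sub_params Γ d1 d2.
exists (Δ1 ++ Δ2)%SEQ, (cat_env d1 d2), (Lt0 (tsub θ1 t1) (tsub θ2 t2)) => e.
by rewrite h1 h2 /= !eval_tsub k1 k2.
Qed.

Lemma definable_imp Γ (P Q : env D Γ -> Prop) :
  definable P -> definable Q -> definable (fun e => P e -> Q e).
Proof.
move=> [Δ1 [d1 [A1 h1]]] [Δ2 [d2 [A2 h2]]].
have [[θ1 k1] [θ2 k2]] := sub_params Γ d1 d2.
exists (Δ1 ++ Δ2)%SEQ, (cat_env d1 d2), (Imp (fsub A1 θ1) (fsub A2 θ2)) => e.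
by rewrite h1 h2 sat_Imp !sat_fsub k1 k2.
Qed.

Lemma definable_False Γ : definable (fun _ : env D Γ => False).
Proof. by exists [], tt, Bot. Qed.

Lemma definable_all Γ σ (P : env D Γ -> D σ -> Prop) :
  definable (fun e : env D (σ :: Γ) => P e.2 e.1) ->
  definable (fun e => forall x, P e x).
Proof.
move=> [Δ [d [A h]]]; exists Δ, d, (All A) => e.
by split=> [k a|k a]; [apply/(h (a, e)); apply: k|apply/(h (a, e)); apply: (k a)].
Qed.

Lemma definable_not Γ (P : env D Γ -> Prop) :
  definable P -> definable (fun e => ~ P e).
Proof. by move=> dP; apply: definable_imp => //; apply: definable_False. Qed.

Lemma not_imp_notE (P Q : Prop) : ~ (P -> ~ Q) <-> P /\ Q.
Proof.
split=> [h|[p q] h]; last exact: h.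
by split; apply: contrapT => n; apply: h.
Qed.

Lemma definable_and Γ (P Q : env D Γ -> Prop) :
  definable P -> definable Q -> definable (fun e => P e /\ Q e).
Proof.
move=> dP dQ.
apply: (@definable_iff _ (fun e => ~ (P e -> ~ Q e))) => [e|]; first exact: not_imp_notE.
by do ?[apply: definable_not|apply: definable_imp].
Qed.

Lemma definable_or Γ (P Q : env D Γ -> Prop) :
  definable P -> definable Q -> definable (fun e => P e \/ Q e).
Proof.
move=> dP dQ; apply: (@definable_iff _ (fun e => ~ P e -> Q e)) => [e|].
  split=> [h|[p|q] np] //.
  by have [p|/h] := pselect (P e); [left|right].
by do ?[apply: definable_not|apply: definable_imp].
Qed.

Lemma definable_ex Γ σ (P : env D Γ -> D σ -> Prop) :
  definable (fun e : env D (σ :: Γ) => P e.2 e.1) ->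
  definable (fun e => exists x, P e x).
Proof.
move=> dP; apply: (@definable_iff _ (fun e => ~ forall x, ~ P e x)) => [e|].
  split=> [|[x Px] /(_ x) []] //.
  by move=> h; apply: contrapT => nP; apply: h => x Px; apply: nP; exists x.
by apply/definable_not/definable_all/definable_not.
Qed.

Lemma sat_and Γ (A B : form Γ) (e : env D Γ) :
  sat (And A B) e <-> sat A e /\ sat B e.
Proof. exact: not_imp_notE. Qed.

Lemma sat_or Γ (A B : form Γ) (e : env D Γ) :
  sat (Or A B) e <-> sat A e \/ sat B e.
Proof.
split=> [h|[a /(_ a) []|b _]] //.
by have [|na] := pselect (sat A e); [left|right; apply: h].
Qed.

Lemma sat_not Γ (A : form Γ) (e : env D Γ) : sat (Not A) e <-> ~ sat A e.
Proof. by []. Qed.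

Lemma sat_fall Γ σ (A : tm (σ :: Γ) σ -> form (σ :: Γ)) (e : env D Γ) :
  sat (fall A) e <-> forall x, sat (A (Var vz)) (x, e).
Proof. by []. Qed.

Lemma sat_fex Γ σ (A : tm (σ :: Γ) σ -> form (σ :: Γ)) (e : env D Γ) :
  sat (fex A) e <-> exists x, sat (A (Var vz)) (x, e).
Proof.
split=> [h|[x h] k]; last exact: (k x).
by apply: contrapT => nA; apply: h => x Ax; apply: nA; exists x.
Qed.

(** * The natural numbers of the model *)

Definition m0 : D N := ct M cZero.
Definition m1 : D N := ct M cOne.
Definition madd (a b : D N) : D N := ct M cPlus • a • b.
Definition mmul (a b : D N) : D N := ct M cTimes • a • b.

Lemma mind (P : D N -> Prop) : definable (fun e : env D [N] => P e.1) ->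
  P m0 -> (forall n, P n -> P (madd n m1)) -> forall n, P n.
Proof.
move=> [Δ [d [A h]]] P0 PS n.
have hP k : P k <-> sat A (k, d) by apply: (h (k, tt)).
have := M_IND M (@ax_ind Δ A); rewrite sat_closure => /(_ d).
rewrite /induction !sat_Imp sat_inst => ind.
apply/hP; apply: ind; first exact/hP.
move=> k; rewrite sat_Imp sat_fsub => /hP/PS/hP.
suff -> : sub_env (scons (App (App (Cst cPlus) (Var vz)) (Cst cOne))
    (fun _ x => Var (vs x))) (k, d) = (madd k m1, d) by [].
by congr pair; apply: (@sub_env_shift M Δ N).
Qed.
End Definability.

Notation "f • x" := (@ap (mstr _) _ _ f x) (at level 25, left associativity).

Section Arith.
Variable M : model.
Notation D := (dom M).
Implicit Types a b c n k : D N.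

Lemma maddA : associative (@madd M).
Proof. by move=> a b c; rewrite -eqrE; apply/(M_RCA M (ax_semiring sr_eq_sym))/(M_RCA M (ax_semiring sr_add_assoc)). Qed.
Lemma maddC : commutative (@madd M).
Proof. by move=> a b; rewrite -eqrE; apply: (M_RCA M (ax_semiring sr_add_comm)). Qed.
Lemma mmulA : associative (@mmul M).
Proof. by move=> a b c; rewrite -eqrE; apply/(M_RCA M (ax_semiring sr_eq_sym))/(M_RCA M (ax_semiring sr_mul_assoc)). Qed.
Lemma mmulC : commutative (@mmul M).
Proof. by move=> a b; rewrite -eqrE; apply: (M_RCA M (ax_semiring sr_mul_comm)). Qed.
Lemma madd0 : left_id (m0 M) (@madd M).
Proof. by move=> a; rewrite maddC -eqrE; apply: (M_RCA M (ax_semiring sr_add_0)). Qed.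
Lemma mmul1 : left_id (m1 M) (@mmul M).
Proof. by move=> a; rewrite mmulC -eqrE; apply: (M_RCA M (ax_semiring sr_mul_1)). Qed.
Lemma mmul0 : left_zero (m0 M) (@mmul M).
Proof. by move=> a; rewrite mmulC -eqrE; apply: (M_RCA M (ax_semiring sr_mul_0)). Qed.
Lemma mmulDl : left_distributive (@mmul M) (@madd M).
Proof.
move=> a b c; rewrite mmulC ![mmul _ c]mmulC -eqrE.
exact: (M_RCA M (ax_semiring sr_mul_add)).
Qed.
Lemma mlt_irr a : ~ ltr a a.
Proof. exact: (M_RCA M (ax_semiring sr_lt_irrefl) a). Qed.
Lemma mlt01 : ltr (m0 M) (m1 M).
Proof. exact: (M_RCA M (ax_semiring sr_lt_01)). Qed.
End Arith.
HB.instance Definition _ (M : structure) := gen_eqMixin (dom M N).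
HB.instance Definition _ (M : structure) := gen_choiceMixin (dom M N).
HB.instance Definition _ (M : model) :=
  GRing.isNmodule.Build (dom M N) (@maddA M) (@maddC M) (@madd0 M).

Lemma m1_neq0 (M : model) : m1 M != 0%R :> dom M N.
Proof. by apply/eqP => e; have := mlt01 M; rewrite e => /mlt_irr. Qed.

HB.instance Definition _ (M : model) := GRing.Nmodule_isComNzSemiRing.Build (dom M N)
  (@mmulA M) (@mmulC M) (@mmul1 M) (@mmulDl M) (@mmul0 M) (@m1_neq0 M).

Local Open Scope ring_scope.

Section Induction.
Variable M : model.
Notation D := (dom M).
Implicit Types a b c n k : D N.

Lemma nat_ind (P : D N -> Prop) : definable (fun e : env D [N] => P e.1) ->
  P 0 -> (forall n, P n -> P (n + 1)) -> forall n, P n.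
Proof. exact: mind. Qed.

Lemma rep_add Γ (f g : env D Γ -> D N) : rep f -> rep g -> rep (fun e => f e + g e).
Proof. by move=> rf rg; do 2?apply: rep_ap => //; apply: rep_const. Qed.

Lemma rep_mul Γ (f g : env D Γ -> D N) : rep f -> rep g -> rep (fun e => f e * g e).
Proof. by move=> rf rg; do 2?apply: rep_ap => //; apply: rep_const. Qed.

End Induction.

Ltac rep_var := first
  [ exact: (rep_lookup _ vz) | exact: (rep_lookup _ (vs vz))
  | exact: (rep_lookup _ (vs (vs vz))) | exact: (rep_lookup _ (vs (vs (vs vz))))
  | exact: (rep_lookup _ (vs (vs (vs (vs vz)))))
  | exact: (rep_lookup _ (vs (vs (vs (vs (vs vz))))))
  | exact: (rep_lookup _ (vs (vs (vs (vs (vs (vs vz))))))) ].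

(** A hook, redefined each time further operations are shown to be representable. *)
Ltac rep_ext := fail.
Ltac rep_step := cbn beta; lazymatch goal with
  | |- rep (fun _ => ?c) => apply: rep_const
  | |- rep (fun _ => @Algebra.add _ _ _) => apply: rep_add
  | |- rep (fun _ => @GRing.mul _ _ _) => apply: rep_mul
  | |- rep (fun _ => Lam _) => apply: rep_Lam
  | |- rep (fun _ => ap _ _) => apply: rep_ap
  | |- _ => first [ assumption | rep_var | rep_ext ]
  end.
Ltac rep_tac := repeat rep_step.

Ltac def_ext := fail.
Ltac def_step := cbn beta; first
  [ apply: definable_False | apply: definable_imp | apply: definable_all
  | apply: definable_ex | apply: definable_and | apply: definable_or
  | apply: definable_not | apply: definable_eq | apply: definable_ltr | def_ext ].
Ltac def_tac := repeat def_step; rep_tac.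

Section Order.
Variable M : model.
Notation D := (dom M).
Implicit Types a b c n k : D N.

Lemma ltr_trans a b c : ltr a b -> ltr b c -> ltr a c.
Proof. exact: (M_RCA M (ax_semiring sr_lt_trans)). Qed.

Lemma ltr_total a b : ltr a b \/ a = b \/ ltr b a.
Proof.
pose x : tm [N; N] N := Var (vs vz); pose y : tm [N; N] N := Var vz.
have : sat (Or (Lt0 x y) (Or (Eq0 x y) (Lt0 y x))) ((b, (a, tt)) : env D [N; N]) :=
  M_RCA M (ax_semiring sr_lt_total) a b.
by rewrite !sat_or /= eqrE.
Qed.

Lemma ltr_add a b c : ltr a b -> ltr (a + c) (b + c).
Proof. exact: (M_RCA M (ax_semiring sr_lt_add)). Qed.

Lemma ltr_mul a b c : ltr 0 c -> ltr a b -> ltr (a * c) (b * c).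
Proof. exact: (M_RCA M (ax_semiring sr_lt_mul) a b c). Qed.

Lemma ltr_ge0 a : ltr 0 a \/ a = 0.
Proof.
pose x : tm [N] N := Var vz.
have : sat (Or (Lt0 (Cst cZero) x) (Eq0 (Cst cZero) x)) ((a, tt) : env D [N]) :=
  M_RCA M (ax_semiring sr_le_0) a.
by rewrite !sat_or /= eqrE => -[|<-]; [left|right].
Qed.

Lemma ltr_succ a b : ltr a b -> ltr (a + 1) b \/ a + 1 = b.
Proof.
move=> ab; pose x : tm [N; N] N := Var (vs vz); pose y : tm [N; N] N := Var vz.
have : sat (Imp (Lt0 x y) (Or (Lt0 (App (App (Cst cPlus) x) (Cst cOne)) y)
    (Eq0 (App (App (Cst cPlus) x) (Cst cOne)) y))) ((b, (a, tt)) : env D [N; N]) :=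
  M_RCA M (ax_semiring sr_lt_discrete) a b.
by rewrite sat_Imp sat_or /= eqrE; apply.
Qed.

(** Induction on [b], for all [a] at once; discreteness of the order decides whether [b + 1] lies
    beyond [b] only. *)
Lemma ltr_sub a b : ltr a b -> exists k, b = a + (k + 1).
Proof.
move: b a; apply: nat_ind; first by def_tac.
  move=> a a0; have [/(ltr_trans a0)/mlt_irr//|a00] := ltr_ge0 a.
  by move: a0; rewrite a00 => /mlt_irr.
move=> b IH a ab; have [/IH[k ->]|[->|/ltr_succ ba]] := ltr_total a b.
- by exists (k + 1); rewrite !addrA.
- by exists 0; rewrite add0r.
- by case: ba => [/(ltr_trans ab)/mlt_irr|ba] //; move: ab; rewrite ba => /mlt_irr.
Qed.

Definition mnat : osemiring := @OSemiring (dom M N) (@ltr M) (@mlt_irr M) ltr_trans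
  ltr_total ltr_add ltr_mul (mlt01 M) ltr_ge0 ltr_sub.

End Order.

(** * Primitive recursion in the model *)

Section Recursion.
Variable M : model.
Notation D := (dom M).
Implicit Types a b c n k : D N.

Lemma rep_apply2 σ τ ρ (f : env D [σ; τ] -> D ρ) (y : D τ) :
  rep f -> rep (fun e : env D [σ] => f (e.1, (y, tt))).
Proof.
by move=> [Δ [d [t ft]]]; exists (τ :: Δ), (y, d), t => e; rewrite ft.
Qed.

Definition mrec (F : D N -> D N -> D N) m n : D N :=
  ct M cRec • Lam (fun i => Lam (F i)) • m • n.

Lemma mrec0 F m : mrec F m 0 = m.
Proof.
by rewrite -eqrE; apply: (M_RCA M ax_rec_0 _ m).
Qed.

Lemma mrecS F m n : rep (fun e : env D [N; N] => F e.2.1 e.1) ->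
  mrec F m (n + 1) = F n (mrec F m n).
Proof.
move=> rF.
have : eqr (mrec F m (n + 1)) (Lam (fun i => Lam (F i)) • n • mrec F m n) :=
  M_RCA M ax_rec_S (Lam (fun i => Lam (F i))) m n.
rewrite eqrE => ->; rewrite LamE; last exact: rep_Lam.
by rewrite LamE //; apply: (rep_apply2 n rF).
Qed.

Lemma rep_mrec Γ (F : env D Γ -> D N -> D N -> D N) (m n : env D Γ -> D N) :
  rep (fun e : env D (N :: N :: Γ) => F e.2.2 e.2.1 e.1) -> rep m -> rep n ->
  rep (fun e => mrec (F e) (m e) (n e)).
Proof.
move=> rF rm rn; apply: rep_ap => //; apply: rep_ap => //.
apply: rep_ap; first exact: rep_const.
by apply: rep_Lam; apply: rep_Lam.
Qed.

Lemma mcase n : n = 0 \/ exists k, n = k + 1.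
Proof.
have [/ltr_sub[k ->]|] := ltr_ge0 n; last by left.
by right; exists k; rewrite add0r.
Qed.

Definition mpred n := mrec (fun i _ => i) 0 n.
Definition mmonus m n := mrec (fun _ r => mpred r) m n.
Definition mpow2 n := mrec (fun _ r => r + r) 1 n.
Definition mtri n := mrec (fun i r => r + (i + 1)) 0 n.
Definition mpair m n := mtri (m + n) + m.
Definition mroot q :=
  mrec (fun i w => w + mmonus 1 (mmonus (mtri (w + 1)) (i + 1))) 0 q.
Definition mfst q := mmonus q (mtri (mroot q)).
Definition msnd q := mmonus (mroot q) (mfst q).
(** Selects [a] when the test [c] is zero: zero stands for truth in all tests below. *)
Definition mite c a b := mrec (fun _ _ => b) a c.

End Recursion.

Ltac rep_ext ::= lazymatch goal with
  | |- rep (fun _ => mrec _ _ _) => apply: rep_mrec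
  end.

Ltac rep_unfold F := intros; unfold F; rep_tac.

Section Arithmetic.
Variable M : model.
Notation D := (dom M).
Notation Q := (frac (mnat M)).
Implicit Types a b c n k q w : D N.

Lemma mpred0 : mpred 0 = 0 :> D N. Proof. exact: mrec0. Qed.
Lemma mpredS n : mpred (n + 1) = n. Proof. by rewrite /mpred mrecS //; rep_tac. Qed.

Lemma rep_mpred Γ (f : env D Γ -> D N) : rep f -> rep (fun e => mpred (f e)).
Proof. rep_unfold @mpred. Qed.
Lemma rep_mmonus Γ (f g : env D Γ -> D N) : rep f -> rep g -> rep (fun e => mmonus (f e) (g e)).
Proof. by rep_unfold @mmonus; apply: rep_mpred; rep_tac. Qed.
Lemma rep_mpow2 Γ (f : env D Γ -> D N) : rep f -> rep (fun e => mpow2 (f e)).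
Proof. rep_unfold @mpow2. Qed.
Lemma rep_mtri Γ (f : env D Γ -> D N) : rep f -> rep (fun e => mtri (f e)).
Proof. rep_unfold @mtri. Qed.
Lemma rep_mpair Γ (f g : env D Γ -> D N) : rep f -> rep g -> rep (fun e => mpair (f e) (g e)).
Proof. by move=> rf rg; apply: rep_add => //; apply: rep_mtri; apply: rep_add. Qed.
Lemma rep_mroot Γ (f : env D Γ -> D N) : rep f -> rep (fun e => mroot (f e)).
Proof.
move=> rf; apply: rep_mrec => //; rep_tac; apply: rep_mmonus; rep_tac.
by apply: rep_mmonus; rep_tac; apply: rep_mtri; rep_tac.
Qed.
Lemma rep_mfst Γ (f : env D Γ -> D N) : rep f -> rep (fun e => mfst (f e)).
Proof. by move=> rf; apply: rep_mmonus => //; apply: rep_mtri; apply: rep_mroot. Qed.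
Lemma rep_msnd Γ (f : env D Γ -> D N) : rep f -> rep (fun e => msnd (f e)).
Proof. by move=> rf; apply: rep_mmonus; [apply: rep_mroot|apply: rep_mfst]. Qed.
Lemma rep_mite Γ (f g h : env D Γ -> D N) : rep f -> rep g -> rep h ->
  rep (fun e => mite (f e) (g e) (h e)).
Proof.
move=> rf rg rh; apply: rep_mrec => //.
by apply: (@rep_snd _ _ _ _ (fun e : env D (N :: Γ) => h e.2)); apply: rep_snd.
Qed.
End Arithmetic.

Ltac rep_nat := lazymatch goal with
  | |- rep (fun _ => mpred _) => apply: rep_mpred
  | |- rep (fun _ => mmonus _ _) => apply: rep_mmonus
  | |- rep (fun _ => mpow2 _) => apply: rep_mpow2
  | |- rep (fun _ => mtri _) => apply: rep_mtri
  | |- rep (fun _ => mpair _ _) => apply: rep_mpair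
  | |- rep (fun _ => mroot _) => apply: rep_mroot
  | |- rep (fun _ => mfst _) => apply: rep_mfst
  | |- rep (fun _ => msnd _) => apply: rep_msnd
  | |- rep (fun _ => mite _ _ _) => apply: rep_mite
  | |- rep (fun _ => mrec _ _ _) => apply: rep_mrec
  end.
Ltac rep_ext ::= rep_nat.

Opaque lam wk.

(** * Evaluation of the arithmetic terms *)

Section EvalBasics.
Variable M : model.
Notation D := (dom M).
Variables (Γ : ctx) (e : env D Γ).

Lemma eval_App σ τ (f : tm Γ (Arr σ τ)) a : eval (App f a) e = eval f e • eval a e.
Proof. by []. Qed.
Lemma eval_Cst σ (c : cst σ) : eval (Cst c) e = ct M c.
Proof. by []. Qed.
Lemma eval_rec (f : tm Γ (Arr N (Arr N N))) s t :
  eval (App (App (App (Cst cRec) f) s) t) e =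
  ct M cRec • eval f e • eval s e • eval t e.
Proof. by []. Qed.
Lemma eval_plus (s t : tm Γ N) : eval (s + t)%tm e = eval s e + eval t e.
Proof. by []. Qed.
Lemma eval_times (s t : tm Γ N) : eval (s * t)%tm e = eval s e * eval t e.
Proof. by []. Qed.
Lemma eval_0 : eval (Cst cZero) e = 0 :> D N.
Proof. by []. Qed.
Lemma eval_1 : eval (Cst cOne) e = 1 :> D N.
Proof. by []. Qed.
Lemma eval_Var σ (x : var Γ σ) : eval (Var x) e = lookup x e.
Proof. by []. Qed.
End EvalBasics.

Ltac lam_ext := congr (@Lam _ _ _ _); apply: funext => ?.
Definition evalE := (eval_plus, eval_times, eval_0, eval_1, eval_App, eval_Cst, eval_wk, eval_Var).

Section EvalArith.
Variable M : model.
Notation D := (dom M).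

Lemma eval_npred Γ (t : tm Γ N) (e : env D Γ) : eval (npred t) e = mpred (eval t e).
Proof.
rewrite /npred /mpred /mrec eval_rec eval_lam; do 2 congr (_ • _); congr (_ • _).
lam_ext; rewrite eval_lam; lam_ext; by rewrite !evalE.
Qed.

Lemma eval_monus Γ (s t : tm Γ N) (e : env D Γ) :
  eval (monus s t) e = mmonus (eval s e) (eval t e).
Proof.
rewrite /monus /mmonus {1}/mrec eval_rec eval_lam; do 2 congr (_ • _); congr (_ • _).
lam_ext; rewrite eval_lam; lam_ext.
exact: (eval_npred (Var vz)).
Qed.

Lemma eval_pow2 Γ (t : tm Γ N) (e : env D Γ) : eval (pow2 t) e = mpow2 (eval t e).
Proof.
rewrite /pow2 /mpow2 /mrec eval_rec eval_lam; do 2 congr (_ • _); congr (_ • _).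
by lam_ext; rewrite eval_lam; lam_ext.
Qed.

Lemma eval_tri Γ (t : tm Γ N) (e : env D Γ) : eval (tri t) e = mtri (eval t e).
Proof.
rewrite /tri /mtri /mrec eval_rec eval_lam; do 2 congr (_ • _); congr (_ • _).
by lam_ext; rewrite eval_lam; lam_ext; rewrite !evalE.
Qed.

Lemma eval_npair Γ (s t : tm Γ N) (e : env D Γ) :
  eval (npair s t) e = mpair (eval s e) (eval t e).
Proof. by rewrite /npair eval_plus eval_tri eval_plus. Qed.

Lemma eval_nroot Γ (t : tm Γ N) (e : env D Γ) : eval (nroot t) e = mroot (eval t e).
Proof.
rewrite /nroot /mroot {1}/mrec eval_rec eval_lam; do 2 congr (_ • _); congr (_ • _).
lam_ext; rewrite eval_lam; lam_ext.
by rewrite eval_plus !eval_monus eval_tri !evalE.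
Qed.

Lemma eval_nfst Γ (t : tm Γ N) (e : env D Γ) : eval (nfst t) e = mfst (eval t e).
Proof. by rewrite /nfst eval_monus eval_tri eval_nroot. Qed.
Lemma eval_nsnd Γ (t : tm Γ N) (e : env D Γ) : eval (nsnd t) e = msnd (eval t e).
Proof. by rewrite /nsnd eval_monus eval_nroot eval_nfst. Qed.
End EvalArith.

Opaque npred monus pow2 tri npair nroot nfst nsnd.

(** * Subtraction, pairing and powers of two, computed in the fraction field *)

Section Embedding.
Variable M : model.
Notation D := (dom M).
Notation Q := (frac (mnat M)).
Implicit Types a b c n k q w : D N.

(** Moves inequalities between numbers into an ordered field, where [lra] settles them. *)
Definition iota a : Q := @mkfrac (mnat M) a 0 0.

Lemma iota0 : iota 0 = 0. Proof. by []. Qed.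
Lemma iota1 : iota 1 = 1. Proof. by []. Qed.
Lemma iotaD a b : iota (a + b) = iota a + iota b.
Proof. by rewrite /iota mkfracD; apply/mkfrac_eq; rewrite /denM; ring. Qed.
Lemma iota_lt a b : ltr a b <-> iota a < iota b.
Proof.
rewrite mkfrac_lt.
have e (x : mnat M) : x * (0 + 1) + 0 * (0 + 1) = x by ring.
by rewrite !e.
Qed.
Lemma iota_inj a b : iota a = iota b -> a = b.
Proof.
move=> e; have [/iota_lt|[//|/iota_lt]] := ltr_total a b; rewrite e ltxx //.
Qed.
Lemma iota_ge0 a : 0 <= iota a.
Proof. by rewrite -iota0; have [/iota_lt/ltW|->] := ltr_ge0 a. Qed.
Lemma iota_succ a b : iota a < iota b -> iota a + 1 <= iota b.
Proof.
move=> /iota_lt/ltr_sub[k ->]; rewrite !iotaD iota1.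
by have := iota_ge0 k; lra.
Qed.
Lemma mmonus0 m : mmonus m 0 = m :> D N. Proof. exact: mrec0. Qed.
Lemma mmonusS m n : mmonus m (n + 1) = mpred (mmonus m n) :> D N.
Proof. by rewrite /mmonus mrecS //; rep_tac. Qed.

Lemma iota_monus m n : iota (mmonus m n) =
  if iota n <= iota m then iota m - iota n else 0.
Proof.
pose P (n : D N) := exists k, (mmonus m n = k /\ m = n + k) \/ (mmonus m n = 0 /\ ltr m n).
have : P n.
  move: n; apply: nat_ind; first by rewrite /P; def_tac.
    by exists m; left; rewrite mmonus0 add0r.
  move=> n [k [[e em]|[e lt]]].
    have [k0|[l kl]] := mcase k.
      exists 0; right; rewrite mmonusS e k0 mpred0; split=> //.
      by apply/iota_lt; rewrite em k0 !iotaD iota0 iota1; lra.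
    by exists l; left; rewrite mmonusS e kl mpredS; split=> //; rewrite em kl; ring.
  exists 0; right; rewrite mmonusS e mpred0; split=> //.
  by move: lt; rewrite !iota_lt iotaD iota1; lra.
move=> [k [[-> ->]|[-> /iota_lt lt]]].
  rewrite iotaD; case: ifP => [_|]; first lra.
  by have := iota_ge0 k => k0; move=> /negbT; rewrite -ltNge; lra.
by rewrite iota0; case: ifP => // h; lra.
Qed.

Lemma mtri0 : mtri 0 = 0 :> D N. Proof. exact: mrec0. Qed.
Lemma mtriS n : mtri (n + 1) = mtri n + (n + 1) :> D N.
Proof. by rewrite /mtri mrecS //; rep_tac. Qed.

Lemma mtri_mono a k : exists c, mtri (a + k) = mtri a + c.
Proof.
move: k; apply: nat_ind; first by def_tac.
  by exists 0; rewrite !addr0.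
move=> k [c e]; exists (c + (a + k + 1)).
by rewrite (addrA a) mtriS e; ring.
Qed.

Lemma mroot_spec q :
  ~ ltr q (mtri (mroot q)) /\ ltr q (mtri (mroot q + 1)).
Proof.
move: q; apply: nat_ind; first by def_tac.
  have -> : mroot 0 = 0 :> D N by exact: mrec0.
  rewrite mtriS mtri0 !add0r; split; first exact: mlt_irr.
  exact: mlt01.
move=> q []; set w := mroot q => lo hi.
have -> : mroot (q + 1) = w + mmonus 1 (mmonus (mtri (w + 1)) (q + 1)).
  by rewrite /mroot mrecS //; rep_tac.
(* The root is raised by one exactly when [q + 1] reaches the next triangular number: below it the
   inner difference is at least 1 and the correction vanishes, at it the correction is 1. *)
have {hi}[hi|hi] := ltr_succ hi.
  have -> : mmonus 1 (mmonus (mtri (w + 1)) (q + 1)) = 0.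
    move: hi; rewrite iota_lt => hi.
    apply: iota_inj; rewrite iota0 !iota_monus (ltW hi).
    by move: (iota_succ hi); rewrite iota1; case: ifP => //; lra.
  rewrite addr0; split=> //.
  by move: lo; rewrite !iota_lt iotaD iota1; lra.
have -> : mmonus 1 (mmonus (mtri (w + 1)) (q + 1)) = 1.
  by apply: iota_inj; rewrite !iota_monus hi lexx subrr iota_ge0 subr0.
rewrite hi; split; first exact: mlt_irr.
rewrite (mtriS (w + 1)) iota_lt !iotaD iota1.
by have := iota_ge0 w; lra.
Qed.

Lemma mroot_unique q w : ~ ltr q (mtri w) -> ltr q (mtri (w + 1)) -> mroot q = w.
Proof.
move=> lo hi; have [lo' hi'] := mroot_spec q.
have aux x y : ltr q (mtri (x + 1)) -> ~ ltr q (mtri y) -> ~ ltr x y.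
  move=> h1 h2 /ltr_sub[k e]; apply: h2; move: h1; rewrite e (addrC k) addrA.
  have [c ->] := mtri_mono (x + 1) k; rewrite !iota_lt iotaD.
  by have := iota_ge0 c; lra.
by have [/aux|[|/aux]] := ltr_total (mroot q) w; [case|..|case].
Qed.

Lemma mroot_pair a b : mroot (mpair a b) = a + b.
Proof.
apply: mroot_unique; rewrite /mpair iota_lt.
  by rewrite iotaD; have := iota_ge0 a; lra.
by rewrite mtriS !iotaD iota1; have := iota_ge0 b; lra.
Qed.

Lemma mmonusDl a b : mmonus (a + b) a = b.
Proof.
apply: iota_inj; rewrite iota_monus iotaD.
by rewrite lerDl iota_ge0; lra.
Qed.

Lemma mfst_pair a b : mfst (mpair a b) = a.
Proof. by rewrite /mfst mroot_pair {1}/mpair mmonusDl. Qed.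
Lemma msnd_pair a b : msnd (mpair a b) = b.
Proof. by rewrite /msnd mroot_pair mfst_pair mmonusDl. Qed.

Lemma mite0 a b : mite 0 a b = a.
Proof. exact: mrec0. Qed.
Lemma miteS c a b : mite (c + 1) a b = b.
Proof. by rewrite /mite mrecS //; rep_tac. Qed.

Lemma mpow20 : mpow2 0 = 1 :> D N. Proof. exact: mrec0. Qed.
Lemma mpow2S n : mpow2 (n + 1) = mpow2 n + mpow2 n :> D N.
Proof. by rewrite /mpow2 mrecS //; rep_tac. Qed.
Lemma mpow2_pos n : exists k, mpow2 n = k + 1.
Proof.
move: n; apply: nat_ind; first by def_tac.
  by exists 0; rewrite mpow20 add0r.
by move=> n [k e]; exists (k + 1 + k); rewrite mpow2S e addrA.
Qed.

Opaque mrec mpred mmonus mpow2 mtri mpair mroot mfst msnd mite.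

(** * Codes of rationals *)

Definition mrat a b c : D N := mpair (mpair a b) c.
Definition mpos q := mfst (mfst q).
Definition mneg q := msnd (mfst q).
Definition mden q := msnd q + 1.
Definition mqadd p q := mrat (mpos p * mden q + mpos q * mden p)
  (mneg p * mden q + mneg q * mden p) (mpred (mden p * mden q)).
Definition mqopp q := mrat (mneg q) (mpos q) (msnd q).
Definition mqabs q :=
  mrat (mmonus (mpos q) (mneg q) + mmonus (mneg q) (mpos q)) 0 (msnd q).
Definition mqhalf n : D N := mrat 1 0 (mpred (mpow2 n)).
Definition mqlhs p q := mpos p * mden q + mneg q * mden p.

Definition qval q : Q := @mkfrac (mnat M) (mpos q) (mneg q) (msnd q).
Definition hpow n : Q := qval (mqhalf n).

Lemma mpos_rat a b c : mpos (mrat a b c) = a.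
Proof. by rewrite /mpos !mfst_pair. Qed.
Lemma mneg_rat a b c : mneg (mrat a b c) = b.
Proof. by rewrite /mneg mfst_pair msnd_pair. Qed.
Lemma msnd_rat a b c : msnd (mrat a b c) = c.
Proof. exact: msnd_pair. Qed.

Lemma qval_rat a b c : qval (mrat a b c) = @mkfrac (mnat M) a b c.
Proof. by rewrite /qval mpos_rat mneg_rat msnd_rat. Qed.

Lemma qvalD p q : qval (mqadd p q) = qval p + qval q.
Proof.
rewrite qval_rat mkfracD; congr mkfrac.
have -> : mden p * mden q = denM (S := mnat M) (msnd p) (msnd q) + 1.
  by rewrite denME.
exact: mpredS.
Qed.

Lemma qvalN q : qval (mqopp q) = - qval q.
Proof. by rewrite qval_rat mkfracN. Qed.

Lemma qval_lt p q : ltr (mqlhs p q) (mqlhs q p) <-> qval p < qval q.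
Proof. by rewrite mkfrac_lt /mqlhs; apply: iff_refl. Qed.

Lemma mkfracE a b c : @mkfrac (mnat M) a b c = (iota a - iota b) / (iota c + 1).
Proof.
have c1 : iota c + 1 != 0 by apply: lt0r_neq0; have := iota_ge0 c; lra.
apply: (mulIf c1); rewrite divfK // -iota1 -iotaD mkfracN mkfracD mkfracM.
by apply/mkfrac_eq; rewrite /denM; ring.
Qed.

Lemma qval_abs q : qval (mqabs q) = `|qval q|.
Proof.
rewrite qval_rat [in RHS]/qval !mkfracE normrM iota0 subr0.
have c1 : 0 < (iota (msnd q) + 1)^-1 by rewrite invr_gt0; have := iota_ge0 (msnd q); lra.
rewrite (gtr0_norm c1); congr (_ * _); move: (mpos q) (mneg q) => a b.
by rewrite iotaD !iota_monus; case: lerP => h; case: lerP => k; lra.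
Qed.

Lemma hpowE n : hpow n = (iota (mpow2 n))^-1.
Proof.
rewrite /hpow qval_rat mkfracE iota0 subr0 iota1 mul1r -iota1 -iotaD.
by have [k ->] := mpow2_pos n; rewrite mpredS.
Qed.

Lemma hpowS n : hpow (n + 1) = hpow n / 2%:R.
Proof.
have e (x : Q) : x + x = x * 2%:R by lra.
by rewrite !hpowE mpow2S iotaD e invfM.
Qed.

Lemma hpow_gt0 n : 0 < hpow n.
Proof.
rewrite hpowE invr_gt0; have [k ->] := mpow2_pos n.
by rewrite iotaD iota1; have := iota_ge0 k; lra.
Qed.

Lemma qval_multiple n k : qval (mrat n 0 (mpred (mpow2 k))) = iota n * hpow k.
Proof.
rewrite qval_rat mkfracE iota0 subr0 hpowE -iota1 -iotaD.
by have [l ->] := mpow2_pos k; rewrite mpredS.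
Qed.

Lemma qval0 : qval (mrat 0 0 0) = 0. Proof. by rewrite qval_rat. Qed.
Lemma qval1 : qval (mrat 1 0 0) = 1. Proof. by rewrite qval_rat. Qed.

Lemma rep_mrat Γ (f g h : env D Γ -> D N) :
  rep f -> rep g -> rep h -> rep (fun e => mrat (f e) (g e) (h e)).
Proof. by move=> *; do 2?apply: rep_mpair. Qed.
Lemma rep_mqadd Γ (f g : env D Γ -> D N) :
  rep f -> rep g -> rep (fun e => mqadd (f e) (g e)).
Proof. by move=> *; rewrite /mqadd /mrat /mpos /mneg /mden; rep_tac. Qed.
Lemma rep_mqopp Γ (f : env D Γ -> D N) :
  rep f -> rep (fun e => mqopp (f e)).
Proof. by move=> *; rewrite /mqopp /mrat /mpos /mneg; rep_tac. Qed.
Lemma rep_mqabs Γ (f : env D Γ -> D N) :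
  rep f -> rep (fun e => mqabs (f e)).
Proof. by move=> *; rewrite /mqabs /mrat /mpos /mneg; rep_tac. Qed.
Lemma rep_mqhalf Γ (f : env D Γ -> D N) :
  rep f -> rep (fun e => mqhalf (f e)).
Proof. by move=> *; rewrite /mqhalf /mrat; rep_tac. Qed.
Lemma rep_mqlhs Γ (f g : env D Γ -> D N) :
  rep f -> rep g -> rep (fun e => mqlhs (f e) (g e)).
Proof. by move=> *; rewrite /mqlhs /mpos /mneg /mden; rep_tac. Qed.

(** Fractions are not objects of the model, so a function with values in [Q] counts as representable
    when codes of its values are. *)
Definition repQ Γ (f : env D Γ -> Q) :=
  exists2 p : env D Γ -> D N, rep p & forall e, f e = qval (p e).

Lemma repQ_qval Γ (p : env D Γ -> D N) : rep p -> repQ (fun e => qval (p e)).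
Proof. by move=> rp; exists p. Qed.

Lemma repQ0 Γ : repQ (fun _ : env D Γ => 0).
Proof. by exists (fun _ => mrat 0 0 0) => [|e]; [apply: rep_const|rewrite qval0]. Qed.

Lemma repQ1 Γ : repQ (fun _ : env D Γ => 1).
Proof. by exists (fun _ => mrat 1 0 0) => [|e]; [apply: rep_const|rewrite qval1]. Qed.

Lemma repQ_add Γ (f g : env D Γ -> Q) : repQ f -> repQ g -> repQ (fun e => f e + g e).
Proof.
move=> [p rp fp] [q rq gq]; exists (fun e => mqadd (p e) (q e)) => [|e].
  exact: rep_mqadd.
by rewrite qvalD fp gq.
Qed.

Lemma repQ_opp Γ (f : env D Γ -> Q) : repQ f -> repQ (fun e => - f e).
Proof.
move=> [p rp fp]; exists (fun e => mqopp (p e)) => [|e].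
  exact: rep_mqopp.
by rewrite qvalN fp.
Qed.

Lemma repQ_norm Γ (f : env D Γ -> Q) : repQ f -> repQ (fun e => `|f e|).
Proof.
move=> [p rp fp]; exists (fun e => mqabs (p e)) => [|e].
  exact: rep_mqabs.
by rewrite qval_abs fp.
Qed.

Lemma repQ_hpow Γ (n : env D Γ -> D N) : rep n -> repQ (fun e => hpow (n e)).
Proof. by move=> rn; apply: repQ_qval; apply: rep_mqhalf. Qed.

Lemma definable_ltQ Γ (f g : env D Γ -> Q) : repQ f -> repQ g ->
  definable (fun e => f e < g e).
Proof.
move=> [p rp fp] [q rq gq].
apply: (@definable_iff _ _ (fun e => ltr (mqlhs (p e) (q e)) (mqlhs (q e) (p e)))).
  by move=> e; rewrite fp gq qval_lt.
by apply: definable_ltr; apply: rep_mqlhs.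
Qed.

Lemma definable_leQ Γ (f g : env D Γ -> Q) : repQ f -> repQ g ->
  definable (fun e => f e <= g e).
Proof.
move=> rf rg; apply: (@definable_iff _ _ (fun e => ~ g e < f e)).
  by move=> e; rewrite leNgt -(rwP negP).
by apply/definable_not/definable_ltQ.
Qed.

Lemma definable_andb Γ (b c : env D Γ -> bool) :
  definable (fun e => b e) -> definable (fun e => c e) -> definable (fun e => b e && c e).
Proof.
move=> db dc; apply: (@definable_iff _ _ (fun e => b e /\ c e)).
  by move=> e; apply: (rwP andP).
exact: definable_and.
Qed.

End Embedding.

Ltac rep_rat := lazymatch goal with
  | |- rep (fun _ => mrat _ _ _) => apply: rep_mrat
  | |- rep (fun _ => mqadd _ _) => apply: rep_mqadd
  | |- rep (fun _ => mqopp _) => apply: rep_mqopp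
  | |- rep (fun _ => mqabs _) => apply: rep_mqabs
  | |- rep (fun _ => mqhalf _) => apply: rep_mqhalf
  | |- rep (fun _ => mqlhs _ _) => apply: rep_mqlhs
  | |- _ => rep_nat
  end.
Ltac rep_ext ::= rep_rat.
Ltac repQ_step := cbn beta; first
  [ assumption | apply: repQ_hpow; rep_tac | apply: repQ_qval; rep_tac
  | apply: repQ0 | apply: repQ1 | apply: repQ_add | apply: repQ_opp | apply: repQ_norm ].
Ltac def_ext ::= first
  [ apply: definable_andb | apply: definable_ltQ; repeat repQ_step | apply: definable_leQ; repeat repQ_step ].

(** * Meaning of the formulas about reals and nets *)

Lemma forall_iff A (P Q : A -> Prop) :
  (forall x, P x <-> Q x) -> (forall x, P x) <-> (forall x, Q x).
Proof. by move=> PQ; split=> h x; apply/PQ. Qed.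
Lemma exists_iff A (P Q : A -> Prop) :
  (forall x, P x <-> Q x) -> (exists x, P x) <-> (exists x, Q x).
Proof. by move=> PQ; split=> -[x /PQ h]; exists x. Qed.
Section Meaning.
Variable M : model.
Notation D := (dom M).
Notation Q := (frac (mnat M)).
Notation R := (D N1).
Implicit Types (x y ε : R).

#[local] Hint Rewrite @eval_npred @eval_monus @eval_pow2 @eval_tri @eval_npair @eval_nroot
  @eval_nfst @eval_nsnd @eval_plus @eval_times @eval_0 @eval_1 @eval_wk @eval_Var
  @qvalD @qvalN @qval_abs : evals.
Ltac evals := repeat (progress autorewrite with evals || rewrite -> eval_App).

Lemma eval_rat Γ (a b c : tm Γ N) (e : env D Γ) :
  eval (rat a b c) e = mrat (eval a e) (eval b e) (eval c e).
Proof. by rewrite /rat; evals. Qed.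
Lemma eval_qpos Γ (q : tm Γ N) (e : env D Γ) : eval (qpos q) e = mpos (eval q e).
Proof. by rewrite /qpos; evals. Qed.
Lemma eval_qneg Γ (q : tm Γ N) (e : env D Γ) : eval (qneg q) e = mneg (eval q e).
Proof. by rewrite /qneg; evals. Qed.
Lemma eval_qden Γ (q : tm Γ N) (e : env D Γ) : eval (qden q) e = mden (eval q e).
Proof. by rewrite /qden; evals. Qed.
#[local] Hint Rewrite @eval_rat @eval_qpos @eval_qneg @eval_qden : evals.
Lemma eval_qadd Γ (p q : tm Γ N) (e : env D Γ) :
  eval (qadd p q) e = mqadd (eval p e) (eval q e).
Proof. by rewrite /qadd; evals. Qed.
Lemma eval_qopp Γ (q : tm Γ N) (e : env D Γ) : eval (qopp q) e = mqopp (eval q e).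
Proof. by rewrite /qopp; evals. Qed.
Lemma eval_qabs Γ (q : tm Γ N) (e : env D Γ) : eval (qabs q) e = mqabs (eval q e).
Proof. by rewrite /qabs; evals. Qed.
Lemma eval_qhalf Γ (n : tm Γ N) (e : env D Γ) : eval (qhalf n) e = mqhalf (eval n e).
Proof. by rewrite /qhalf; evals. Qed.
#[local] Hint Rewrite @eval_qadd @eval_qopp @eval_qabs @eval_qhalf : evals.

Lemma sat_qlt Γ (p q : tm Γ N) (e : env D Γ) :
  sat (qlt p q) e <-> qval (eval p e) < qval (eval q e).
Proof.
rewrite -qval_lt /mqlhs -!eval_qpos -!eval_qneg -!eval_qden; exact: iff_refl.
Qed.

Definition real x := forall n i, `|qval (x • n) - qval (x • (n + i))| < hpow n :> Q.
Definition rlts x y := exists n, qval (x • n) + (hpow n + hpow n) < qval (y • n) :> Q.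

Lemma sat_is_real Γ (x : tm Γ N1) (e : env D Γ) :
  sat (is_real x) e <-> real (eval x e).
Proof.
rewrite /is_real sat_fall; apply: forall_iff => n.
rewrite sat_fall; apply: forall_iff => i.
by rewrite -> sat_qlt; evals.
Qed.

Lemma sat_rlt Γ (x y : tm Γ N1) (e : env D Γ) :
  sat (rlt x y) e <-> rlts (eval x e) (eval y e).
Proof.
rewrite /rlt sat_fex; apply: exists_iff => n.
by rewrite -> sat_qlt; evals.
Qed.

Definition radds x y : R := Lam (fun n => mqadd (x • (n + 1)) (y • (n + 1))).
Definition ropps x : R := Lam (fun n => mqopp (x • n)).
Definition rsubs x y : R := radds x (ropps y).
Definition rabss x : R := Lam (fun n => mqabs (x • n)).
Definition rconst q : R := Lam (fun _ => q).

Lemma eval_radd Γ (x y : tm Γ N1) (e : env D Γ) :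
  eval (radd x y) e = radds (eval x e) (eval y e).
Proof. by rewrite /radd eval_lam; lam_ext; evals. Qed.
Lemma eval_ropp Γ (x : tm Γ N1) (e : env D Γ) : eval (ropp x) e = ropps (eval x e).
Proof. by rewrite /ropp eval_lam; lam_ext; evals. Qed.
Lemma eval_rsub Γ (x y : tm Γ N1) (e : env D Γ) :
  eval (rsub x y) e = rsubs (eval x e) (eval y e).
Proof. by rewrite /rsub eval_radd eval_ropp. Qed.
Lemma eval_rabs Γ (x : tm Γ N1) (e : env D Γ) : eval (rabs x) e = rabss (eval x e).
Proof. by rewrite /rabs eval_lam; lam_ext; evals. Qed.
Lemma eval_r0 Γ (e : env D Γ) : eval r0 e = rconst (mrat 0 0 0).
Proof. by rewrite /r0 eval_lam; lam_ext; evals. Qed.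
Lemma eval_r1 Γ (e : env D Γ) : eval r1 e = rconst (mrat 1 0 0).
Proof. by rewrite /r1 eval_lam; lam_ext; evals. Qed.

Lemma qval_radds x y n : qval (radds x y • n) = qval (x • (n + 1)) + qval (y • (n + 1)).
Proof. by rewrite LamE ?qvalD //; rep_tac. Qed.
Lemma qval_ropps x n : qval (ropps x • n) = - qval (x • n).
Proof. by rewrite LamE ?qvalN //; rep_tac. Qed.
Lemma qval_rsubs x y n : qval (rsubs x y • n) = qval (x • (n + 1)) - qval (y • (n + 1)).
Proof. by rewrite qval_radds qval_ropps. Qed.
Lemma qval_rabss x n : qval (rabss x • n) = `|qval (x • n)|.
Proof. by rewrite LamE ?qval_abs //; rep_tac. Qed.
Lemma rconstE q n : rconst q • n = q.
Proof. by rewrite LamE //; rep_tac. Qed.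

(** As [rle] denies [rlt], the bounds say that no index witnesses a strict violation. *)
Definition in_units x := real x /\
  (forall n, - (hpow n + hpow n) <= qval (x • n) <= 1 + (hpow n + hpow n)).

Lemma sat_in_unit Γ (x : tm Γ N1) (e : env D Γ) :
  sat (in_unit x) e <-> in_units (eval x e).
Proof.
rewrite /in_unit /rle; rewrite -> !sat_and, !sat_not, sat_is_real, !sat_rlt.
rewrite eval_r0 eval_r1.
split=> [[rx [h0 h1]]|[rx h]]; last first.
  split=> //; split=> -[n]; have := h n; rewrite rconstE ?qval0 ?qval1; lra.
split=> // n; apply/andP; split; rewrite leNgt; apply/negP => lt.
  by apply: h0; exists n; rewrite rconstE qval0; lra.
by apply: h1; exists n; rewrite rconstE qval1; lra.
Qed.

Definition poss ε := real ε /\ exists n, hpow n + hpow n < qval (ε • n) :> Q.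

Lemma rlts0 x : rlts (rconst (mrat 0 0 0)) x <-> exists n, hpow n + hpow n < qval (x • n) :> Q.
Proof. by apply: exists_iff => n; rewrite rconstE qval0 add0r. Qed.

Lemma sat_is_pos Γ (x : tm Γ N1) (e : env D Γ) :
  sat (is_pos x) e <-> poss (eval x e).
Proof. by rewrite /is_pos sat_and sat_is_real sat_rlt eval_r0 rlts0. Qed.

#[local] Hint Rewrite @eval_radd @eval_ropp @eval_rsub @eval_rabs : evals.

Lemma sat_mem Γ (S : tm Γ N2) d (e : env D Γ) :
  sat (mem S d) e <-> eval S e • eval d e = 1.
Proof. by rewrite -eqrE; apply: iff_refl. Qed.

Lemma sat_prec Γ (R : tm Γ (Arr N1 (Arr N1 N))) d d' (e : env D Γ) :
  sat (prec R d d') e <-> eval R e • eval d e • eval d' e = 1.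
Proof. by rewrite -eqrE; apply: iff_refl. Qed.

Lemma sat_le0 Γ (s t : tm Γ N) (e : env D Γ) :
  sat (le0 s t) e <-> iota (eval s e) <= iota (eval t e).
Proof.
rewrite /le0 sat_or /= eqrE iota_lt le_eqVlt; split=> [[->|->]|/orP[/eqP/iota_inj|]].
- by rewrite orbT.
- by rewrite eqxx.
- by right.
- by left.
Qed.

Definition sat_andE Γ (A B : form Γ) (e : env D Γ) := propext (sat_and A B e).
Definition sat_is_realE Γ (x : tm Γ N1) (e : env D Γ) := propext (sat_is_real x e).
Definition sat_rltE Γ (x y : tm Γ N1) (e : env D Γ) := propext (sat_rlt x y e).
Definition sat_in_unitE Γ (x : tm Γ N1) (e : env D Γ) := propext (sat_in_unit x e).
Definition sat_is_posE Γ (x : tm Γ N1) (e : env D Γ) := propext (sat_is_pos x e).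
Definition sat_memE Γ (S : tm Γ N2) (d : tm Γ N1) (e : env D Γ) := propext (sat_mem S d e).
Definition sat_precE Γ (R : tm Γ (Arr N1 (Arr N1 N))) (d d' : tm Γ N1) (e : env D Γ) := propext (sat_prec R d d' e).
Definition sat_le0E Γ (s t : tm Γ N) (e : env D Γ) := propext (sat_le0 s t e).
Lemma sat_Lt0E Γ (s t : tm Γ N) (e : env D Γ) :
  sat (Lt0 s t) e = ltr (eval s e) (eval t e).
Proof. by []. Qed.
#[local] Hint Rewrite @sat_andE @sat_is_realE @sat_rltE @sat_in_unitE @sat_is_posE
  @sat_memE @sat_precE @sat_le0E @sat_Lt0E @sat_Imp : sats.
Ltac sats := autorewrite with sats; evals.

Lemma sat_pos_real_fun Γ (Φ : tm Γ (Arr N1 N1)) (e : env D Γ) :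
  sat (pos_real_fun Φ) e ->
  forall x, real x -> poss (eval Φ e • x).
Proof.
rewrite /pos_real_fun /real_fun; sats; move=> [[h _] k] x rx.
have := h x; have := k x; sats; rewrite eval_r0 rlts0; move=> /(_ rx) p /(_ rx) r.
by split.
Qed.

Hypothesis M_CAU : sat CAU_net (tt : env D []).

Lemma cau_net (S : D N2) (R : D (Arr N1 (Arr N1 N))) (X : D (Arr N1 N1)) :
  (forall d, iota (S • d) <= 1) -> (forall d d', iota (R • d • d') <= 1) ->
  (exists d, S • d = 1) ->
  (forall d, S • d = 1 -> R • d • d = 1) ->
  (forall d d' d'', S • d = 1 -> S • d' = 1 -> S • d'' = 1 ->
     R • d • d' = 1 -> R • d' • d'' = 1 -> R • d • d'' = 1) ->
  (forall d d', S • d = 1 -> S • d' = 1 ->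
     exists d'', S • d'' = 1 /\ R • d • d'' = 1 /\ R • d' • d'' = 1) ->
  (forall d, S • d = 1 -> in_units (X • d)) ->
  (forall ε, poss ε -> exists d, S • d = 1 /\
     forall d' d'', S • d' = 1 -> S • d'' = 1 -> R • d • d' = 1 -> R • d • d'' = 1 ->
       rlts (rabss (rsubs (X • d') (X • d''))) ε) ->
  exists y, real y /\ forall ε, poss ε -> exists d, S • d = 1 /\
    forall d', S • d' = 1 -> R • d • d' = 1 -> rlts (rabss (rsubs (X • d') y)) ε.
Proof.
move=> S1 R1 Sne Rrefl Rtrans Rdir Xu Xc.
have := M_CAU; rewrite /CAU_net; rewrite -> sat_fall; move/(_ S).
rewrite -> sat_fall; move/(_ R); rewrite -> sat_fall; move/(_ X).
rewrite -> sat_Imp, sat_Imp, sat_fex => h; have {h} [|| y] := h.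
- rewrite /net_in_unit /directed /is_set /is_rel.
  repeat (apply/sat_and; split); rewrite ?sat_fall ?sat_fex.
  + by move=> d; sats; rewrite iota1; apply: S1.
  + by move=> d; rewrite -> sat_fall; move=> d'; sats; rewrite iota1; apply: R1.
  + by case: Sne => d Sd; exists d; sats.
  + by move=> d; sats; apply: Rrefl.
  + by move=> d; rewrite -> sat_fall; move=> d'; rewrite -> sat_fall; move=> d''; sats; apply: Rtrans.
  + move=> d; rewrite -> sat_fall; move=> d'; sats; move=> Sd Sd'.
    have [d'' [h1 [h2 h3]]] := Rdir _ _ Sd Sd'.
    by rewrite -> sat_fex; exists d''; sats.
  + by move=> d; sats; apply: Xu.
- rewrite /cauchy sat_fall => ε; sats; rewrite -> sat_fex; move=> /Xc[d [Sd hd]].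
  exists d; sats; split=> //.
  by rewrite -> sat_fall; move=> d'; rewrite -> sat_fall; move=> d''; sats; apply: hd.
sats; move=> [ry hy]; exists y; split=> // ε pε.
move: hy; rewrite /converges_to sat_fall; move/(_ ε); sats; move/(_ pε).
rewrite -> sat_fex; move=> [d]; sats; move=> [Sd hd].
exists d; split=> // d' Sd' Rdd'.
by move: hd; rewrite -> sat_fall; move/(_ d'); sats; apply.
Qed.

Lemma sat_HBU :
  (forall Ψ : D (Arr N1 N1), (forall x, real x -> poss (Ψ • x)) ->
   exists k (Y : D (Arr N N1)),
     (forall i, ltr i k -> in_units (Y • i)) /\
     (forall x, in_units x -> exists i, ltr i k /\
        rlts (rsubs (Y • i) (Ψ • (Y • i))) x /\
        rlts x (radds (Y • i) (Ψ • (Y • i))))) ->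
  sat HBU (tt : env D []).
Proof.
move=> h; rewrite /HBU sat_fall => Ψ; rewrite sat_Imp => /sat_pos_real_fun/h.
move=> [k [Y [YU Yc]]]; rewrite sat_fex; exists k; rewrite sat_fex; exists Y.
apply/sat_and; rewrite !sat_fall; split=> [i|x]; first by sats; apply: YU.
sats; move=> /Yc[i [ik [h1 h2]]].
by rewrite -> sat_fex; exists i; sats.
Qed.
End Meaning.

(** * Decidable tests and the projection of sequences onto [0, 1] *)

Section Tests.
Variable M : model.
Notation D := (dom M).
Notation Q := (frac (mnat M)).
Notation R := (D N1).
Implicit Types (a b c n i k p q : D N) (x y : R).

(** For tests whose truth value is zero, a sum is a conjunction. *)
Definition teq a b := mmonus a b + mmonus b a.
Definition tlt p q := mmonus (mqlhs p q + 1) (mqlhs q p).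
Definition tle p q := mite (tlt q p) 1 0.

Lemma madd_eq0 a b : (a + b == 0) = (a == 0) && (b == 0).
Proof.
apply/eqP/andP => [e|[/eqP-> /eqP->]]; last by rewrite addr0.
have := congr1 (@iota M) e; rewrite iotaD iota0.
have := iota_ge0 a; have := iota_ge0 b => b0 a0 e0.
by split; apply/eqP/iota_inj; rewrite iota0; lra.
Qed.

Lemma m1_neq0b : (1 == 0 :> D N) = false.
Proof. by apply/negbTE/m1_neq0. Qed.

Lemma miteE c a b : mite c a b = if c == 0 then a else b.
Proof.
have [->|[k ->]] := mcase c; first by rewrite mite0 eqxx.
by rewrite miteS madd_eq0 m1_neq0b andbF.
Qed.

Lemma mmonus_eq0 a b : (mmonus a b == 0) = (iota a <= iota b).
Proof.
apply/eqP/idP => [/(congr1 (@iota M))|le].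
  by rewrite iota_monus iota0; case: lerP => h; lra.
by apply: iota_inj; rewrite iota_monus iota0; case: lerP => h; lra.
Qed.

Lemma teqE a b : (teq a b == 0) = (a == b).
Proof.
rewrite madd_eq0 !mmonus_eq0 -eq_le.
by apply/eqP/eqP => [/iota_inj|->].
Qed.

Lemma tltE p q : (tlt p q == 0) = (qval p < qval q).
Proof.
rewrite mmonus_eq0 iotaD iota1; apply/idP/idP => [h|/qval_lt/iota_lt/iota_succ //].
by apply/qval_lt/iota_lt; lra.
Qed.

Lemma tleE p q : (tle p q == 0) = (qval p <= qval q).
Proof.
rewrite /tle miteE tltE; case: ltP => _; last by rewrite eqxx.
by rewrite m1_neq0b.
Qed.

Lemma rep_comp σ τ Γ (F : D σ -> D τ) (a : env D Γ -> D σ) :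
  rep (fun e : env D [σ] => F e.1) -> rep a -> rep (fun e => F (a e)).
Proof.
move=> rF ra.
have -> : (fun e => F (a e)) = (fun e => Lam F • a e).
  by apply: funext => e; rewrite LamE.
by apply: rep_ap => //; apply: rep_const.
Qed.

(** Turns a bounded universal quantifier into a term, which lets the condition on all links of a
    chain enter a characteristic function. *)
Lemma msum_eq0 (F : D N -> D N) k : rep (fun e : env D [N] => F e.1) ->
  mrec (fun i r => r + F i) 0 k = 0 <-> forall i, ltr i k -> F i = 0.
Proof.
move=> rF; move: k; apply: nat_ind.
- have rF' Γ (a : env D Γ -> D N) : rep a -> rep (fun e => F (a e)).
    exact: rep_comp.
  by apply: definable_and; def_tac; apply: rF'; rep_tac.
- rewrite mrec0; split=> // _ i /iota_lt; rewrite iota0 => lt.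
  by have := iota_ge0 i => i0; exfalso; lra.
- move=> k [IH1 IH2].
  have -> : mrec (fun i r => r + F i) 0 (k + 1) = mrec (fun i r => r + F i) 0 k + F k.
    by rewrite mrecS //; rep_tac; apply: (rep_comp rF); rep_tac.
  split=> [/eqP|h].
    rewrite madd_eq0 => /andP[/eqP/IH1 h /eqP Fk] i ik.
    have [/h//|[->//|ki]] := ltr_total i k.
    by exfalso; move: ki ik; rewrite !iota_lt => /iota_succ; rewrite iotaD iota1; lra.
  rewrite IH2 ?add0r => [|i ik]; apply: h; rewrite iota_lt iotaD iota1; first lra.
  by move: ik; rewrite iota_lt; lra.
Qed.

Definition clampQ (lo hi z : Q) : Q := if z < lo then lo else if hi < z then hi else z.
Definition mclamp lo hi a := mite (tlt a lo) lo (mite (tlt hi a) hi a).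

Lemma qval_clamp lo hi a : qval (mclamp lo hi a) = clampQ (qval lo) (qval hi) (qval a).
Proof. by rewrite /mclamp /clampQ !miteE !tltE; case: ifP => //; case: ifP. Qed.

Lemma definable_eqQ Γ (f g : env D Γ -> Q) : repQ f -> repQ g ->
  definable (fun e => f e = g e).
Proof.
move=> rf rg; apply: (@definable_iff _ _ (fun e => f e <= g e /\ g e <= f e)).
  by move=> e; split=> [[h k]|->//]; apply/eqP; rewrite eq_le h k.
by apply: definable_and; apply: definable_leQ.
Qed.

Definition q0 : D N := mrat 0 0 0.
Definition q1 : D N := mrat 1 0 0.

Lemma qval_q0 : qval q0 = 0 :> Q. Proof. exact: qval0. Qed.
Lemma qval_q1 : qval q1 = 1 :> Q. Proof. exact: qval1. Qed.

Definition hat_step x i r :=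
  mclamp (mqadd r (mqopp (mqhalf (i + 1 + 1)))) (mqadd r (mqhalf (i + 1 + 1)))
    (mclamp q0 q1 (x • (i + 1 + 1 + 1 + 1))).
(** Being a real is undecidable, so membership in an index set cannot test it.
    Following [x] with [n]-th step at most [2^-(n+2)] instead turns every sequence
    [x] into a real in [0, 1], which is the projection of [x] if [x] is a real. *)
Definition hat x : R :=
  Lam (fun n => mrec (hat_step x) (mclamp q0 q1 (x • (0 + 1 + 1 + 1))) n).

End Tests.

Section RepTests.
Variables (M : model) (Γ : ctx).
Notation D := (dom M).
Notation R := (D N1).
Implicit Types f g h : env D Γ -> D N.

Lemma rep_teq f g : rep f -> rep g -> rep (fun e => teq (f e) (g e)).
Proof. by move=> *; rewrite /teq; rep_tac. Qed.
Lemma rep_tlt f g : rep f -> rep g -> rep (fun e => tlt (f e) (g e)).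
Proof. by move=> *; rewrite /tlt; rep_tac. Qed.
Lemma rep_tle f g : rep f -> rep g -> rep (fun e => tle (f e) (g e)).
Proof. by move=> *; rewrite /tle; apply: rep_mite; rep_tac; apply: rep_tlt. Qed.
Lemma rep_mclamp f g h : rep f -> rep g -> rep h -> rep (fun e => mclamp (f e) (g e) (h e)).
Proof. by move=> *; rewrite /mclamp /tlt; rep_tac. Qed.
End RepTests.

Ltac rep_test := lazymatch goal with
  | |- rep (fun _ => teq _ _) => apply: rep_teq
  | |- rep (fun _ => tlt _ _) => apply: rep_tlt
  | |- rep (fun _ => tle _ _) => apply: rep_tle
  | |- rep (fun _ => mclamp _ _ _) => apply: rep_mclamp
  | |- _ => rep_rat
  end.
Ltac rep_ext ::= rep_test.

Section Hat.
Variable M : model.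
Notation D := (dom M).
Notation Q := (frac (mnat M)).
Notation R := (D N1).
Implicit Types (a b c n i k p q : D N) (x y : R).

Lemma rep_hat_step Γ (f : env D Γ -> R) g h :
  rep f -> rep g -> rep h -> rep (fun e => hat_step (f e) (g e) (h e)).
Proof. by move=> *; rewrite /hat_step; rep_tac. Qed.

Lemma rep_hatC : rep (fun e : env D [N1] => hat e.1).
Proof.
rewrite /hat; rep_tac.
by apply: rep_hat_step; rep_tac.
Qed.

Lemma rep_hat Γ (f : env D Γ -> R) : rep f -> rep (fun e => hat (f e)).
Proof. exact: rep_comp rep_hatC. Qed.

Lemma hatE x n : hat x • n = mrec (hat_step x) (mclamp (q0 M) (q1 M) (x • (0 + 1 + 1 + 1))) n.
Proof. by rewrite LamE //; rep_tac; apply: rep_hat_step; rep_tac. Qed.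

Lemma hat0 x : qval (hat x • 0) = clampQ 0 1 (qval (x • (0 + 1 + 1 + 1))).
Proof. by rewrite hatE mrec0; rewrite -> qval_clamp, qval_q0, qval_q1. Qed.

Lemma hatS x n : qval (hat x • (n + 1)) =
  clampQ (qval (hat x • n) - hpow (n + 1 + 1)) (qval (hat x • n) + hpow (n + 1 + 1))
    (clampQ 0 1 (qval (x • (n + 1 + 1 + 1 + 1)))).
Proof.
rewrite !hatE mrecS; last by apply: rep_hat_step; rep_tac.
by rewrite /hat_step; rewrite -> !qval_clamp, !qvalD, qvalN, qval_q0, qval_q1.
Qed.

Lemma clampQ_bounds (lo hi z : Q) : lo <= hi -> lo <= clampQ lo hi z <= hi.
Proof. by move=> le; rewrite /clampQ; case: ltP => h; [|case: ltP => k]; lra. Qed.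

Lemma hat_bounds x n : 0 <= qval (hat x • n) <= 1.
Proof.
move: n; apply: nat_ind; first by def_tac.
  by rewrite hat0; apply: clampQ_bounds.
move=> n IH; rewrite hatS.
have := clampQ_bounds (qval (x • (n + 1 + 1 + 1 + 1))) (@ler01 Q).
move: (clampQ 0 1 _) => c cb; have := hpow_gt0 (n + 1 + 1) => h0.
by rewrite /clampQ; case: ltP => h; [|case: ltP => k]; lra.
Qed.

Lemma hat_move x n : `|qval (hat x • n) - qval (hat x • (n + 1))| <= hpow (n + 1 + 1).
Proof.
rewrite hatS; move: (clampQ 0 1 _) => c; have := hpow_gt0 (n + 1 + 1) => h0.
by rewrite ler_norml /clampQ; case: ltP => h; [|case: ltP => k]; lra.
Qed.

Lemma real_hat x : real (hat x).
Proof.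
(* This is the geometric sum of the step bounds 2^-(j+2) for n <= j < n + i. *)
move=> n i; apply: (@le_lt_trans _ _ (hpow (n + 1) - hpow (n + i + 1))); last first.
  by rewrite !hpowS; have := hpow_gt0 n; have := hpow_gt0 (n + i); lra.
move: i; apply: nat_ind; first by def_tac.
  by rewrite addr0 !subrr normr0.
move=> i; rewrite (addrA n) => IH.
have := hat_move x (n + i); move: IH; rewrite !ler_norml !hpowS.
by have := hpow_gt0 n; have := hpow_gt0 (n + i); lra.
Qed.

Lemma in_units_hat x : in_units (hat x).
Proof.
split=> [|n]; first exact: real_hat.
by have := hat_bounds x n; have := hpow_gt0 n; lra.
Qed.

Lemma clampQ_lip (z z' d : Q) : `|z - z'| < d -> `|clampQ 0 1 z - clampQ 0 1 z'| < d.
Proof.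
rewrite !ltr_norml /clampQ.
by case: (ltP z 0) => ?; case: (ltP 1 z) => ?; case: (ltP z' 0) => ?; case: (ltP 1 z') => ?; lra.
Qed.

Lemma clampQ_inside (lo hi z : Q) : lo <= z <= hi -> clampQ lo hi z = z.
Proof. by rewrite /clampQ; case: (ltP z lo) => ?; case: (ltP hi z) => ?; lra. Qed.

(** For a real, the truncated approximations at [n + 3] and [n + 4] differ by less than 2^-(n+3),
    within the permitted step 2^-(n+2), so the restriction on steps never acts. *)
Lemma hat_real x n : real x ->
  qval (hat x • n) = clampQ 0 1 (qval (x • (n + 1 + 1 + 1))).
Proof.
move=> rx; pose c n := mclamp (q0 M) (q1 M) (x • (n + 1 + 1 + 1)).
have cE k : qval (c k) = clampQ 0 1 (qval (x • (k + 1 + 1 + 1))).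
  by rewrite /c; rewrite -> qval_clamp, qval_q0, qval_q1.
rewrite -cE; move: n; apply: nat_ind.
- by apply: definable_eqQ; rewrite /c; repeat repQ_step; rep_ext; rep_tac.
- by rewrite cE hat0.
- move=> n IH; rewrite hatS IH clampQ_inside; first by rewrite cE.
  have := clampQ_lip (rx (n + 1 + 1 + 1) 1); rewrite !cE !hpowS.
  by rewrite ltr_norml; have := hpow_gt0 n; lra.
Qed.

End Hat.

Ltac rep_real := lazymatch goal with
  | |- rep (fun _ => hat _) => apply: rep_hat
  | |- _ => rep_test
  end.
Ltac rep_ext ::= rep_real.

(** * The net of initial segments covered by finitely many intervals *)

Section Reals.
Variable M : model.
Notation D := (dom M).
Notation Q := (frac (mnat M)).
Notation R := (D N1).
Implicit Types (a b c n i k p q : D N) (x y : R).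

Lemma real_dist x n m : real x ->
  `|qval (x • n) - qval (x • m)| < hpow n + hpow m.
Proof.
move=> rx; have hn := hpow_gt0 n; have hm := hpow_gt0 m.
have [/ltr_sub[k ->]|[->|/ltr_sub[k ->]]] := ltr_total n m.
- by have := rx n (k + 1); have := hpow_gt0 (n + (k + 1)); rewrite !ltr_norml; lra.
- by rewrite subrr normr0; lra.
- by have := rx m (k + 1); have := hpow_gt0 (m + (k + 1)); rewrite !ltr_norml; lra.
Qed.

(** The field is archimedean relative to the numbers of the model, which may be nonstandard. *)
Lemma hpow_archimedean p : 0 < qval p -> exists n, hpow n < qval p.
Proof.
have pow_gt n : iota n < iota (mpow2 n).
  apply/iota_lt; move: n; apply: nat_ind; first by def_tac.
    by rewrite mpow20; apply: mlt01.
  move=> n; rewrite mpow2S !iota_lt => /iota_succ; rewrite !iotaD iota1.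
  by have := iota_ge0 n; lra.
have pow0 n : 0 < iota (mpow2 n) by apply: le_lt_trans (pow_gt n); apply: iota_ge0.
(* By discreteness a positive fraction has numerator at least 1, and 2^n > n for [n] the
   denominator. *)
move=> p0; exists (mden p); rewrite hpowE /mden.
move: p0; rewrite /qval mkfracE; move: (mpos p) (mneg p) (msnd p) => a b c.
have c0 := iota_ge0 c; have c1 : 0 < iota c + 1 by lra.
rewrite pmulr_lgt0 ?invr_gt0 // => ab.
have {}ab : iota b + 1 <= iota a by apply: iota_succ; lra.
apply: (@lt_le_trans _ _ (iota c + 1)^-1).
  by rewrite ltf_pV2 ?posrE // -iota1 -iotaD.
by rewrite ler_pdivlMr // mulVf ?lt0r_neq0 //; lra.
Qed.

Definition above (q : Q) x := forall n, q <= qval (x • n) + (hpow n + hpow n).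
Definition below x (q : Q) := forall n, qval (x • n) <= q + (hpow n + hpow n).

Lemma below_or_above x (q : Q) : real x -> below x q \/ above q x.
Proof.
move=> rx; have [|nb] := pselect (below x q); [by left|right] => m.
have [n lt] : exists n, q + (hpow n + hpow n) < qval (x • n).
  apply: contrapT => nex; apply: nb => n; rewrite leNgt; apply/negP => lt.
  by apply: nex; exists n.
have := real_dist n m rx; have := hpow_gt0 n; have := hpow_gt0 m.
by rewrite ltr_norml; lra.
Qed.

Lemma real_rconst q : real (rconst q).
Proof. by move=> n i; rewrite !rconstE subrr normr0; apply: hpow_gt0. Qed.

End Reals.

Section Net.
Variable M : model.
Notation D := (dom M).
Notation Q := (frac (mnat M)).
Notation R := (D N1).
Variable Ψ : D (Arr N1 N1).
Hypothesis Ψ_pos : forall x, real x -> poss (Ψ • x).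
Implicit Types (a b c n i j k p q w : D N) (x y f g d : R).

(** A sequence [f] codes a length [len f], rationals [pt f i] for [i <= len f] and,
    for [i < len f], a real [ctr f i] in [0, 1] and an index [wit f i] at which the
    rational approximations show that [pt f i] and [pt f (i + 1)] lie in the
    interval around [ctr f i]; this makes the chain condition decidable. *)
Definition part j f : R := Lam (fun n => f • mpair j n).
Definition len f : D N := f • mpair 0 0.
Definition pt f i : D N := f • mpair 1 i.
Definition wit f i : D N := f • mpair (1 + 1) i.
Definition ctr f i : R := hat (part (i + 1 + 1 + 1) f).
Definition rad f i : R := Ψ • ctr f i.
Definition top f : D N := pt f (len f).

Definition four q := mqadd (mqadd q q) (mqadd q q).
Definition lower f i :=
  mqadd (mqadd (ctr f i • wit f i) (mqopp (rad f i • wit f i))) (four (mqhalf (wit f i))).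
Definition upper f i :=
  mqadd (mqadd (ctr f i • wit f i) (rad f i • wit f i)) (mqopp (four (mqhalf (wit f i)))).
Lemma partE j f n : part j f • n = f • mpair j n.
Proof. by rewrite LamE //; rep_tac. Qed.

Definition linkbad f i :=
  mite (tlt (lower f i) (pt f i)) (tlt (pt f (i + 1)) (upper f i)) 1.
Definition link f i := qval (lower f i) < qval (pt f i) /\ qval (pt f (i + 1)) < qval (upper f i).

(** The condition that the last point lies in [0, 1] is kept apart, because the chain that yields
    the cover ends above 1. *)
Definition good f := (forall i, ltr i (len f) -> link f i) /\ qval (pt f 0) <= 0.

Lemma linkbadE f i : linkbad f i = 0 <-> link f i.
Proof.
rewrite /linkbad /link miteE tltE; case: ifP => [h|nh].
  by rewrite (rwP eqP) tltE; split=> [|[]].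
by split=> [/eqP|[]//]; rewrite m1_neq0b.
Qed.

Lemma qval_four q : qval (four q) = qval q + qval q + (qval q + qval q).
Proof. by rewrite /four; rewrite -> !qvalD. Qed.

Lemma qval_lower f i : qval (lower f i) = qval (ctr f i • wit f i) - qval (rad f i • wit f i)
  + (hpow (wit f i) + hpow (wit f i) + (hpow (wit f i) + hpow (wit f i))).
Proof. by rewrite /lower; rewrite -> !qvalD, qvalN, qval_four. Qed.

Lemma qval_upper f i : qval (upper f i) = qval (ctr f i • wit f i) + qval (rad f i • wit f i)
  - (hpow (wit f i) + hpow (wit f i) + (hpow (wit f i) + hpow (wit f i))).
Proof. by rewrite /upper; rewrite -> !qvalD, qvalN, qval_four. Qed.

Definition defect f : D N :=
  mrec (fun i r => r + linkbad f i) 0 (len f) + tle (pt f 0) (q0 M) +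
  (tle (q0 M) (top f) + tle (top f) (q1 M)).

Section Rep.
Variable Γ : ctx.
Implicit Types (F : env D Γ -> R) (I : env D Γ -> D N).
Lemma rep_part I F : rep I -> rep F -> rep (fun e => part (I e) (F e)).
Proof.
move=> rI rF; rewrite /part; apply: rep_Lam; apply: rep_ap.
  exact: rep_snd.
by apply: rep_mpair; [apply: rep_snd|rep_tac].
Qed.
Lemma rep_pt F I : rep F -> rep I -> rep (fun e => pt (F e) (I e)).
Proof. by move=> *; rewrite /pt; rep_tac. Qed.
Lemma rep_wit F I : rep F -> rep I -> rep (fun e => wit (F e) (I e)).
Proof. by move=> *; rewrite /wit; rep_tac. Qed.
Lemma rep_len F : rep F -> rep (fun e => len (F e)).
Proof. by move=> *; rewrite /len; rep_tac. Qed.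
Lemma rep_ctr F I : rep F -> rep I -> rep (fun e => ctr (F e) (I e)).
Proof. by move=> *; rewrite /ctr; apply: rep_hat; apply: rep_part; rep_tac. Qed.
Lemma rep_rad F I : rep F -> rep I -> rep (fun e => rad (F e) (I e)).
Proof. by move=> *; rewrite /rad; rep_tac; apply: rep_ctr. Qed.
Lemma rep_top F : rep F -> rep (fun e => top (F e)).
Proof. by move=> rF; apply: rep_pt => //; apply: rep_len. Qed.
Lemma rep_lower F I : rep F -> rep I -> rep (fun e => lower (F e) (I e)).
Proof.
by move=> *; rewrite /lower /four; rep_tac; (apply: rep_ctr || apply: rep_rad || apply: rep_wit).
Qed.
Lemma rep_upper F I : rep F -> rep I -> rep (fun e => upper (F e) (I e)).
Proof.
by move=> *; rewrite /upper /four; rep_tac; (apply: rep_ctr || apply: rep_rad || apply: rep_wit).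
Qed.
Lemma rep_linkbad F I : rep F -> rep I -> rep (fun e => linkbad (F e) (I e)).
Proof.
move=> *; rewrite /linkbad; rep_tac.
- exact: rep_lower.
- exact: rep_pt.
- by apply: rep_pt; rep_tac.
- exact: rep_upper.
Qed.
End Rep.

Lemma rep_defect : rep (fun e : env D [N1] => defect e.1).
Proof.
rewrite /defect; rep_tac.
- by apply: rep_linkbad; rep_tac.
- by apply: rep_len; rep_tac.
- by apply: rep_pt; rep_tac.
- by apply: rep_top; rep_tac.
- by apply: rep_top; rep_tac.
Qed.

Lemma defectE f : defect f = 0 <-> good f /\ 0 <= qval (top f) <= 1.
Proof.
rewrite (rwP eqP) !madd_eq0 !tleE; rewrite -> qval_q0, qval_q1.
have rl : rep (fun e : env D [N] => linkbad f e.1).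
  by apply: rep_linkbad; rep_tac.
have := msum_eq0 (len f) rl; rewrite (rwP eqP) => e.
split=> [/andP[/andP[/e h h0] ht]|[[h h0] ht]].
  by split=> //; split=> // i /h/linkbadE.
apply/andP; split=> //; apply/andP; split=> //.
by apply/e => i /h/linkbadE.
Qed.

Lemma real_ctr f i : real (ctr f i).
Proof. exact: real_hat. Qed.

Lemma real_rad f i : real (rad f i).
Proof. by have [] := Ψ_pos (real_ctr f i). Qed.

(** The four units 2^-w in [lower] and [upper] are spent as follows: two on passing from index [w]
    to [w + 2] in the centre and the radius, one on [above] or [below] at index [w + 1], and one on
    the margin that [rlt] demands there. *)
Lemma link_cover f i x : link f i -> real x ->
  above (qval (pt f i)) x -> below x (qval (pt f (i + 1))) ->
  rlts (rsubs (ctr f i) (rad f i)) x /\ rlts x (radds (ctr f i) (rad f i)).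
Proof.
rewrite /link qval_lower qval_upper; set w := wit f i => -[lo hi] rx ax bx.
have := real_ctr f i w (1 + 1); have := real_rad f i w (1 + 1).
have := ax (w + 1); have := bx (w + 1); have := hpow_gt0 w.
rewrite (addrA w) !ltr_norml hpowS => *.
by split; exists (w + 1); rewrite hpowS; [rewrite qval_rsubs|rewrite qval_radds]; lra.
Qed.

(** A crossing argument: the first point not known to lie below [x] ends a link that contains [x].
    The points of a chain need not increase. *)
Lemma locate f x k : real x -> above (qval (pt f 0)) x ->
  above (qval (pt f k)) x \/
  exists i, [/\ ltr i k, above (qval (pt f i)) x & below x (qval (pt f (i + 1)))].
Proof.
move=> rx x0.
(* Binary conjunctions, so that the induction predicate is recognised as definable. *)
have : above (qval (pt f k)) x \/
  exists i, ltr i k /\ above (qval (pt f i)) x /\ below x (qval (pt f (i + 1))).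
  move: k; apply: nat_ind.
  - by rewrite /above /below; def_tac; apply: rep_pt; rep_tac.
  - by left.
  - move=> k [ak|[i [ik h]]]; last first.
      by right; exists i; split=> //; apply: ltr_trans ik _; apply/iota_lt; rewrite iotaD iota1; lra.
    have [bk|ak'] := below_or_above (qval (pt f (k + 1))) rx; last by left.
    by right; exists k; split=> //; apply/iota_lt; rewrite iotaD iota1; lra.
by move=> [|[i [? [? ?]]]]; [left|right; exists i].
Qed.

Lemma cover f : good f -> 1 < qval (top f) ->
  exists k (Y : D (Arr N N1)),
   (forall i, ltr i k -> in_units (Y • i)) /\
   (forall x, in_units x -> exists i, ltr i k /\
      rlts (rsubs (Y • i) (Ψ • (Y • i))) x /\
      rlts x (radds (Y • i) (Ψ • (Y • i)))).
Proof.
move=> [lf f0] f1; exists (len f), (Lam (fun i => ctr f i)).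
have YE i : Lam (fun i => ctr f i) • i = ctr f i.
  by rewrite LamE //; apply: rep_ctr; rep_tac.
split=> [i _|x [rx x01]]; first by rewrite YE; apply: in_units_hat.
have a0 : above (qval (pt f 0)) x.
  by move=> n; have := x01 n; have := hpow_gt0 n; lra.
have [atop|[i [il ai bi]]] := locate (len f) rx a0.
- have [n] : exists n, hpow n < qval (mqadd (top f) (mqopp (q1 M))).
    by apply: hpow_archimedean; rewrite qvalD qvalN qval_q1; lra.
  rewrite qvalD qvalN qval_q1.
  (* At index [n + 2] the two error bounds add up to 2^-n, less than the distance from 1 to
     [top f]. *)
  have := x01 (n + 1 + 1); have := atop (n + 1 + 1); rewrite !hpowS /top.
  by have := hpow_gt0 n; lra.
- by exists i; rewrite YE; split=> //; apply: link_cover => //; apply: lf.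
Qed.

(** Appends a link with centre [hat y], witness index [w] and end point [p]. Columns 0, 1 and 2 hold
    length, points and witnesses, so the centre of the new link number [len f] is column
    [len f + 3], stored as the raw sequence [y]. *)
Definition extend f y p w : R :=
  Lam (fun s => mite (teq (mfst s) 0) (len f + 1)
    (mite (teq (mfst s) 1 + teq (msnd s) (len f + 1)) p
    (mite (teq (mfst s) (1 + 1) + teq (msnd s) (len f)) w
    (mite (teq (mfst s) (len f + 1 + 1 + 1)) (y • msnd s) (f • s))))).

Lemma teq2E a b c k : (teq a b + teq c k == 0) = (a == b) && (c == k).
Proof. by rewrite madd_eq0 !teqE. Qed.

Lemma extendE f y p w j n : extend f y p w • mpair j n =
  if j == 0 then len f + 1
  else if (j == 1) && (n == len f + 1) then p
  else if (j == 1 + 1) && (n == len f) then w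
  else if j == len f + 1 + 1 + 1 then y • n else f • mpair j n.
Proof.
rewrite /extend LamE; last first.
  by rep_tac; rewrite /teq; rep_tac.
by rewrite !mfst_pair !msnd_pair !miteE !teq2E !teqE.
Qed.

Lemma iota_lt_neq a b : iota a < iota b -> (a == b) = false.
Proof. by move=> lt; apply/negbTE/eqP => e; move: lt; rewrite e ltxx. Qed.

Section Extend.
Variables (f y : R) (p w : D N).
Let f' := extend f y p w.

Lemma len_extend : len f' = len f + 1.
Proof. by rewrite /len extendE eqxx. Qed.

Lemma pt_extend i : pt f' i = if i == len f + 1 then p else pt f i.
Proof.
rewrite /pt extendE m1_neq0b eqxx /=; case: ifP => // _.
have k0 := iota_ge0 (len f).
have -> : (1 == 1 + 1 :> D N) = false.
  by apply: iota_lt_neq; rewrite !iotaD iota1; lra.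
have -> : (1 == len f + 1 + 1 + 1 :> D N) = false.
  by apply: iota_lt_neq; rewrite !iotaD iota1; lra.
by [].
Qed.

Lemma wit_extend i : wit f' i = if i == len f then w else wit f i.
Proof.
have k0 := iota_ge0 (len f).
rewrite /wit extendE madd_eq0 m1_neq0b /= eqxx /=.
have -> : (1 + 1 == 1 :> D N) = false.
  by rewrite eq_sym; apply: iota_lt_neq; rewrite !iotaD iota1; lra.
have -> : (1 + 1 == len f + 1 + 1 + 1 :> D N) = false.
  by apply: iota_lt_neq; rewrite !iotaD iota1; lra.
by [].
Qed.

Lemma ctr_extend i : ctr f' i = if i == len f then hat y else ctr f i.
Proof.
have k0 := iota_ge0 (len f); have i0 := iota_ge0 i.
rewrite /ctr; have -> : part (i + 1 + 1 + 1) f' =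
    if i == len f then y else part (i + 1 + 1 + 1) f; last by case: ifP.
apply: ext => n; rewrite partE extendE !madd_eq0 m1_neq0b !andbF /=.
have -> : (i + 1 + 1 + 1 == 1) = false.
  by rewrite eq_sym; apply: iota_lt_neq; rewrite !iotaD iota1; lra.
have -> : (i + 1 + 1 + 1 == 1 + 1) = false.
  by rewrite eq_sym; apply: iota_lt_neq; rewrite !iotaD iota1; lra.
have -> : (i + 1 + 1 + 1 == len f + 1 + 1 + 1) = (i == len f).
  apply/eqP/eqP => [/(congr1 (@iota M))|->//].
  by rewrite !iotaD => e; apply: iota_inj; lra.
by case: ifP => //; rewrite partE.
Qed.

Lemma top_extend : top f' = p.
Proof. by rewrite /top len_extend pt_extend eqxx. Qed.

Lemma good_extend : good f ->
  qval (hat y • w) - qval (Ψ • hat y • w) + (hpow w + hpow w + (hpow w + hpow w))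
    < qval (top f) ->
  qval p < qval (hat y • w) + qval (Ψ • hat y • w) - (hpow w + hpow w + (hpow w + hpow w)) ->
  good f'.
Proof.
have k0 := iota_ge0 (len f).
move=> [lf f0] lo hi; split; last first.
  rewrite pt_extend; have -> // : (0 == len f + 1 :> D N) = false.
  by apply: iota_lt_neq; rewrite iotaD iota0 iota1; lra.
move=> i; rewrite len_extend => ik.
rewrite /link qval_lower qval_upper /rad ctr_extend wit_extend !pt_extend.
have [e|] := eqVneq i (len f).
  rewrite e eqxx; have -> // : (len f == len f + 1 :> D N) = false.
  by apply: iota_lt_neq; rewrite iotaD iota1; lra.
move=> ne; have {}ik : ltr i (len f).
  have [//|[e|]] := ltr_total i (len f); first by rewrite e eqxx in ne.
  by move: ik; rewrite !iota_lt iotaD iota1 => ? /iota_succ ?; exfalso; lra.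
have [lo' hi'] := lf _ ik; move: ik; rewrite iota_lt => /iota_succ ik.
have -> : (i == len f + 1 :> D N) = false.
  by apply: iota_lt_neq; rewrite iotaD iota1; lra.
have -> : (i + 1 == len f + 1 :> D N) = false.
  apply/negbTE/eqP => /(congr1 (@iota M)); rewrite !iotaD => e.
  by move/eqP: ne; apply; apply: iota_inj; lra.
by move: lo' hi'; rewrite qval_lower qval_upper.
Qed.
End Extend.

End Net.

(** * The chains as a Cauchy net, and the cover obtained from its limit *)

Section CauchyNet.
Variable M : model.
Notation D := (dom M).
Notation Q := (frac (mnat M)).
Notation R := (D N1).
Hypothesis M_CAU : sat CAU_net (tt : env D []).
Variable Ψ : D (Arr N1 N1).
Hypothesis Ψ_pos : forall x, real x -> poss (Ψ • x).
Implicit Types (a b c n i j k p q w : D N) (x y f g d : R).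

(** Tests yield 0 for truth, whereas [mem] and [prec] ask for the value 1; subtraction from 1
    converts one into the other and keeps the values at most 1. *)
Definition idx : D N2 := Lam (fun f => mmonus 1 (defect Ψ f)).
Definition ord : D (Arr N1 (Arr N1 N)) :=
  Lam (fun f => Lam (fun g => mmonus 1 (tle (top f) (top g)))).
Definition net : D (Arr N1 N1) := Lam (fun f => rconst (top f)).

Lemma mmonus1_le a : iota (mmonus 1 a) <= 1.
Proof. by have a0 := iota_ge0 a; rewrite iota_monus iota1; case: (lerP (iota a) 1) => ?; lra. Qed.

Lemma mmonus1_eq1 a : mmonus 1 a = 1 <-> a = 0.
Proof.
split=> [/(congr1 (@iota M))|->]; last by rewrite mmonus0.
have a0 := iota_ge0 a; rewrite iota_monus iota1 => e; apply: iota_inj; rewrite iota0.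
by move: e; case: (lerP (iota a) 1) => ?; lra.
Qed.

Lemma idxE f : idx • f = mmonus 1 (defect Ψ f).
Proof. by rewrite LamE //; rep_tac; apply: rep_defect. Qed.

Lemma ordE f g : ord • f • g = mmonus 1 (tle (top f) (top g)).
Proof.
rewrite /ord LamE; last by rep_tac; apply: rep_top; rep_tac.
by rewrite LamE //; rep_tac; apply: rep_top; rep_tac.
Qed.

Lemma netE f : net • f = rconst (top f).
Proof. by rewrite LamE //; rewrite /rconst; rep_tac; apply: rep_top; rep_tac. Qed.

Lemma idxP f : idx • f = 1 <-> good Ψ f /\ 0 <= qval (top f) <= 1.
Proof. by rewrite idxE mmonus1_eq1 defectE. Qed.

Lemma ordP f g : ord • f • g = 1 <-> qval (top f) <= qval (top g).
Proof. by rewrite ordE mmonus1_eq1 (rwP eqP) tleE. Qed.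

Lemma idx_nonempty : exists d, idx • d = 1.
Proof.
(* The chain of length 0 from 0 to 0: the number 0 also codes the rational 0. *)
pose f : R := Lam (fun _ => 0).
have fE n : f • n = 0 by rewrite LamE //; rep_tac.
have z : qval 0 = 0 :> Q.
  have p0 : mpair 0 0 = 0 :> D N.
    by rewrite /mpair !addr0; apply: mtri0.
  by rewrite -(qval0 M) /mrat !p0.
have len0 : len f = 0 by rewrite /len fE.
exists f; apply/idxP; rewrite /good /top /pt len0 !fE z lexx ler01.
by split=> //; split=> // i /iota_lt; rewrite iota0; have := iota_ge0 i => ? ?; exfalso; lra.
Qed.

(** If every chain could be improved by 2^-n0, then 2^n0 + 1 improvements would carry the last point
    beyond 1. *)
Lemma net_nearly_maximal n0 : exists d, idx • d = 1 /\ forall e, idx • e = 1 ->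
  ord • d • e = 1 -> qval (top e) < qval (top d) + hpow n0.
Proof.
apply: contrapT => nex.
have step d : idx • d = 1 -> exists e, idx • e = 1 /\ qval (top d) + hpow n0 <= qval (top e).
  move=> Sd; apply: contrapT => ne; apply: nex; exists d; split=> // e Se _.
  by rewrite ltNge; apply/negP => le; apply: ne; exists e.
(* The bound n * 2^-n0 is given by a code, which makes this existential statement over chains
   definable and open to [IND]. *)
have many n : exists d, idx • d = 1 /\ qval (mrat n 0 (mpred (mpow2 n0))) <= qval (top d).
  move: n; apply: nat_ind.
  - by def_tac; apply: rep_top; rep_tac.
  - have [d Sd] := idx_nonempty; exists d; split=> //.
    by rewrite qval_multiple iota0 mul0r; have [_ /andP[]] := (idxP d).1 Sd.
  - move=> n [d [/step[e [Se le]] nd]]; exists e; split=> //; move: nd.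
    by rewrite !qval_multiple iotaD iota1 mulrDl mul1r; lra.
have [d [/idxP[_ d01]]] := many (mpow2 n0 + 1).
rewrite qval_multiple iotaD iota1 mulrDl mul1r hpowE mulfV; last first.
  by have := hpow_gt0 n0; rewrite hpowE invr_gt0 => /lt0r_neq0.
by rewrite -hpowE; have := hpow_gt0 n0; lra.
Qed.

Lemma net_cauchy ε : poss ε -> exists d, idx • d = 1 /\
  forall e e', idx • e = 1 -> idx • e' = 1 -> ord • d • e = 1 -> ord • d • e' = 1 ->
    rlts (rabss (rsubs (net • e) (net • e'))) ε.
Proof.
(* Beyond [d] the values differ by less than 2^-(n0+2). The margin of [rlts] at index [n0 + 3] is
   again 2^-(n0+2), while ε exceeds 2^-n0 there. *)
move=> [rε [n0 hn0]]; have [d [Sd hd]] := net_nearly_maximal (n0 + 1 + 1).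
exists d; split=> // e e' Se Se' de de'; exists (n0 + (1 + 1 + 1)).
have := hd _ Se de; have := hd _ Se' de'; have := rε n0 (1 + 1 + 1).
move/ordP: de; move/ordP: de'; rewrite qval_rabss qval_rsubs !netE !rconstE.
rewrite !addrA !hpowS !ltr_norml; have := hpow_gt0 n0.
by case: (ger0P (qval (top e) - qval (top e'))) => ?; lra.
Qed.

Lemma poss_rconst q : 0 < qval q -> poss (rconst q).
Proof.
move=> q0; split=> [|]; first exact: real_rconst.
have [n hn] := hpow_archimedean q0; exists (n + 1 + 1).
by rewrite rconstE !hpowS; have := hpow_gt0 n; lra.
Qed.

Lemma clampQ_close (q z e : Q) : 0 <= q <= 1 -> `|q - z| < e -> `|q - clampQ 0 1 z| < e.
Proof.
by rewrite !ltr_norml /clampQ; case: (ltP z 0) => ?; case: (ltP 1 z) => ?; lra.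
Qed.

Theorem cau_net_cover : exists k (Y : D (Arr N N1)),
  (forall i, ltr i k -> in_units (Y • i)) /\
  (forall x, in_units x -> exists i, ltr i k /\
     rlts (rsubs (Y • i) (Ψ • (Y • i))) x /\
     rlts x (radds (Y • i) (Ψ • (Y • i)))).
Proof.
have [||||||||y [ry hy]] := @cau_net M M_CAU idx ord net.
- by move=> d; rewrite idxE; apply: mmonus1_le.
- by move=> d d'; rewrite ordE; apply: mmonus1_le.
- exact: idx_nonempty.
- by move=> d _; apply/ordP.
- by move=> d d' d'' _ _ _ /ordP h /ordP h'; apply/ordP; apply: le_trans h h'.
- move=> d d' Sd Sd'; have [h|h] := leP (qval (top d)) (qval (top d')).
    by exists d'; split=> //; split; apply/ordP.
  by exists d; split=> //; split; apply/ordP => //; apply: ltW.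
- move=> d /idxP[_ d01]; rewrite netE; split=> [|n]; first exact: real_rconst.
  by rewrite rconstE; have := hpow_gt0 n; lra.
- exact: net_cauchy.
have [rc [n0 hc]] := Ψ_pos (real_hat y).
(* Write h for 2^-n0. The radius at [hat y] exceeds h at index [w], the four units 2^-w amount to
   h/8, and [top d] is within 3h/32 of [hat y] at index [w]. So a link centred at [hat y] reaches
   from [top d] past [top d] + h/2. *)
set m := n0 + 1 + 1 + 1 + 1; set w := m + 1.
have Hm : hpow m = hpow n0 / 2%:R / 2%:R / 2%:R / 2%:R by rewrite !hpowS.
have Hw : hpow w = hpow m / 2%:R by rewrite hpowS.
have H0 := hpow_gt0 n0.
have [|d [Sd hd]] := hy (rconst (mqhalf m)).
  by apply: poss_rconst; apply: hpow_gt0.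
have [gd d01] := (idxP d).1 Sd.
(* Values of the net lie in [0, 1], so projecting the limit onto [0, 1] does not take it farther
   from them. *)
have close e n : idx • e = 1 -> ord • d • e = 1 ->
    `|qval (top e) - qval (hat y • n)| < hpow m + hpow n.
  move=> Se /(hd _ Se)[k]; rewrite qval_rabss qval_rsubs netE !rconstE.
  rewrite (hat_real _ ry) -/(hpow m) => lt.
  apply: clampQ_close; first by have [] := (idxP e).1 Se.
  have := real_dist (k + 1) (n + 1 + 1 + 1) ry; move: lt; rewrite !hpowS.
  have := hpow_gt0 k; have := hpow_gt0 n; rewrite !ltr_norml.
  by case: (ger0P (qval (top e) - qval (y • (k + 1)))) => ?; lra.
have dd : ord • d • d = 1 by apply/ordP.
set p := mqadd (top d) (mqhalf (n0 + 1)).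
have pE : qval p = qval (top d) + hpow n0 / 2%:R.
  by rewrite /p; rewrite -> qvalD; rewrite -/(hpow _) hpowS.
have rcw : hpow n0 < qval (Ψ • hat y • w).
  have := rc n0 (1 + 1 + 1 + 1 + 1); rewrite !addrA -/w ltr_norml; lra.
have good' : good Ψ (extend d y p w).
  have := close d w Sd dd; rewrite ltr_norml => dw.
  by apply: good_extend => //; rewrite ?pE Hw; move: dw; rewrite Hw Hm; lra.
(* If [p] were at most 1, the prolonged chain would be an index beyond [d]. Then [p] and [top d]
   would both be within h/8 of [hat y] at index [m], although they differ by h/2. *)
apply: (cover Ψ_pos good'); rewrite top_extend ltNge; apply/negP => p1.
have Se : idx • extend d y p w = 1.
  by apply/idxP; split=> //; rewrite top_extend pE; move: p1; rewrite pE; lra.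
have de : ord • d • extend d y p w = 1 by apply/ordP; rewrite top_extend pE; lra.
have := close _ m Sd dd; have := close _ m Se de.
by rewrite top_extend pE !ltr_norml Hm; lra.
Qed.

End CauchyNet.

Theorem theorem3p20 : RCA0ω ∪ IND ∪ single CAU_net ⊢ HBU.
Proof.
apply: completeness_ext => [B RB|M M_ext MT]; first by left; left.
have MR : models M RCA0ω by move=> B RB; apply: MT; left; left.
have MI : models M IND by move=> B RB; apply: MT; left; right.
have MC : sat CAU_net (tt : env (dom M) []) by apply: MT; right.
apply: (@sat_HBU (Model M_ext MR MI)) => Ψ Ψ_pos.
exact: (@cau_net_cover (Model M_ext MR MI)).
Qed.
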